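(* Let $f$ be a tamely ramified polynomial over a field $K$ with geometric profinite iterated monodromy group $\overline{\mathrm{Arb}}$. If the Frattini subgroup of $\overline{\mathrm{Arb}}$ is open, in either of these cases: (1) $f$ is post-critically infinite; (2) $f$ is unicritical but not conjugate to a powering map; then $\overline{\mathrm{Arb}}$ is pro-$p$ for some prime $p$ and $\deg f$ is a prime power.
   Context: Let $\bar K$ be a separable closure of $K$ and $t$ transcendental over $K$; $f$ is tamely ramified if $\bar K(x)/\bar K(t)$, $f(x)=t$, is tamely ramified. The geometric profinite iterated monodromy group is $\overline{\mathrm{Arb}}\cong\mathrm{Gal}(\bar K(f^{-\infty}(t))/\bar K(t))$, where $f^{-\infty}(t)$ is the set of all solutions of $f^n(x)=t$, $n\ge0$, in a separable closure of $\bar K(t)$. $f$ is post-critically infinite if $\{f^n(c):c\text{ critical},\,n\ge1\}$ is infinite. A polynomial is unicritical if it has exactly one critical point other than $\infty$. A powering map is $x\mapsto x^d$. The Frattini subgroup of a profinite group is the intersection of its maximal open subgroups. *)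

(* Defs.v *)
From HB Require Import structures.
From mathcomp Require Import all_boot all_order all_algebra.
From mathcomp Require Import separable.
From mathcomp Require Import boolp classical_sets functions cardinality topology.

Set Implicit Arguments.
Unset Strict Implicit.
Unset Printing Implicit Defensive.

Import Order.TTheory GRing.Theory Num.Theory.
Local Open Scope classical_set_scope.
Local Open Scope ring_scope.

Definition separably_closed (L : fieldType) : Prop :=
  forall g : {poly L},
    separable_poly g -> (1 < size g)%N -> exists x : L, root g x.

(* A field extension E/F is an embedding phi : {rmorphism F -> E}. *)

Section FieldExtensions.
Variables (F E : fieldType) (phi : {rmorphism F -> E}).

Definition separable_over (x : E) : Prop :=
  exists2 g : {poly F}, separable_poly g & root (map_poly phi g) x.

Definition separable_ext : Prop := forall x : E, separable_over x.

Definition separable_closure : Prop := separable_ext /\ separably_closed E.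

Definition adjoin_pred (S : set E) : {pred E} := fun x =>
  `[< forall D : divringClosed E,
        (forall a, phi a \in D) -> (forall y, S y -> y \in D) -> x \in D >].

Lemma adjoin_predP (S : set E) x :
  reflect (forall D : divringClosed E,
             (forall a, phi a \in D) -> (forall y, S y -> y \in D) -> x \in D)
          (x \in adjoin_pred S).
Proof. exact: asboolP. Qed.

Lemma adjoin_divring_closed (S : set E) : divring_closed (adjoin_pred S).
Proof.
split.
- by apply/adjoin_predP => D _ _; exact: rpred1.
- move=> x y /adjoin_predP Hx /adjoin_predP Hy; apply/adjoin_predP => D HF HS.
  by apply: rpredB; [exact: Hx | exact: Hy].
- move=> x y /adjoin_predP Hx /adjoin_predP Hy; apply/adjoin_predP => D HF HS.
  by apply: rpred_div; [exact: Hx | exact: Hy].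
Qed.

HB.instance Definition _ (S : set E) :=
  GRing.isDivringClosed.Build E (adjoin_pred S) (adjoin_divring_closed S).

(* The subfield F(S) of E, as a field of its own. *)
Record adjoin (S : set E) :=
  Adjoin { adjoin_val : E; _ : adjoin_val \in adjoin_pred S }.

HB.instance Definition _ (S : set E) := [isSub for @adjoin_val S].
HB.instance Definition _ (S : set E) := [Choice of adjoin S by <:].
HB.instance Definition _ (S : set E) :=
  [SubChoice_isSubIntegralDomain of adjoin S by <:].
HB.instance Definition _ (S : set E) :=
  [SubIntegralDomain_isSubField of adjoin S by <:].

Lemma base_adjoin_pred (S : set E) a : phi a \in adjoin_pred S.
Proof. by apply/adjoin_predP => D HF _; exact: HF. Qed.

Definition adjoin_base (S : set E) (a : F) : adjoin S :=
  Adjoin (base_adjoin_pred S a).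

Lemma adjoin_base_zmod (S : set E) : zmod_morphism (adjoin_base S).
Proof. by move=> a b; apply: val_inj; rewrite /= rmorphB. Qed.

Lemma adjoin_base_monoid (S : set E) : monoid_morphism (adjoin_base S).
Proof.
by split=> [|a b]; apply: val_inj; rewrite /= ?rmorph1 ?rmorphM.
Qed.

HB.instance Definition _ (S : set E) :=
  GRing.isZmodMorphism.Build F (adjoin S) (adjoin_base S) (adjoin_base_zmod S).
HB.instance Definition _ (S : set E) :=
  GRing.isMonoidMorphism.Build F (adjoin S) (adjoin_base S)
    (adjoin_base_monoid S).

End FieldExtensions.

HB.mixin Record isTopologicalGroup G & Group G & Topological G := {
  mulg_continuous : continuous (fun x : G * G => (x.1 * x.2)%g);
  invg_continuous : continuous (fun x : G => (x^-1)%g);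
}.

#[short(type="topologicalGroupType")]
HB.structure Definition TopologicalGroup :=
  {G of Group G & Topological G & isTopologicalGroup G}.

Section GaloisGroup.
Variables (F M : fieldType) (phi : {rmorphism F -> M}).

Definition is_galois_auto (s : M -> M) : Prop :=
  [/\ zmod_morphism s, monoid_morphism s, bijective s
    & forall a, s (phi a) = phi a].

Record galois_group :=
  GaloisAuto { galois_fun :> M -> M; _ : `[< is_galois_auto galois_fun >] }.

HB.instance Definition _ := [isSub for galois_fun].
HB.instance Definition _ := [Choice of galois_group by <:].

Lemma galoisP (s : galois_group) : is_galois_auto s.
Proof. by case: s => s /= /asboolP. Qed.

Lemma galois_ext (s t : galois_group) : s =1 t -> s = t.
Proof. by move=> st; apply: val_inj; apply/funext. Qed.

Lemma galois_one_subproof : `[< is_galois_auto (@id M) >].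
Proof. by apply/asboolP; split=> //; exists id. Qed.

Lemma galois_mul_subproof (s t : galois_group) :
  `[< is_galois_auto (s \o t) >].
Proof.
have [sB [s1 sM] sb sF] := galoisP s; have [tB [t1 tM] tb tF] := galoisP t.
apply/asboolP; split.
- by move=> x y /=; rewrite tB sB.
- by split=> [|x y] /=; rewrite ?t1 ?s1 ?tM ?sM.
- exact: bij_comp.
- by move=> a /=; rewrite tF sF.
Qed.

Lemma galois_inv_ex (s : galois_group) :
  exists t : galois_group, cancel s t /\ cancel t s.
Proof.
have [sB [s1 sM] [t st ts] sF] := galoisP s.
have si := can_inj st.
have tP : `[< is_galois_auto t >].
  apply/asboolP; split.
  - by move=> x y; apply: si; rewrite sB !ts.
  - by split=> [|x y]; apply: si; rewrite ?s1 ?sM !ts.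
  - by exists s.
  - by move=> a; apply: si; rewrite ts sF.
by exists (GaloisAuto tP).
Qed.

Definition galois_one := GaloisAuto galois_one_subproof.
Definition galois_mul s t := GaloisAuto (galois_mul_subproof s t).
Definition galois_inv s := sval (cid (galois_inv_ex s)).

Lemma galois_invK (s : galois_group) : cancel (galois_fun s) (galois_inv s).
Proof. by rewrite /galois_inv; case: cid => t []. Qed.

Lemma galois_invKV (s : galois_group) : cancel (galois_inv s) (galois_fun s).
Proof. by rewrite /galois_inv; case: cid => t []. Qed.

Lemma galois_mulA : associative galois_mul.
Proof. by move=> s t u; apply: galois_ext. Qed.
Lemma galois_mul1 : left_id galois_one galois_mul.
Proof. by move=> s; apply: galois_ext. Qed.
Lemma galois_mulr1 : right_id galois_one galois_mul.
Proof. by move=> s; apply: galois_ext. Qed.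
Lemma galois_mulV : left_inverse galois_one galois_inv galois_mul.
Proof. by move=> s; apply: galois_ext => x /=; exact: galois_invK. Qed.
Lemma galois_mulrV : right_inverse galois_one galois_inv galois_mul.
Proof. by move=> s; apply: galois_ext => x /=; exact: galois_invKV. Qed.

HB.instance Definition _ := isGroup.Build galois_group
  galois_mulA galois_mul1 galois_mulr1 galois_mulV galois_mulrV.

(* Krull topology: when M/F is algebraic, the automorphisms agreeing with s on *)
(* a finite subset A of M form the coset s Gal(M/F(A)), with F(A)/F finite.    *)
Definition krull_open (U : set galois_group) : Prop :=
  forall s, U s -> exists A : seq M,
    forall t : galois_group, {in A, galois_fun s =1 galois_fun t} -> U t.

Lemma krull_openT : krull_open setT.
Proof. by move=> s _; exists [::]. Qed.

Lemma krull_openI : setI_closed krull_open.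
Proof.
move=> U V HU HV s [Us Vs]; have [A HA] := HU s Us; have [B HB] := HV s Vs.
exists (A ++ B) => t st; split; [apply: HA | apply: HB] => x xA;
  by apply: st; rewrite mem_cat xA ?orbT.
Qed.

Lemma krull_open_bigU (I : Type) (U : I -> set galois_group) :
  (forall i, krull_open (U i)) -> krull_open (\bigcup_i U i).
Proof.
move=> HU s [i _ Us]; have [A HA] := HU i s Us.
by exists A => t /HA ?; exists i.
Qed.

HB.instance Definition _ := isOpenTopological.Build galois_group
  krull_openT krull_openI krull_open_bigU.

Lemma open_krullE (U : set galois_group) : open U <-> krull_open U.
Proof. by []. Qed.

Lemma krull_nbhs (s : galois_group) (A : seq M) :
  nbhs s [set t : galois_group | {in A, galois_fun s =1 galois_fun t}].
Proof.
apply: open_nbhs_nbhs; split=> //; apply/open_krullE => t st.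
by exists A => u tu x xA; rewrite st // tu.
Qed.

Lemma galois_mul_continuous :
  continuous (fun x : galois_group * galois_group => (x.1 * x.2)%g).
Proof.
move=> [s t] W; rewrite {1}nbhsE => -[V [/open_krullE/(_ (s * t)%g) HV Vst] sVW].
have {HV} [A HA] := HV Vst.
exists ([set s' : galois_group |
           {in [seq t x | x <- A], galois_fun s =1 galois_fun s'}],
        [set t' : galois_group | {in A, galois_fun t =1 galois_fun t'}]).
  by split; exact: krull_nbhs.
move=> [s' t'] [/= ss' tt']; apply: sVW; apply: HA => x xA /=.
by rewrite -tt' // -ss' // map_f.
Qed.

Lemma galois_inv_continuous :
  continuous (fun x : galois_group => (x^-1)%g).
Proof.
move=> s W; rewrite {1}nbhsE => -[V [/open_krullE/(_ (s^-1)%g) HV Vs] sVW].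
have {HV} [A HA] := HV Vs.
apply: filterS (krull_nbhs s [seq galois_inv s x | x <- A]) => t st.
apply: sVW; apply: HA => x xA.
have /st : galois_inv s x \in [seq galois_inv s x | x <- A] by exact: map_f.
rewrite galois_invKV => {2}->.
by change (galois_inv s x = galois_inv t (t (galois_inv s x))); rewrite galois_invK.
Qed.

HB.instance Definition _ := isTopologicalGroup.Build galois_group
  galois_mul_continuous galois_inv_continuous.

End GaloisGroup.

Section ProfiniteNotions.
Variable G : topologicalGroupType.

Definition open_subgroup (H : set G) : Prop :=
  group_closed (mem H) /\ open H.

Definition maximal_open_subgroup (H : set G) : Prop :=
  [/\ open_subgroup H, H <> setT
    & forall H' : set G, open_subgroup H' -> H `<=` H' -> H' = H \/ H' = setT].

Definition frattini : set G :=
  \bigcap_(H in maximal_open_subgroup) H.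

Definition normal_subset (H : set G) : Prop :=
  forall g h, H h -> H (h ^ g)%g.

Definition left_cosets (H : set G) : set (set G) :=
  range (fun g => [set (g * h)%g | h in H]).

Definition pro_p (p : nat) : Prop :=
  forall N : set G, open_subgroup N -> normal_subset N ->
    exists n : nat, (left_cosets N #= `I_(p ^ n)%N)%card.

End ProfiniteNotions.

Arguments frattini : clear implicits.
Arguments pro_p : clear implicits.

(* A valuation w is only meaningful away from 0: w 0 is a junk value. *)
Section TameRamification.
Variable L : fieldType.

Definition discrete_valuation (w : L -> int) : Prop :=
  [/\ forall x y : L, x != 0 -> y != 0 -> w (x * y) = w x + w y,
      forall x y : L, x != 0 -> y != 0 -> x + y != 0 ->
        Num.min (w x) (w y) <= w (x + y)
    & exists2 x : L, x != 0 & w x = 1].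

Definition valuation_ring (w : L -> int) : set L :=
  [set x | x = 0 \/ 0 <= w x].

Definition valuation_ideal (w : L -> int) : set L :=
  [set x | x = 0 \/ 0 < w x].

(* r identifies the residue field of w with kappa; its values outside the *)
(* valuation ring are irrelevant.                                         *)
Definition residue_map (w : L -> int) (kappa : fieldType) (r : L -> kappa) :=
  [/\ r 1 = 1,
      forall x y, valuation_ring w x -> valuation_ring w y ->
        r (x + y) = r x + r y /\ r (x * y) = r x * r y,
      forall x, valuation_ring w x -> (r x = 0 <-> valuation_ideal w x)
    & forall z, exists2 x, valuation_ring w x & r x = z].

Variables (F : fieldType) (phi : {rmorphism F -> L}).

Definition ramification_index (w : L -> int) (e : nat) : Prop :=
  (0 < e)%N /\
  forall n : int, (exists2 a : F, a != 0 & w (phi a) = n) <-> (e %| n)%Z.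

(* The residue field of w restricted to F is the image under r of the elements *)
(* of F that are integral for w.                                               *)
Definition residually_separable (w : L -> int) (kappa : fieldType)
    (r : L -> kappa) : Prop :=
  forall z : kappa, exists g : {poly kappa},
    [/\ forall i : nat, exists2 a : F, valuation_ring w (phi a) & r (phi a) = g`_i,
        separable_poly g & root g z].

Definition tame_at (w : L -> int) : Prop :=
  exists e : nat, ramification_index w e /\
  exists (kappa : fieldType) (r : L -> kappa),
    [/\ residue_map w r, e%:R != 0 :> kappa & residually_separable w r].

(* L/F is an extension of function fields with constants embedded by c; the *)
(* places of L are the discrete valuations that are trivial on constants.   *)
Definition tamely_ramified_ext (k : fieldType) (c : {rmorphism k -> L}) : Prop :=
  separable_ext phi /\
  forall w : L -> int, discrete_valuation w ->
    (forall a, a != 0 -> w (c a) = 0) -> tame_at w.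

End TameRamification.

Notation ratfun k := {fraction {poly k}}.

Definition ratfun_const (k : fieldType) : {rmorphism k -> ratfun k} :=
  @tofrac {poly k} \o polyC.

Definition ratfun_var (k : fieldType) : ratfun k := tofrac ('X : {poly k}).

Section Polynomials.
Variables (K Kbar : fieldType) (iota : {rmorphism K -> Kbar}) (f : {poly K}).

(* phi is Kbar(t) -> Kbar(x), t |-> f(x); it exists only if f is nonconstant. *)
Definition tamely_ramified : Prop :=
  exists phi : {rmorphism ratfun Kbar -> ratfun Kbar},
    [/\ forall a, phi (ratfun_const Kbar a) = ratfun_const Kbar a,
        phi (ratfun_var Kbar) = tofrac (map_poly iota f)
      & tamely_ramified_ext phi (ratfun_const Kbar)].

(* Finite critical points.  Tameness forces every critical point to be       *)
(* separable over K, and the critical point at infinity is fixed by f, so    *)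
(* the forward orbits of these points decide post-critical finiteness.       *)
Definition critical_point (c : Kbar) : Prop := root (map_poly iota f)^`() c.

Definition post_critical_set : set Kbar :=
  [set y | exists c n, [/\ critical_point c, (0 < n)%N
                         & y = iter n (horner (map_poly iota f)) c]].

Definition post_critically_infinite : Prop := infinite_set post_critical_set.

Definition unicritical : Prop := exists! c, critical_point c.

(* Conjugacy over some extension field of K, equivalently over an algebraic   *)
(* closure of K.  A separable closure would not do in characteristic p: if u  *)
(* is not a p-th power there, u x^(p+1) becomes conjugate to x^(p+1) only     *)
(* after extracting a p-th root of u.  A Moebius map conjugating polynomials  *)
(* can be taken affine here.                                                  *)
Definition conjugate_to_powering_map : Prop :=
  exists (E : fieldType) (phi : {rmorphism K -> E}) (a b : E) (d : nat),
    a != 0 /\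
    let m := a *: 'X + b%:P in map_poly phi f \Po m = m \Po 'X^d.

Variables (Omega : fieldType) (j : {rmorphism ratfun Kbar -> Omega}).

Definition backward_orbit : set Omega :=
  [set y | exists n : nat,
     iter n (horner (map_poly (j \o ratfun_const Kbar \o iota) f)) y
       = j (ratfun_var Kbar)].

(* Gal(Kbar(f^{-infinity}(t)) / Kbar(t)), inside the extension Omega of Kbar(t). *)
Definition arboreal_group : topologicalGroupType :=
  galois_group (adjoin_base j backward_orbit).

End Polynomials.

Definition prime_power (n : nat) : Prop :=
  exists p k : nat, [/\ prime p, (0 < k)%N & n = (p ^ k)%N].

(* Main.v *)
(** Tameness forces deg f and the multiplicities of the critical points to be
    prime to the characteristic, and the critical points to lie in Kbar.  If the
    Frattini subgroup Phi is open, it contains the pointwise stabilizer St(k) of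
    some level k of the tree of iterated preimages of t; as Frattini subgroups
    of finite groups are nilpotent, St(k) acts on every level through a
    nilpotent group.  Replacing t by a Laurent series with a given leading term
    embeds the tower locally and produces inertia elements: at infinity, one
    acting on each level as a full cycle; at a finite branch point, one fixing
    all vertices but those above the branch.

    If f = a (X - c)^d + b with b <> c and d is a power of p, then g^(d^n) acts
    trivially on level n for all g, so the group is pro-p.  If two distinct
    primes divide d, one of them odd, some element fixes a vertex u of level k
    and rotates the d children of exactly one child of u; its commutator with
    the odd part of a power of the cycle at infinity contradicts nilpotence.

    A critical point with infinite orbit is impossible.  Take such a point c
    for which b = f^(k+1)(c) is not a critical value of f^k.  Inertia above b
    at c lies in St(k), hence in Phi, and moves some x in level k+1.  The block
    structure of a nilpotent group containing a full cycle yields, as in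
    Lueroth's theorem, polynomials k and K with
    K(X) - K(c) = C (k(X) - k(c))^p, where p divides the ramification index.
    It follows that t - b = beta^p in the tower.  The stabilizer of beta is then
    a maximal open subgroup, so Phi fixes beta, whereas the inertia element
    multiplies beta by a nontrivial root of unity. *)

From HB Require Import structures.
Require Import Defs.
From mathcomp Require Import all_boot all_order all_algebra all_fingroup all_solvable.

Set Implicit Arguments.
Unset Strict Implicit.
Unset Printing Implicit Defensive.

(** * Nilpotent permutation groups *)

(** The Laurent series field and [Omega] are unrelated extensions, neither given inside the other.
    They are compared through a partial isomorphism, kept as its graph: series algebraic over the
    embedded rational functions are matched with elements of [Omega], and a substitution [X -> w X],
    with [w] a root of unity, is carried over and extended to a Galois automorphism. The series
    assigned to [t], or to a chosen vertex, is prepared so that the relevant preimages are again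
    series in the same [X]; no Puiseux series occur. [Kbar] is only separably closed, so each root
    that is extracted needs an exponent that is nonzero in [Kbar], or a simple root for Hensel's
    lemma. Tameness supplies both. Group theory is applied only to finite permutation groups on one
    level: the first level beyond [k] for a critical point with infinite orbit, the second in the
    unicritical case. There the image of [St(k)] is nilpotent, and inertia provides explicit
    elements of it or of its normalizer. *)

Section FiniteGroups.
Import GroupScope.

Lemma Phi_nilpotent (gT : finGroupType) (G : {group gT}) : nilpotent 'Phi(G).
Proof.
have FP (p : nat) (P : {group gT}) : p.-Sylow('Phi(G)) P -> P \subset 'F('Phi(G)).
  move=> sylP; have sPP := pHall_sub sylP.
  have nP : G \subset 'N(P).
    have := Frattini_arg (Phi_normal G) sylP => E.
    have /Phi_nongen <- : 'Phi(G) <*> 'N_G(P) = G.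
      by apply/eqP; rewrite eqEsubset join_subG Phi_sub subsetIl -{1}E mulG_subG joing_subl joing_subr.
    by rewrite gen_subG subsetIr.
  apply: Fitting_max; last exact: pgroup_nil (pHall_pgroup sylP).
  by rewrite /normal sPP (subset_trans (Phi_sub G)).
have : #|'Phi(G)| %| #|'F('Phi(G))|.
  apply/dvdn_partP => [|p _]; first exact: cardG_gt0.
  have [P sylP] := Sylow_exists p 'Phi(G).
  by rewrite -(card_Hall sylP) cardSg // (FP p).
move=> /dvdn_leq -/(_ (cardG_gt0 _)) le.
have /eqP -> : 'Phi(G) == 'F('Phi(G)) by rewrite eq_sym eqEcard Fitting_sub.
exact: Fitting_nil.
Qed.

Section Orbits.
Variables (T : finType) (R : {group {perm T}}).

Lemma orbit_permP (x y : T) :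
  reflect (exists2 s, s \in R & y = s x) (y \in orbit 'P R x).
Proof.
by apply: (iffP orbitP) => -[s sR /= sx]; exists s; rewrite // -?sx.
Qed.

Lemma orbit_norm (s : {perm T}) (x y : T) : s \in 'N(R) ->
  y \in orbit 'P R x -> s y \in orbit 'P R (s x).
Proof.
move=> sN /orbit_permP[r rR ->]; apply/orbit_permP; exists (r ^ s).
  by rewrite memJ_norm.
by rewrite !permM permK.
Qed.

Lemma orbit_coset (s s' : {perm T}) (x : T) : s \in 'N(R) -> s' \in 'N(R) ->
  coset R s = coset R s' -> s x \in orbit 'P R (s' x).
Proof.
move=> sN s'N E; apply/orbit_permP; exists (s'^-1 * s).
  by apply: coset_idr; rewrite ?groupM ?groupV // morphM ?groupV //= E morphV // mulVg.
by rewrite permM permK.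
Qed.

End Orbits.

Section BlockStep.
Variables (T : finType) (Gm P : {group {perm T}}) (X : {set T}) (t h : {perm T}) (x0 : T).
Hypotheses (nPG : P <| Gm) (nilP : nilpotent P) (tP : t \in P) (hP : h \in P) (x0X : x0 \in X).
Hypothesis GX : forall g x, g \in Gm -> x \in X -> g x \in X.
Hypothesis tX : forall x, x \in X -> exists m, x = (t ^+ m) x0.
Hypothesis hx0 : h x0 != x0.

(* R' x0 splits into p orbits of R, which a power of h permutes cyclically:  *)
(* with R maximal among the normal subgroups whose blocks do not meet the    *)
(* h-orbit of x0 twice, R' / R is a subgroup of order p in the centre of     *)
(* P / R, and the centre is cyclic since t is transitive on X.               *)
Lemma block_step : exists (R R' : {group {perm T}}) (p s : nat),
  [/\ prime p, R <| Gm, R' <| Gm,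
      (forall y, (y \in orbit 'P R' x0) =
         [exists a : 'I_p, y \in orbit 'P R ((h ^+ (s * a)) x0)])
    & (forall a b : 'I_p, (h ^+ (s * a)) x0 \in orbit 'P R ((h ^+ (s * b)) x0) -> a = b)
      /\ forall m, (h ^+ m) x0 = x0 -> p %| m].
Proof.
have PG := normal_sub nPG.
pose good (R : {group {perm T}}) := [&& R <| Gm, R \subset P &
  [forall l : 'I_#[h], ((h ^+ l) x0 \in orbit 'P R x0) ==> ((h ^+ l) x0 == x0)]].
have goodP R : good R -> forall l, (h ^+ l) x0 \in orbit 'P R x0 -> (h ^+ l) x0 = x0.
  case/and3P=> _ _ /forallP gR l; rewrite -expg_mod_order => hl.
  by apply/eqP; have /implyP := gR (Ordinal (ltn_pmod l (order_gt0 h))); apply.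
have good1 : good 1%G.
  rewrite /good normal1 sub1G; apply/forallP => l; apply/implyP => /orbit_permP[s].
  by rewrite inE => /eqP -> ->; rewrite perm1.
case: (arg_maxnP (fun R : {group {perm T}} => #|R|) good1) => R gR maxR.
have /and3P[nRG sRP _] := gR.
have nR g : g \in Gm -> g \in 'N(R) by move/(subsetP (normal_norm nRG)).
have nRP g : g \in P -> g \in 'N(R) by move=> gP; apply: nR; apply: (subsetP PG).
have oRR y : y \in orbit 'P R y by apply/orbit_permP; exists 1; rewrite ?perm1.
have oT x y z : x \in orbit 'P R y -> y \in orbit 'P R z -> x \in orbit 'P R z.
  exact: orbit_trans.
have oS x y : x \in orbit 'P R y -> y \in orbit 'P R x by rewrite orbit_sym.
(* [P / R] acts faithfully on the blocks of [R] in [X]: the members of [P] that preserve every block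
   form a good group [K] containing [R], and [R] is maximal. *)
have RK g : g \in P -> (forall x, x \in X -> g x \in orbit 'P R x) -> g \in R.
  move=> gP gX.
  pose K := [set s in P | [forall x in X, s x \in orbit 'P R x]].
  have KP s : reflect (s \in P /\ forall x, x \in X -> s x \in orbit 'P R x) (s \in K).
    by rewrite inE; apply: (iffP andP) => -[sP /forall_inP sK].
  have gK : group_set K.
    apply/group_setP; split=> [|s s' /KP[sP sK] /KP[s'P s'K]]; apply/KP.
      by split=> // x _; rewrite perm1.
    split=> [|x xX]; first exact: groupM.
    rewrite permM; apply: oT (s'K _ _) (sK _ xX).
    by apply: GX => //; apply: (subsetP PG).
  have goodK : good (Group gK).
    apply/and3P; split.
    - rewrite /normal (subset_trans _ PG) /=; last by apply/subsetP => s /KP[].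
      apply/subsetP => s sG; rewrite inE; apply/subsetP => _ /imsetP[s' /KP[s'P s'K] ->].
      apply/KP; split; first by rewrite memJ_norm // (subsetP (normal_norm nPG)).
      move=> x xX; rewrite /conjg !permM.
      have := orbit_norm (nR _ sG) (s'K (s^-1 x) (GX (groupVr sG) xX)).
      by rewrite permKV.
    - by apply/subsetP => s /KP[].
    - apply/forallP => l; apply/implyP => /orbit_permP[s /KP[_ sK] E].
      by apply/eqP/(goodP _ gR); rewrite E; apply: sK.
  have sRK : R \subset K.
    apply/subsetP => s sR; apply/KP; split=> [|x _]; first exact: (subsetP sRP).
    by apply/orbit_permP; exists s.
  have : R :=: K by apply/eqP; rewrite eqEcard sRK; exact: (maxR (Group gK)).
  by move=> ->; apply/KP.
have central g : g \in P -> coset R g \in 'Z(P / R) ->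
    forall g', g' \in P -> coset R (g' * g) = coset R (g * g').
  move=> gP /centerP[_ cg] g' g'P; rewrite !morphM ?nRP //.
  by rewrite cg // mem_quotient.
have X_t m : (t ^+ m) x0 \in X by apply: GX => //; rewrite groupX // (subsetP PG).
(* A central element preserving one block preserves all of them, since it commutes modulo [R] with
   the powers of [t], which reach every block. *)
have fixR g : g \in P -> coset R g \in 'Z(P / R) -> g x0 \in orbit 'P R x0 -> g \in R.
  move=> gP gZ gx0; apply: RK => // x /tX[m ->].
  have tmP : t ^+ m \in P by rewrite groupX.
  rewrite -permM; apply: oT (orbit_coset _ _ _ (central _ gP gZ _ tmP)) _; rewrite ?nRP ?groupM //.
  by rewrite permM; apply: orbit_norm => //; apply: nRP.
(* If [g x0 = (t ^+ m) x0], the central element [g] agrees with [t ^+ m] on the block of every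
   [(t ^+ j) x0], hence modulo [R]. *)
have Zt : 'Z(P / R) \subset <[coset R t]>.
  apply/subsetP => z zZ; have /morphimP[g gN gP Ez] := subsetP (center_sub _) _ zZ.
  rewrite /= in Ez; have gZ : coset R g \in 'Z(P / R) by rewrite -Ez.
  have gx0X : g x0 \in X by apply: GX; rewrite // (subsetP PG).
  have [m Em] := tX gx0X.
  have tmP i : t ^+ i \in P by rewrite groupX.
  suff gR' : g * (t ^+ m)^-1 \in R.
    have -> : z = coset R (t ^+ m).
      rewrite Ez -[g](mulgKV (t ^+ m)) morphM ?nRP ?groupM ?groupV //=.
      by rewrite (coset_id gR') mul1g.
    by rewrite morphX ?nRP // mem_cycle.
  apply: RK => [|x /tX[j ->]]; first by rewrite groupM ?groupV.
  rewrite -permM mulgA.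
  have -> : (t ^+ j) x0 = ((g * t ^+ j) * (t ^+ m)^-1) x0.
    by rewrite !permM Em -(permM (t ^+ m)) -expgD addnC expgD permM permK.
  apply: orbit_coset; rewrite ?nRP ?groupM ?groupV //.
  rewrite [LHS]morphM ?[RHS]morphM ?nRP ?groupM ?groupV //=.
  by rewrite (central g gP gZ).
have hlN l : h ^+ l \in 'N(R) by rewrite nRP // groupX.
have nRP' : P \subset 'N(R) by apply/subsetP => g /nRP.
have nilQ : nilpotent (P / R) by exact: quotient_nil.
have ntQ : P / R != 1.
  rewrite -subG1 quotient_sub1 //; apply: contra hx0 => /subsetP/(_ h hP) hR.
  by apply/eqP/(goodP _ gR 1%N); apply/orbit_permP; exists h.
have ntZ : 'Z(P / R) != 1 by rewrite center_nil_eq1.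
have pr_p : prime (pdiv #|'Z(P / R)|) by rewrite pdiv_prime // cardG_gt1.
have [z zZ oz] := Cauchy pr_p (pdiv_dvd _).
set p := pdiv _ in pr_p oz.
(* Subgroups of a cyclic group are characteristic; this makes [R'] normal in all of [Gm] and not
   only in [P]. *)
have chz : <[z]> \char 'Z(P / R).
  by rewrite sub_cyclic_char ?cycle_subG // (cyclicS Zt) // cycle_cyclic.
have nzG : <[z]> <| Gm / R.
  apply: char_normal_trans (char_trans chz (center_char _)) _.
  exact: quotient_normal.
pose R' := (coset R @*^-1 <[z]>)%G.
have nR'G : R' <| Gm by rewrite -(quotientGK nRG) cosetpre_normal.
have memR' g : g \in 'N(R) -> (g \in R') = (coset R g \in <[z]>).
  by move=> gN; rewrite /= morphpreE in_setI gN inE.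
have R'P : R' \subset P.
  rewrite -(quotientGK (normalS sRP PG nRG)) morphpreS //.
  by rewrite cycle_subG (subsetP (center_sub _)).
have RR' : R \subset R'.
  by apply/subsetP => r rR; rewrite memR' ?coset_id ?group1 // (subsetP (normG R)).
(* [R'] is strictly larger than [R], so it is not good: some power of [h] moves [x0] inside its
   [R']-block. *)
have [l hlR' hlx0] : exists2 l, (h ^+ l) x0 \in orbit 'P R' x0 & (h ^+ l) x0 != x0.
  have : ~~ good R'.
    apply/negP => /maxR /=; apply/negP; rewrite -ltnNge.
    rewrite proper_card // /proper RR' /=; apply/negP => /subsetP R'R.
    have [g gN gP Ez] := morphimP (subsetP (center_sub _) _ zZ).
    have /R'R/coset_id : g \in R' by rewrite memR' // -Ez cycle_id.
    by move=> g1; move: pr_p; rewrite -oz Ez /= g1 order1.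
  rewrite /good nR'G R'P /= negb_forall => /existsP[l]; rewrite negb_imply.
  by case/andP=> ? ?; exists l.
have /orbit_permP[r rR' Er] := hlR'.
have rP : r \in P := subsetP R'P _ rR'.
have rN := nRP _ rP.
have rz : coset R r \in <[z]> by rewrite -memR'.
have rZ : coset R r \in 'Z(P / R).
  by apply: subsetP rz; rewrite cycle_subG.
have rnR : r \notin R.
  apply: contra hlx0 => rR; apply/eqP/(goodP _ gR).
  by rewrite Er; apply/orbit_permP; exists r.
have r1 : coset R r != 1 by apply: contra rnR => /eqP/coset_idr; apply.
have gen_r : <[z]> = <[coset R r]>.
  apply/esym/eqP; rewrite eqEcard cycle_subG rz /= -!orderE oz.
  have : #[coset R r] %| p by rewrite -oz order_dvdG.
  have /primeP[_ pP] := pr_p; move=> /pP/orP[|/eqP-> //].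
  by rewrite order_eq1 (negPf r1).
have pr : p = #[coset R r] by rewrite orderE -gen_r -orderE oz.
(* [r] is central modulo [R] and so commutes there with [h ^+ l]; as the two agree at [x0], their
   powers agree at [x0] up to [R]. *)
have step a : ((h ^+ l) ^+ a) x0 \in orbit 'P R ((r ^+ a) x0).
  elim: a => [|a IH]; first by rewrite !expg0.
  rewrite expgS permM Er -permM.
  apply: oT (_ : _ \in orbit 'P R (((h ^+ l) ^+ a * r) x0)) _.
    apply: orbit_coset; rewrite ?groupM ?groupX ?(nRP h) //.
    by symmetry; apply: central => //; rewrite !groupX.
  by rewrite permM expgSr permM; apply: orbit_norm.
exists R, R', p, l; split=> //.
- move=> y; apply/idP/existsP => [/orbit_permP[g gR' ->]|[a ya]].
    have gP := subsetP R'P _ gR'; have gN := nRP _ gP.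
    have /cycleP[i Ei] : coset R g \in <[coset R r]> by rewrite -gen_r -memR'.
    have ltp : (i %% p < p)%N by rewrite ltn_pmod // prime_gt0.
    exists (Ordinal ltp); rewrite expgM; apply: oT (oS _ _ (step _)).
    by apply: orbit_coset; rewrite ?groupX // morphX //= Ei pr expg_mod_order.
  rewrite expgM in ya; have /orbit_permP[r1' r1R E1] := oT _ _ _ ya (step a).
  apply/orbit_permP; exists (r ^+ a * r1'); last by rewrite permM.
  by rewrite groupM ?groupX // (subsetP RR').
(* If the blocks coincide, [r ^+ i * (r ^+ j)^-1] is central modulo [R] and preserves a block, so it
   lies in [R] by [fixR]; and [r] has order [p] modulo [R]. *)
have key i j : (h ^+ (l * i)) x0 \in orbit 'P R ((h ^+ (l * j)) x0) -> i = j %[mod p].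
  rewrite !expgM => ij; have := oT _ _ _ (oT _ _ _ (oS _ _ (step i)) ij) (step j).
  move=> /orbit_permP[r2 r2R E2].
  have : r ^+ i * (r ^+ j)^-1 \in R.
    apply: fixR; first by rewrite groupM ?groupV ?groupX.
      by rewrite morphM ?morphV ?morphX ?groupV ?groupX //= groupM ?groupV ?groupX.
    apply/orbit_permP; exists (r2 ^ (r ^+ j)^-1); first by rewrite memJ_norm ?groupV ?groupX.
    by rewrite permM E2 /conjg invgK !permM.
  move=> /coset_id; rewrite morphM ?morphV ?morphX ?groupV ?groupX //= => /eqP.
  by rewrite -eq_mulgV1 eq_expg_mod_order -pr => /eqP.
split=> [a b /key|m hm].
  by rewrite !modn_small // => ab; apply: val_inj.
have : (h ^+ (l * m)) x0 \in orbit 'P R ((h ^+ (l * 0)) x0).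
  rewrite muln0 expg0 perm1 mulnC expgM.
  by elim: (l) => [|i IH]; rewrite ?expg0 ?perm1 // expgS permM hm.
by move/key; rewrite mod0n => /eqP.
Qed.

End BlockStep.

Lemma nilpotent_constt_commute (gT : finGroupType) (G : {group gT}) (x y : gT) (p q : nat) :
  nilpotent G -> x \in G -> y \in G -> p != q -> commute x.`_p y.`_q.
Proof.
move=> nG xG yG pq.
have sub z n : z \in G -> <[z.`_n]> \subset G by move=> zG; rewrite cycle_subG groupX.
have := sub_nilpotent_cent2 nG (sub _ p xG) (sub _ q yG).
have co : coprime #|<[x.`_p]>| #|<[y.`_q]>|.
  apply: (@pnat_coprime p); first exact: p_elt_constt.
  apply: sub_in_pnat (p_elt_constt q y) => r _; rewrite !inE => /eqP ->.
  by rewrite eq_sym.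
by move/(_ co); rewrite cent_cycle cycle_subG => /cent1P/commute_sym.
Qed.

Section Rotation.
Variables (T : finType) (A : eqType) (Gm P : {group {perm T}}) (pa : T -> A).
Variables (t xi : {perm T}) (x0 : T) (d q r : nat).
Hypotheses (nPG : P <| Gm) (nilP : nilpotent P) (tP : t \in P) (xiG : xi \in Gm).
Hypotheses (pr_q : prime q) (pr_r : prime r) (qd : q %| d) (rd : r %| d) (odd_r : odd r) (qr : q != r).
Hypothesis paG : forall g x y, g \in Gm -> pa x = pa y -> pa (g x) = pa (g y).
Hypothesis t_tr : forall x, pa x = pa x0 -> exists m, x = (t ^+ m) x0.
Hypothesis t_pa : forall m, pa ((t ^+ m) x0) = pa x0 <-> d %| m.
Hypothesis xi_pa : forall x, pa x = pa x0 -> pa (xi x) = pa x0.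
Hypothesis xi_fix : forall m, pa ((t ^+ m) x0) <> pa x0 -> xi ((t ^+ m) x0) = (t ^+ m) x0.
Hypothesis xi_x0 : forall m, (xi ^+ m) x0 = x0 -> d %| m.

(** The exponent is the Chinese remainder that is [1] modulo the [p]-part of the order and [0]
    modulo the rest; it is prime to [p] because [p] divides the [p]-part. *)
Lemma constt_exp (g : {perm T}) (p : nat) : prime p -> p %| #[g] ->
  exists2 c, g.`_p = g ^+ c & ~~ (p %| c).
Proof.
move=> pr_p pg; exists (chinese #[g]`_p #[g]`_p^' 1 0) => //.
set c := chinese _ _ _ _.
have E : c = 1 %[mod #[g]`_p] by rewrite /c chinese_modl // coprime_partC.
have pp : p %| #[g]`_p.
  rewrite p_part dvdn_exp // logn_gt0 mem_primes pr_p order_gt0 pg //.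
apply/negP => pc; have : c = 1 %[mod p] by rewrite -(modn_dvdm c pp) E modn_dvdm.
by rewrite (eqP pc) modn_small // prime_gt1.
Qed.

(** Here [pa] plays the parent map, and [xi] rotates the children of [pa x0] while fixing the other
    points of the [t]-orbit of [x0]. With [rho] the [r]-part of [t] and [al] the [q]-part of [xi],
    the element [ga] lies in [P], because [P] is normal and contains [rho]. By nilpotence the
    [q]-part of [ga] commutes with the [r]-element [rho]. It fixes [rho^-1 x0], so it would fix [x0]
    too, although [ga] moves [x0] in a cycle of length divisible by [q]. *)
Lemma no_partial_rotation : False.
Proof.
have PG := normal_sub nPG; have tG := subsetP PG _ tP.
have d_t : d %| #[t] by apply/t_pa; rewrite expg_order perm1.
have d_xi : d %| #[xi] by apply: xi_x0; rewrite expg_order perm1.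
have [c Et rc] := constt_exp pr_r (dvdn_trans rd d_t).
have [c' Exi qc'] := constt_exp pr_q (dvdn_trans qd d_xi).
pose rho := t.`_r; pose al := xi.`_q.
have rhoP : rho \in P by rewrite groupX.
have rhoG := subsetP PG _ rhoP.
have rho_pa i : ~~ (r %| i) -> pa ((rho ^+ i) x0) <> pa x0.
  rewrite /rho Et -expgM => ri /t_pa/(dvdn_trans rd); rewrite Euclid_dvdM //.
  by rewrite (negPf rc) (negPf ri).
(* Oddness of [r] enters here: [ga] also acts on the block of [rho x0], and the block of [rho^-1 x0]
   has to be a different one. *)
have r2 : ~~ (r %| 2).
  by rewrite dvdn_prime2 //; apply/eqP => Er; move: odd_r; rewrite Er.
have r1 : ~~ (r %| 1) by rewrite Euclid_dvd1.
have al_fix m : pa ((t ^+ m) x0) <> pa x0 -> al ((t ^+ m) x0) = (t ^+ m) x0.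
  move=> h; rewrite /al Exi; elim: c' {Exi qc'} => [|i IH]; first by rewrite expg0 perm1.
  by rewrite expgS permM xi_fix.
have al_pa x : pa x = pa x0 -> pa (al x) = pa x0.
  rewrite /al Exi; elim: c' x {Exi qc'} => [|i IH] x; first by rewrite expg0 perm1.
  by move=> h; rewrite expgS permM; apply/IH/xi_pa.
have al_x0 m : (al ^+ m) x0 = x0 -> q %| m.
  rewrite /al Exi -expgM => /xi_x0/(dvdn_trans qd); rewrite Euclid_dvdM //.
  by rewrite (negPf qc').
have alG : al \in Gm by rewrite groupX.
(* [ga] acts below [x0] as the inverse of [al] and below [rho^-1 x0] trivially. *)
pose ga := al^-1 * (al ^ rho).
have gaP : ga \in P.
  have -> : ga = (rho^-1) ^ al * rho by rewrite /ga /conjg !mulgA.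
  by rewrite groupM // memJ_norm ?groupV // (subsetP (normal_norm nPG)).
have rho_inv i : exists j, forall x, ((rho ^+ i)^-1) x = (t ^+ j) x.
  have /cycleP[j E] : (rho ^+ i)^-1 \in <[t]> by rewrite groupV !groupX // cycle_id.
  by exists j => x; rewrite E.
have al_inv_pa x : pa x = pa x0 -> pa (al^-1 x) = pa x0.
  have /cycleP[j ->] : al^-1 \in <[al]> by rewrite groupV cycle_id.
  elim: j x => [|j IH] x h; first by rewrite expg0 perm1.
  by rewrite expgS permM; apply/IH/al_pa.
have rhoV_pa x i : ~~ (r %| i) -> pa x = pa x0 -> pa ((rho ^+ i)^-1 x) <> pa x0.
  move=> ri xx0 E; apply: (rho_pa i ri); rewrite -xx0.
  rewrite -[in RHS](permKV (rho ^+ i) x); apply: paG; first by rewrite groupX.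
  exact/esym.
have alJ_fix x : pa x = pa x0 -> (al ^ rho) x = x.
  move=> xx0; rewrite /conjg !permM; have := rhoV_pa x 1%N r1 xx0; rewrite expg1.
  have [m ->] := t_tr xx0; have [j Ej] := rho_inv 1%N; rewrite expg1 in Ej.
  by rewrite Ej -permM -expgD => /al_fix ->; rewrite expgD permM -Ej permKV.
have ga_al x : pa x = pa x0 -> ga x = al^-1 x.
  by move=> h; rewrite /ga permM alJ_fix //; apply: al_inv_pa.
have ga_x0 i : (ga ^+ i) x0 = (al^-1 ^+ i) x0 /\ pa ((ga ^+ i) x0) = pa x0.
  elim: i => [|i [IH1 IH2]]; first by rewrite !expg0 !perm1.
  by rewrite expgSr permM ga_al // expgSr permM -IH1; split=> //; apply: al_inv_pa.
have ga_q m : (ga ^+ m) x0 = x0 -> q %| m.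
  by have [-> _] := ga_x0 m => E; apply: al_x0; rewrite -{1}E -permM expgVn mulVg perm1.
have q_ga : q %| #[ga] by apply: ga_q; rewrite expg_order perm1.
have [c2 Ec2 qc2] := constt_exp pr_q q_ga.
case/negP: qc2; apply: ga_q; rewrite -Ec2.
pose z := rho^-1 x0.
have ga_z : ga z = z.
  have z0 : pa z <> pa x0 by have := rhoV_pa x0 1%N r1 erefl; rewrite expg1.
  have [j Ej] := rho_inv 1%N; rewrite expg1 in Ej.
  have al_z : al z = z by move: z0; rewrite /z Ej => /al_fix.
  rewrite /ga permM -{1}al_z permK /conjg !permM.
  have := rhoV_pa x0 2%N r2 erefl; have [l El] := rho_inv 2%N.
  rewrite El => /al_fix; rewrite -El expgS expg1 invMg permM => ->.
  by rewrite permKV.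
have ga_qz : ga.`_q z = z.
  rewrite Ec2; elim: c2 {Ec2} => [|i IH]; first by rewrite expg0 perm1.
  by rewrite expgS permM ga_z.
have cm : commute ga.`_q rho by apply: nilpotent_constt_commute nilP _ _ qr.
by rewrite -{1}[x0](permKV rho) -/z -permM -cm permM ga_qz /z permKV.
Qed.

End Rotation.

End FiniteGroups.

From mathcomp Require Import separable mxpoly fieldext ring zify.
From mathcomp Require Import boolp classical_sets cardinality topology.

Import GRing.Theory.
Local Open Scope ring_scope.

(** * Field isomorphisms *)

Section FractionMap.
Variables (R : idomainType) (L : fieldType) (phi : {rmorphism R -> L}).
Hypothesis phi_inj : injective phi.

Lemma fractionP (x : {fraction R}) :
  exists a b, b != 0 /\ x = tofrac a / tofrac b.
Proof.
elim/quotW: x => r; exists (\n_r), (\d_r); split; first exact: denom_ratioP.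
apply: (mulIf (x := tofrac \d_r)); first by rewrite tofrac_eq0 denom_ratioP.
rewrite divfK ?tofrac_eq0 ?denom_ratioP //.
rewrite /FracField.tofrac; unlock FracField.tofrac.
rewrite -[LHS]FracField.pi_mul; apply/eqmodP; rewrite /= FracField.equivfE.
by rewrite /FracField.mulf !numden_Ratio ?oner_neq0 ?mulr1 ?denom_ratioP // mulrC.
Qed.

(** Numerator and denominator are picked by choice; injectivity of [phi] makes the value independent
    of them. *)
Definition frac_map (x : {fraction R}) : L :=
  let a := sval (cid (fractionP x)) in
  let b := sval (cid (svalP (cid (fractionP x)))) in phi a / phi b.

Lemma phi_eq0 a : (phi a == 0) = (a == 0).
Proof. by rewrite -(inj_eq phi_inj) rmorph0. Qed.

Lemma frac_mapE a b : b != 0 -> frac_map (tofrac a / tofrac b) = phi a / phi b.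
Proof.
move=> b0; rewrite /frac_map; case: cid => a' /= ex; case: cid => b' /= [b'0].
move/eqP; rewrite eqr_div ?tofrac_eq0 // -!tofracM tofrac_eq => /eqP E.
by apply/eqP; rewrite eqr_div ?phi_eq0 // -!rmorphM E eqxx.
Qed.

Lemma frac_map_tofrac a : frac_map (tofrac a) = phi a.
Proof. by rewrite -[tofrac a]divr1 -tofrac1 frac_mapE ?oner_neq0 // rmorph1 divr1. Qed.

Lemma frac_map_zmod : zmod_morphism frac_map.
Proof.
move=> x y; have [a [b [b0 ->]]] := fractionP x.
have [c [d [d0 ->]]] := fractionP y.
rewrite -mulNr -tofracN addf_div ?tofrac_eq0 // -!tofracM -tofracD.
rewrite !frac_mapE ?mulf_neq0 // !rmorphM rmorphD !rmorphM rmorphN.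
by rewrite -addf_div ?phi_eq0 // !mulNr.
Qed.

Lemma frac_map_monoid : monoid_morphism frac_map.
Proof.
split=> [|x y]; first by rewrite -tofrac1 frac_map_tofrac rmorph1.
have [a [b [b0 ->]]] := fractionP x; have [c [d [d0 ->]]] := fractionP y.
by rewrite mulf_div -!tofracM !frac_mapE ?mulf_neq0 // !rmorphM mulf_div.
Qed.

Lemma frac_map_ex :
  exists h : {rmorphism {fraction R} -> L}, forall a, h (tofrac a) = phi a.
Proof.
pose h1 := GRing.isZmodMorphism.Build _ _ frac_map frac_map_zmod.
pose h2 := GRing.isMonoidMorphism.Build _ _ frac_map frac_map_monoid.
pose h : {rmorphism {fraction R} -> L} := HB.pack frac_map h1 h2.
by exists h => a; exact: frac_map_tofrac.
Qed.

End FractionMap.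

Definition splits (L : fieldType) (p : {poly L}) : Prop :=
  exists rs : seq L, p %= \prod_(r <- rs) ('X - r%:P).

Lemma splits_root (L : fieldType) (p q : {poly L}) :
  splits p -> q %| p -> (1 < size q)%N -> exists y, root q y.
Proof.
move=> [rs prs] qp q1; move: qp; rewrite (eqp_dvdr _ prs).
move=> /dvdp_prod_XsubC[m qm]; case E: (mask m rs) qm => [|y s] qm.
  by move: (eqp_size qm); rewrite big_nil size_poly1 => q1'; rewrite q1' in q1.
by exists y; rewrite (eqp_root qm) big_cons rootM root_XsubC eqxx.
Qed.

Section ConjugateRoots.
Variables (F E1 E2 : fieldType) (phi : {rmorphism F -> E1}) (psi : {rmorphism F -> E2}).

Lemma min_poly_ex (x : E1) (p0 : {poly F}) : p0 != 0 -> root (map_poly phi p0) x ->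
  exists m : {poly F}, forall p, root (map_poly phi p) x = (m %| p).
Proof.
move=> p00 rp0.
pose Q n := `[< exists p : {poly F}, [/\ p != 0, root (map_poly phi p) x & size p = n] >].
have exQ : exists n, Q n by exists (size p0); apply/asboolP; exists p0.
have [n /asboolP[m [m0 rm sm]] minn] := ex_minnP exQ.
exists m => p; apply/idP/idP => [rp|/dvdpP[q ->]]; last first.
  by rewrite rmorphM rootM rm orbT.
have rr : root (map_poly phi (p %% m)) x.
  have: root (map_poly phi (p %/ m * m + p %% m)) x by rewrite -divp_eq.
  by rewrite rmorphD rmorphM /root hornerD hornerM (rootP rm) mulr0 add0r.
rewrite /dvdp -size_poly_eq0; apply: contraT; rewrite size_poly_eq0 => r0.
have /minn : Q (size (p %% m)) by apply/asboolP; exists (p %% m).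
by rewrite -sm leqNgt ltn_modp m0.
Qed.

(** Minimality makes [m] irreducible: if [m] does not divide [p], the two are coprime, and a Bezout
    relation evaluated at a common root [y] would read [0 = 1]. *)
Lemma min_poly_conj (x : E1) (y : E2) (m : {poly F}) : m != 0 ->
  (forall p, root (map_poly phi p) x = (m %| p)) -> root (map_poly psi m) y ->
  forall p, root (map_poly phi p) x = root (map_poly psi p) y.
Proof.
move=> m0 mP ry p; rewrite mP; apply/idP/idP => [/dvdpP[q ->]|rp].
  by rewrite rmorphM rootM ry orbT.
apply: contraLR (rp) => Nmp.
have cop : coprimep m p.
  rewrite coprimep_def eqn_leq lt0n size_poly_eq0 gcdp_eq0 (negPf m0) andbT /=.
  have /dvdpP[r Er] := dvdp_gcdl m p.
  have : root (map_poly phi m) x by rewrite mP dvdpp.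
  rewrite {1}Er rmorphM rootM => /orP[|]; last first.
    by rewrite mP => /dvdp_trans/(_ (dvdp_gcdr m p)); rewrite (negPf Nmp).
  have r0 : r != 0 by apply: contraNneq m0 => r0; rewrite Er r0 mul0r.
  have g0 : gcdp m p != 0 by rewrite gcdp_eq0 (negPf m0).
  have szm : size m = (size r + size (gcdp m p)).-1 by rewrite -size_mul // -Er.
  rewrite mP => /dvdp_leq -/(_ r0); rewrite szm.
  have : (0 < size r)%N by rewrite lt0n size_poly_eq0.
  case: (size r) => // a _; case: (size (gcdp m p)) => [|[|b]] //.
  by rewrite !addnS => /(leq_ltn_trans (leq_addr b a.+1)); rewrite ltnn.
have /Bezout_eq1_coprimepP[[u v] /= E] := cop.
apply/negP => rp'; have : (map_poly psi (u * m + v * p)).[y] = 1.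
  by rewrite E rmorph1 hornerE.
rewrite rmorphD !rmorphM !hornerE (rootP ry) (rootP rp) !mulr0 addr0 => /eqP.
by rewrite eq_sym oner_eq0.
Qed.

Lemma conj_root_ex (x : E1) (p0 : {poly F}) : p0 != 0 -> root (map_poly phi p0) x ->
  splits (map_poly psi p0) ->
  exists y, forall p, root (map_poly phi p) x = root (map_poly psi p) y.
Proof.
move=> p00 rp0 sp0; have [m mP] := min_poly_ex p00 rp0.
have mp0 : m %| p0 by rewrite -mP.
have m0 : m != 0 by apply: contraTneq mp0 => ->; rewrite dvd0p.
have m1 : (1 < size m)%N.
  rewrite ltnNge; apply/negP => /size1_polyC mc.
  have : root (map_poly phi m) x by rewrite mP dvdpp.
  rewrite mc map_polyC rootC fmorph_eq0 => /eqP mc0.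
  by move: m0; rewrite mc mc0 eqxx.
have [y ry] : exists y, root (map_poly psi m) y.
  by apply: splits_root sp0 _ _; rewrite ?dvdp_map ?size_map_poly.
by exists y; exact: min_poly_conj mP ry.
Qed.

End ConjugateRoots.

(* A field isomorphism between a subfield of E1 and a subfield of E2, seen as *)
(* its graph.                                                                 *)
Definition field_graph (E1 E2 : fieldType) (G : set (E1 * E2)) : Prop :=
  [/\ G (1, 1),
      forall x y x' y', G (x, y) -> G (x', y') -> G (x - x', y - y'),
      forall x y x' y', G (x, y) -> G (x', y') -> G (x / x', y / y')
    & forall y, G (0, y) -> y = 0].

Section FieldGraphTheory.
Variables (E1 E2 : fieldType) (G : set (E1 * E2)).
Hypothesis gG : field_graph G.

Lemma fgraph1 : G (1, 1). Proof. by case: gG. Qed.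
Lemma fgraphB x y x' y' : G (x, y) -> G (x', y') -> G (x - x', y - y').
Proof. by case: gG => _ h _ _; exact: h. Qed.
Lemma fgraph_div x y x' y' : G (x, y) -> G (x', y') -> G (x / x', y / y').
Proof. by case: gG => _ _ h _; exact: h. Qed.
Lemma fgraph0 : G (0, 0).
Proof. by have := fgraphB fgraph1 fgraph1; rewrite !subrr. Qed.
Lemma fgraphN x y : G (x, y) -> G (- x, - y).
Proof. by move=> h; have := fgraphB fgraph0 h; rewrite !sub0r. Qed.
Lemma fgraphD x y x' y' : G (x, y) -> G (x', y') -> G (x + x', y + y').
Proof. by move=> h /fgraphN h'; have := fgraphB h h'; rewrite !opprK. Qed.
Lemma fgraphV x y : G (x, y) -> G (x^-1, y^-1).
Proof. by move=> h; have := fgraph_div fgraph1 h; rewrite !div1r. Qed.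
Lemma fgraphM x y x' y' : G (x, y) -> G (x', y') -> G (x * x', y * y').
Proof. by move=> h /fgraphV h'; have := fgraph_div h h'; rewrite !invrK. Qed.
Lemma fgraph_fun x y y' : G (x, y) -> G (x, y') -> y = y'.
Proof.
move=> h h'; apply/eqP; rewrite -subr_eq0; apply/eqP; case: gG => _ _ _; apply.
by have := fgraphB h h'; rewrite subrr.
Qed.
Lemma fgraph_inj x x' y : G (x, y) -> G (x', y) -> x = x'.
Proof.
move=> h h'; apply/eqP; rewrite -subr_eq0; apply/eqP; apply: contrapT => /eqP n0.
have hd := fgraphB h h'; rewrite subrr in hd.
have := fgraph_div hd hd; rewrite divff // mul0r => h1.
by have /eqP := fgraph_fun fgraph1 h1; rewrite oner_eq0.
Qed.

End FieldGraphTheory.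

(** The graph of the isomorphism from [F(x)] to [F(y)] consists of the values of one fraction at [x]
    and at [y]; a denominator vanishes at [x] exactly when it vanishes at [y]. *)
Lemma field_graph_conj (F E1 E2 : fieldType) (phi : {rmorphism F -> E1})
    (psi : {rmorphism F -> E2}) (x : E1) (y : E2) :
  (forall p, root (map_poly phi p) x = root (map_poly psi p) y) ->
  exists G : set (E1 * E2),
    [/\ field_graph G, forall a, G (phi a, psi a) & G (x, y)].
Proof.
move=> xy.
pose G : set (E1 * E2) := fun z => exists p q : {poly F},
  [/\ ~~ root (map_poly phi q) x, z.1 = (map_poly phi p).[x] / (map_poly phi q).[x]
    & z.2 = (map_poly psi p).[y] / (map_poly psi q).[y]].
have nr1 : ~~ root (map_poly phi 1) x by rewrite rmorph1 rootE hornerE oner_eq0.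
have inG p : G ((map_poly phi p).[x], (map_poly psi p).[y]).
  by exists p, 1; split=> //=; rewrite rmorph1 hornerC divr1.
exists G; split; last 2 first.
- by move=> a; have := inG a%:P; rewrite !map_polyC !hornerC.
- by have := inG 'X; rewrite !map_polyX !hornerX.
split.
- by have := inG 1; rewrite !rmorph1 !hornerC.
- move=> u v u' v' [p [q [q0 /= -> ->]]] [p' [q' [q'0 /= -> ->]]].
  exists (p * q' - p' * q), (q * q').
  rewrite !rmorphM rootM negb_or q0 q'0 /=; split=> //.
    by rewrite rmorphB !rmorphM !hornerE -mulNr (addf_div _ _ q0 q'0) mulNr.
  rewrite xy in q0; rewrite xy in q'0.
  by rewrite rmorphB !rmorphM !hornerE -mulNr (addf_div _ _ q0 q'0) mulNr.
- move=> u v u' v' [p [q [q0 /= -> ->]]] [p' [q' [q'0 /= -> ->]]].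
  (* If the divisor is [0] at [x] it is [0] at [y] too, and both quotients are [0] by the convention
     for inverses. *)
  have [rp|rp] := boolP (root (map_poly phi p') x).
    have rp' : root (map_poly psi p') y by rewrite -xy.
    have := inG 0; rewrite (rootP rp) (rootP rp') !mul0r !invr0 !mulr0.
    by rewrite !rmorph0 !horner0.
  exists (p * q'), (q * p'); rewrite !rmorphM rootM negb_or q0 rp /= !hornerE.
  by split=> //; rewrite invf_div mulf_div.
- move=> v [p [q [q0 /= /esym/eqP + ->]]].
  rewrite mulf_eq0 invr_eq0 -!rootE (negPf q0) orbF xy => /rootP ->.
  by rewrite mul0r.
Qed.

Section Extension.
Variables (F E1 E2 : fieldType) (phi : {rmorphism F -> E1}) (psi : {rmorphism F -> E2}).
Variables (G0 : set (E1 * E2)) (S : set E1).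
Hypothesis gG0 : field_graph G0.
Hypothesis G0F : forall a, G0 (phi a, psi a).
Hypothesis algS : forall x, S x -> exists p : {poly F},
  [/\ p != 0, root (map_poly phi p) x & splits (map_poly psi p)].

Let dom (G : set (E1 * E2)) : set E1 := [set x | exists y, G (x, y)].

(** The domain of [G] is a subfield, turned into the field [D], and [G] becomes a morphism [sg] on
    it. A conjugate of [x] over [D] exists because the image of [p] splits, and the graph of the
    resulting isomorphism on [D(x)] extends [G]. *)
Let extend_step (G : set (E1 * E2)) x : field_graph G -> (G0 `<=` G)%classic -> S x ->
  exists G' : set (E1 * E2), [/\ field_graph G', (G `<=` G')%classic & dom G' x].
Proof.
move=> gG GG0 Sx; pose D := adjoin phi (dom G).
have domD : divring_closed (fun z => `[< dom G z >]).
  split=> [|u v /asboolP[u' Gu] /asboolP[v' Gv]|u v /asboolP[u' Gu] /asboolP[v' Gv]].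
  - by apply/asboolP; exists 1; exact: fgraph1.
  - by apply/asboolP; exists (u' - v'); exact: fgraphB.
  - by apply/asboolP; exists (u' / v'); exact: fgraph_div.
pose DR : divringClosed E1 := HB.pack (fun z => `[< dom G z >])
  (GRing.isDivringClosed.Build E1 (fun z => `[< dom G z >]) domD).
have Ddom (z : D) : dom G (val z).
  have /adjoin_predP/(_ DR) := valP z => h; apply/asboolP; apply: h.
    by move=> a; apply/asboolP; exists (psi a); exact/GG0/G0F.
  by move=> y Sy; apply/asboolP.
pose sg (z : D) : E2 := sval (cid (Ddom z)).
have sgP z : G (val z, sg z) by exact: svalP (cid (Ddom z)).
have sgB : zmod_morphism sg.
  by move=> u v; exact: (fgraph_fun gG (sgP (u - v)) (fgraphB gG (sgP u) (sgP v))).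
have sgM : monoid_morphism sg.
  split=> [|u v]; first exact: (fgraph_fun gG (sgP 1) (fgraph1 gG)).
  exact: (fgraph_fun gG (sgP (u * v)) (fgraphM gG (sgP u) (sgP v))).
pose sgR : {rmorphism D -> E2} := HB.pack sg
  (GRing.isZmodMorphism.Build _ _ sg sgB) (GRing.isMonoidMorphism.Build _ _ sg sgM).
pose vR : {rmorphism D -> E1} := \val.
have [p [p0 rp sp]] := algS Sx.
pose bs : {rmorphism F -> D} := @adjoin_base F E1 phi (dom G).
have vbs : map_poly vR (map_poly bs p) = map_poly phi p.
  by rewrite -map_poly_comp.
have sbs : map_poly sgR (map_poly bs p) = map_poly psi p.
  rewrite -map_poly_comp; apply: eq_map_poly => a /=.
  by apply: (fgraph_fun gG) (sgP _) _; exact/GG0/G0F.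
have [|||y xy] := @conj_root_ex D E1 E2 vR sgR x (map_poly bs p).
- by rewrite map_poly_eq0.
- by rewrite vbs.
- by rewrite sbs.
have [G' [gG' G'D G'x]] := field_graph_conj xy.
exists G'; split=> //; last by exists y.
move=> [u v] Guv; have uD : u \in adjoin_pred phi (dom G).
  by apply/adjoin_predP => T _; apply; exists v.
have := G'D (Adjoin uD); rewrite /= (_ : sg _ = v) //.
by apply: (fgraph_fun gG) (sgP _) _.
Qed.

(** Zorn's lemma. The property is imposed on the union with [G0], so that it also holds for the
    empty set, the union of the empty chain. *)
Lemma field_graph_extend : exists G : set (E1 * E2),
  [/\ field_graph G, (G0 `<=` G)%classic & forall x, S x -> exists y, G (x, y)].
Proof.
pose P (A : set (E1 * E2)) := field_graph (A `|` G0)%classic.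
have [C CP Ctot|A [PA maxA]] := @Zorn_bigcup _ P.
  (* Two pairs from the union lie in a common member of the chain, where the closure properties can
     be read off. *)
  have key2 z z' : ((\bigcup_(X in C) X) `|` G0)%classic z ->
      ((\bigcup_(X in C) X) `|` G0)%classic z' ->
      exists A, [/\ field_graph (A `|` G0)%classic, (A `|` G0)%classic z, (A `|` G0)%classic z'
        & (A `<=` \bigcup_(X in C) X)%classic].
    have inC X : C X -> (X `<=` \bigcup_(Y in C) Y)%classic by move=> CX u Xu; exists X.
    move=> [[X CX Xz]|G0z] [[Y CY Yz]|G0z'].
    - have [XY|YX] := Ctot X Y CX CY.
        by exists Y; split; [exact: CP|left; exact: XY|left|exact: inC].
      by exists X; split; [exact: CP|left|left; exact: YX|exact: inC].
    - by exists X; split; [exact: CP|left|right|exact: inC].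
    - by exists Y; split; [exact: CP|right|left|exact: inC].
    - by exists set0; split; [rewrite set0U|right|right|].
  split.
  - by right; exact: fgraph1.
  - move=> x y x' y' h h'; have [A [gA Az Az' AC]] := key2 _ _ h h'.
    by have [/AC|] := fgraphB gA Az Az'; [left|right].
  - move=> x y x' y' h h'; have [A [gA Az Az' AC]] := key2 _ _ h h'.
    by have [/AC|] := fgraph_div gA Az Az'; [left|right].
  - move=> y h; have [A [gA Az _ AC]] := key2 _ _ h h.
    exact: (fgraph_fun gA Az (fgraph0 gA)).
exists (A `|` G0)%classic; split=> // x Sx.
have [|G' [gG' AG' [y G'x]]] := extend_step PA _ Sx; first by move=> z ?; right.
exists y; apply: contrapT => nA; apply: (maxA G').
  split; last by move/(_ (x, y) G'x) => ?; apply: nA; left.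
  by move=> z Az; apply: AG'; left.
rewrite /P (_ : (G' `|` G0)%classic = G') //.
by apply/seteqP; split=> [z [//|?]|z ?]; [apply: AG'; right|left].
Qed.

End Extension.

(** * Power series *)

Record powser (k : fieldType) := PowSer { pscoef : nat -> k }.

HB.instance Definition _ (k : fieldType) := gen_eqMixin (powser k).
HB.instance Definition _ (k : fieldType) := gen_choiceMixin (powser k).

Section PowerSeries.
Variable k : fieldType.
Local Notation ps := (powser k).
Implicit Types a b c : ps.

Lemma powserP a b : (forall n, pscoef a n = pscoef b n) -> a = b.
Proof. by case: a => a; case: b => b /= ab; congr PowSer; apply/funext. Qed.

Definition ps_zero : ps := PowSer (fun=> 0).
Definition ps_one : ps := PowSer (fun n => (n == 0%N)%:R).
Definition ps_opp a : ps := PowSer (fun n => - pscoef a n).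
Definition ps_add a b : ps := PowSer (fun n => pscoef a n + pscoef b n).
Definition ps_mul a b : ps :=
  PowSer (fun n => \sum_(i < n.+1) pscoef a i * pscoef b (n - i)).

Definition ps_trunc n a : {poly k} := \poly_(i < n) pscoef a i.

(** Up to degree [n] only truncations matter; this lets the multiplication of power series inherit
    its laws from [{poly k}]. *)
Lemma coef_ps_mul n m a b : (n < m)%N ->
  pscoef (ps_mul a b) n = (ps_trunc m a * ps_trunc m b)`_n.
Proof.
move=> nm; rewrite coefM; apply: eq_bigr => i _; rewrite !coef_poly.
by rewrite (leq_ltn_trans (leq_subr _ _) nm) (leq_ltn_trans _ nm) // -ltnS.
Qed.

Lemma ps_addA : associative ps_add.
Proof. by move=> a b c; apply: powserP => n /=; rewrite addrA. Qed.
Lemma ps_addC : commutative ps_add.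
Proof. by move=> a b; apply: powserP => n /=; rewrite addrC. Qed.
Lemma ps_add0 : left_id ps_zero ps_add.
Proof. by move=> a; apply: powserP => n /=; rewrite add0r. Qed.
Lemma ps_addN : left_inverse ps_zero ps_opp ps_add.
Proof. by move=> a; apply: powserP => n /=; rewrite addNr. Qed.
HB.instance Definition _ := GRing.isZmodule.Build ps ps_addA ps_addC ps_add0 ps_addN.

Lemma ps_mulC : commutative ps_mul.
Proof. by move=> a b; apply: powserP => n; rewrite !(@coef_ps_mul n n.+1) // mulrC. Qed.

Lemma ps_mulA : associative ps_mul.
Proof.
suff H a b c n : pscoef (ps_mul (ps_mul a b) c) n =
    (ps_trunc n.+1 a * ps_trunc n.+1 b * ps_trunc n.+1 c)`_n.
  move=> a b c; apply: powserP => n; rewrite ps_mulC !H.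
  by rewrite mulrC mulrA.
rewrite coefM; apply: eq_bigr => i _.
rewrite (@coef_ps_mul i n.+1) //; congr (_ * _).
by rewrite coef_poly ltnS leq_subr.
Qed.

Lemma ps_mul1 : left_id ps_one ps_mul.
Proof.
move=> a; apply: powserP => n /=; rewrite big_ord_recl /= mul1r subn0.
by rewrite big1 ?addr0 // => i _; rewrite mul0r.
Qed.

Lemma ps_mulD : left_distributive ps_mul ps_add.
Proof.
move=> a b c; apply: powserP => n /=; rewrite -big_split /=.
by apply: eq_bigr => i _; rewrite mulrDl.
Qed.

Lemma ps_oner_neq0 : ps_one != ps_zero.
Proof. by apply/eqP => /(congr1 (fun a => pscoef a 0)) /= /eqP; rewrite oner_eq0. Qed.

HB.instance Definition _ := GRing.Zmodule_isComNzRing.Build ps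
  ps_mulA ps_mulC ps_mul1 ps_mulD ps_oner_neq0.

Lemma pscoefD a b n : pscoef (a + b) n = pscoef a n + pscoef b n. Proof. by []. Qed.
Lemma pscoef0 n : pscoef (0 : ps) n = 0. Proof. by []. Qed.
Lemma pscoefM a b n :
  pscoef (a * b) n = \sum_(i < n.+1) pscoef a i * pscoef b (n - i).
Proof. by []. Qed.

Definition ps_unit : {pred ps} := fun a => `[< exists b, b * a = 1 >].
Definition ps_inv a : ps :=
  if pselect (exists b, b * a = 1) is left h then sval (cid h) else a.

Lemma ps_mulV : {in ps_unit, left_inverse 1 ps_inv *%R}.
Proof.
move=> a /asboolP h; rewrite /ps_inv; case: pselect => // h'.
by case: cid.
Qed.
Lemma ps_unitP a b : b * a = 1 -> ps_unit a.
Proof. by move=> h; apply/asboolP; exists b. Qed.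
Lemma ps_inv_out : {in [predC ps_unit], ps_inv =1 id}.
Proof.
move=> a /negP na; rewrite /ps_inv; case: pselect => // h.
by case: na; apply/asboolP.
Qed.
HB.instance Definition _ := GRing.ComNzRing_hasMulInverse.Build ps
  ps_mulV ps_unitP ps_inv_out.

Lemma ps_neq0P a : a != 0 ->
  exists n, pscoef a n != 0 /\ forall i, (i < n)%N -> pscoef a i = 0.
Proof.
move=> a0; have ex : exists n, pscoef a n != 0.
  apply: contrapT => h; case/eqP: a0; apply: powserP => n; rewrite pscoef0.
  by apply/eqP; apply: contrapT => /negP h'; apply: h; exists n.
have [n an minn] := ex_minnP ex; exists n; split=> // i ltin.
by apply/eqP; apply: contraLR ltin => /minn; rewrite -leqNgt.
Qed.

Lemma ps_idomain : GRing.integral_domain_axiom ps.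
Proof.
move=> a b ab0; apply/norP => -[/ps_neq0P[n [an amin]] /ps_neq0P[m [bm bmin]]].
have : pscoef (a * b) (n + m) = pscoef a n * pscoef b m.
  have ltn : (n < (n + m).+1)%N by rewrite ltnS leq_addr.
  rewrite pscoefM (bigD1 (Ordinal ltn)) //= addKn big1 ?addr0 // => i.
  rewrite -val_eqE /= neq_ltn => /orP[/amin->|ni]; rewrite ?mul0r //.
  rewrite bmin ?mulr0 // ltn_subLR; last by rewrite -ltnS ltn_ord.
  by rewrite ltn_add2r.
by rewrite ab0 pscoef0 => /esym/eqP; rewrite mulf_eq0 (negPf an) (negPf bm).
Qed.
HB.instance Definition _ := GRing.ComUnitRing_isIntegral.Build ps ps_idomain.

Lemma pscoefB a b n : pscoef (a - b) n = pscoef a n - pscoef b n. Proof. by []. Qed.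

Definition psC (c : k) : ps := PowSer (fun n => if n is 0 then c else 0).

Lemma psC_zmod : zmod_morphism psC.
Proof. by move=> x y; apply: powserP => -[|n]; rewrite pscoefB //= subr0. Qed.
Lemma psC_monoid : monoid_morphism psC.
Proof.
split=> [|x y]; first by apply: powserP => -[|n].
apply: powserP => n; rewrite pscoefM big_ord_recl /= subn0 big1 ?addr0.
  by case: n => [|n] //=; rewrite mulr0.
by move=> i _; rewrite mul0r.
Qed.
HB.instance Definition _ := GRing.isZmodMorphism.Build k ps psC psC_zmod.
HB.instance Definition _ := GRing.isMonoidMorphism.Build k ps psC psC_monoid.

Definition ps0 a : k := pscoef a 0.
Lemma ps0_zmod : zmod_morphism ps0. Proof. by []. Qed.
Lemma ps0_monoid : monoid_morphism ps0.
Proof.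
by split=> [//|x y]; rewrite /ps0 pscoefM big_ord_recl big_ord0 addr0.
Qed.
HB.instance Definition _ := GRing.isZmodMorphism.Build ps k ps0 ps0_zmod.
HB.instance Definition _ := GRing.isMonoidMorphism.Build ps k ps0 ps0_monoid.

Lemma psCK : cancel psC ps0. Proof. by []. Qed.

Definition psX : ps := PowSer (fun n => (n == 1%N)%:R).

Lemma pscoef_mulX a n : pscoef (psX * a) n = if n is m.+1 then pscoef a m else 0.
Proof.
rewrite pscoefM; case: n => [|n]; first by rewrite big_ord_recl big_ord0 addr0 mul0r.
rewrite big_ord_recl /= mul0r add0r big_ord_recl /= mul1r subSS subn0.
by rewrite big1 ?addr0 // => i _; rewrite mul0r.
Qed.

Lemma pscoef_mulXn a n i :
  pscoef (psX ^+ n * a) i = if (i < n)%N then 0 else pscoef a (i - n).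
Proof.
elim: n i => [|n IH] i; first by rewrite expr0 mul1r subn0.
by rewrite exprS -mulrA pscoef_mulX; case: i => [|i] //; rewrite IH ltnS subSS.
Qed.

Lemma psX_neq0 : psX != 0.
Proof. by apply/eqP => /(congr1 (fun a => pscoef a 1)) /eqP; rewrite /= oner_eq0. Qed.

Lemma ps0X : ps0 psX = 0. Proof. by []. Qed.

Lemma ps0_mulXn n a : ps0 (psX ^+ n.+1 * a) = 0.
Proof. by rewrite /ps0 pscoef_mulXn. Qed.

Definition psmod n a b := forall i, (i < n)%N -> pscoef a i = pscoef b i.

Lemma psmodP n a b : psmod n a b <-> exists c, a = b + psX ^+ n * c.
Proof.
split=> [ab|[c ->] i ltin]; last by rewrite pscoefD pscoef_mulXn ltin addr0.
exists (PowSer (fun i => pscoef a (i + n) - pscoef b (i + n))).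
apply: powserP => i; rewrite pscoefD pscoef_mulXn; case: ltnP => [/ab->|ni].
  by rewrite addr0.
by rewrite /= subnK // addrC subrK.
Qed.

Lemma ps0_eq0P a : ps0 a = 0 -> exists b, a = psX * b.
Proof.
move=> a0; have [c ->] : exists c, a = 0 + psX ^+ 1 * c by apply/psmodP => -[|].
by exists c; rewrite add0r expr1.
Qed.

End PowerSeries.

Arguments psX {k}.
Arguments ps0 : simpl never.
Arguments psC : simpl never.

(** * Taylor expansion and Hensel's lemma *)

Lemma horner_taylor2 (R : comNzRingType) (p : {poly R}) (y h : R) :
  exists r, p.[y + h] = p.[y] + p^`().[y] * h + h ^+ 2 * r.
Proof.
elim/poly_ind: p => [|p c [r IH]]; first by exists 0; rewrite deriv0 !horner0; ring.
exists (p^`().[y] + r * (y + h)).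
rewrite derivD derivM derivX derivC addr0 mulr1 !hornerE IH; ring.
Qed.

Lemma horner_taylor1 (R : comNzRingType) (p : {poly R}) (y h : R) :
  exists r, p.[y + h] = p.[y] + h * r.
Proof.
by have [r ->] := horner_taylor2 p y h; exists (p^`().[y] + h * r); ring.
Qed.

Section Hensel.
Variables (k : fieldType) (P : {poly powser k}).
Local Notation ps := (powser k).
Local Notation P0 := (map_poly (@ps0 k) P).

Lemma ps0_horner (y : ps) : ps0 P.[y] = P0.[ps0 y].
Proof. by rewrite horner_map. Qed.

Lemma ps0_deriv_horner (y : ps) : ps0 P^`().[y] = P0^`().[ps0 y].
Proof. by rewrite deriv_map horner_map. Qed.

(** Taylor expansion gives [0 = (y' - y) * (P'(y) + (y' - y) * r)], and the second factor has a
    nonzero constant term. This uniqueness later makes Hensel lifts invariant under scaling of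
    [psX]. *)
Lemma hensel_uniq (y y' : ps) : root P y -> root P y' -> ps0 y = ps0 y' ->
  P0^`().[ps0 y] != 0 -> y = y'.
Proof.
move=> /rootP Py /rootP Py' yy' d0; apply/eqP; rewrite eq_sym -subr_eq0.
have [r] := horner_taylor2 P y (y' - y).
rewrite addrC subrK Py Py' add0r expr2 -mulrA mulrC -mulrDr => /esym/eqP.
rewrite mulf_eq0 => /orP[//|/eqP/(congr1 (@ps0 k))].
rewrite rmorphD rmorphM rmorphB /= yy' subrr mul0r addr0 ps0_deriv_horner.
by move/eqP; rewrite (negPf d0).
Qed.

Variable y0 : k.
Hypotheses (rP0 : root P0 y0) (dP0 : P0^`().[y0] != 0).

(** Newton's iteration with the slope frozen at [y0]: it gains only one power of [psX] per step, but
    no power series has to be inverted. *)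
Let newton (n : nat) : ps :=
  iter n (fun y => y - psC (P0^`().[y0])^-1 * P.[y]) (psC y0).

Let newtonP n : ps0 (newton n) = y0 /\ exists c, P.[newton n] = psX ^+ n.+1 * c.
Proof.
elim: n => [|n [IH1 [c IH2]]].
  split=> //; have [|c ->] := @ps0_eq0P k P.[psC y0].
    by rewrite ps0_horner psCK (rootP rP0).
  by exists c; rewrite expr1.
set I := psC (P0^`().[y0])^-1.
have E : newton n.+1 = newton n + - I * (psX ^+ n.+1 * c) by rewrite /newton iterS -/(newton n) IH2 mulNr.
rewrite E; split; first by rewrite rmorphD rmorphM /= ps0_mulXn mulr0 addr0.
have [r ->] := horner_taylor2 P (newton n) (- I * (psX ^+ n.+1 * c)).
(* The factor by which the linear step misses has constant term [0], because [I] inverts the slope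
   at [y0]; the [psX] that it contains is the gain in order. *)
have [|e Ee] := @ps0_eq0P k (1 - P^`().[newton n] * I).
  by rewrite rmorphB rmorph1 rmorphM /= ps0_deriv_horner IH1 psCK divff // subrr.
exists (e * c + psX ^+ n * (I ^+ 2 * c ^+ 2 * r)).
have -> : psX ^+ n.+2 = psX ^+ n.+1 * psX :> ps by rewrite exprSr.
rewrite mulrDr -[_ * psX * (e * c)]mulrA [psX * (e * c)]mulrA -Ee IH2.
rewrite exprSr; ring.
Qed.

Let newton_step n m : (n <= m)%N -> psmod n.+1 (newton m) (newton n).
Proof.
move=> /subnK <-; elim: (m - n)%N => [|i IH] //.
rewrite addSn => l ln; rewrite -(IH l ln).
have [_ [c Ec]] := newtonP (i + n); rewrite /newton iterS -/(newton (i + n)) Ec.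
rewrite pscoefB mulrCA pscoef_mulXn.
by rewrite (leq_trans ln) ?subr0 // ltnS leq_addl.
Qed.

Lemma hensel : exists2 y, root P y & ps0 y = y0.
Proof.
(* The coefficient of degree [n] is stable from step [n] on. *)
pose y : ps := PowSer (fun n => pscoef (newton n) n).
have yn n : psmod n.+1 y (newton n).
  by move=> i; rewrite ltnS => /newton_step/(_ i (ltnSn i)) ->.
exists y => //; apply/rootP; apply: powserP => n; rewrite pscoef0.
have /psmodP[c ->] := yn n; have [r ->] := horner_taylor1 P (newton n) (psX ^+ n.+1 * c).
have [_ [e ->]] := newtonP n.
by rewrite pscoefD -mulrA !pscoef_mulXn ltnSn addr0.
Qed.

End Hensel.

Section Scaling.
Variables (k : fieldType) (w : k).
Local Notation ps := (powser k).

(** The substitution of [w * psX] for [psX]; with [w] a root of unity it is the local inertia. *)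
Definition ps_scale (a : ps) : ps := PowSer (fun n => w ^+ n * pscoef a n).

Lemma ps_scale_zmod : zmod_morphism ps_scale.
Proof. by move=> a b; apply: powserP => n; rewrite /= mulrDr mulrN. Qed.

Lemma ps_scale_monoid : monoid_morphism ps_scale.
Proof.
split=> [|a b]; apply: powserP => n.
  by case: n => [|n]; rewrite /= ?mulr1 ?mulr0.
rewrite [LHS]/= !pscoefM mulr_sumr; apply: eq_bigr => i _ /=.
by rewrite mulrACA -exprD subnKC // -ltnS.
Qed.

HB.instance Definition _ := GRing.isZmodMorphism.Build ps ps ps_scale ps_scale_zmod.
HB.instance Definition _ := GRing.isMonoidMorphism.Build ps ps ps_scale ps_scale_monoid.

Lemma ps_scale_inj : w != 0 -> injective ps_scale.
Proof.
move=> w0 a b /(congr1 (fun a => pscoef a _)) ab; apply: powserP => n.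
by have /= := ab n; apply: mulfI; rewrite expf_neq0.
Qed.

Lemma ps_scaleC c : ps_scale (psC c) = psC c.
Proof. by apply: powserP => -[|n] /=; rewrite ?mul1r ?mulr0. Qed.

Lemma ps_scaleX : ps_scale psX = psC w * psX.
Proof.
apply: powserP => n; rewrite mulrC pscoef_mulX /=.
by case: n => [|[|n]]; rewrite ?mulr0 ?mulr1.
Qed.

Lemma ps0_scale a : ps0 (ps_scale a) = ps0 a.
Proof. by rewrite /ps0 /= mul1r. Qed.

End Scaling.

(** * Roots in separably closed fields *)

Section SeparablyClosed.
Variable L : fieldType.
Hypothesis hL : separably_closed L.

Lemma separable_poly_roots (p : {poly L}) : separable_poly p ->
  exists2 rs, uniq rs & p %= \prod_(r <- rs) ('X - r%:P).
Proof.
have [n] := ubnP (size p); elim: n => // n IH in p *; rewrite ltnS => pn sp.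
have [p1|p1] := leqP (size p) 1.
  exists [::] => //; rewrite big_nil -size_poly_eq1 eqn_leq p1 lt0n size_poly_eq0.
  by apply: contraTneq sp => ->; rewrite separable_poly.unlock deriv0 coprimep0 -size_poly_eq1 size_poly0.
have [x rx] := hL sp p1; have /factor_theorem[q Eq] := rx.
move: (sp); rewrite Eq separable_root => /andP[sq nrq].
have q0 : q != 0 by apply: contraNneq nrq => ->; rewrite root0.
have [|rs urs qrs] := IH q _ sq.
  by apply: leq_trans pn; rewrite Eq size_mul ?polyXsubC_eq0 // size_XsubC addn2.
exists (x :: rs); last by rewrite big_cons mulrC eqp_mull.
by rewrite /= urs andbT -root_prod_XsubC -(eqp_root qrs).
Qed.

Lemma separable_poly_splits (p : {poly L}) : separable_poly p -> splits p.
Proof. by move=> /separable_poly_roots[rs _ h]; exists rs. Qed.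

Lemma separable_Xn_subC (n : nat) (a : L) : n%:R != 0 :> L -> a != 0 ->
  separable_poly ('X^n - a%:P).
Proof.
move=> n0 a0; rewrite separable_poly.unlock; apply/Bezout_coprimepP.
exists (- (n%:R : L)%:P, 'X) => /=; rewrite derivB derivC subr0 derivXn.
have -> : (- polyC (n%:R : L)) * (GRing.exp (polyX L) n - polyC a) + (polyX L) * (GRing.exp (polyX L) n.-1 *+ n) = polyC (n%:R * a).
  case: n n0 => [|n] n0; first by rewrite eqxx in n0.
  rewrite polyCM !polyC_natr -mulr_natr /= exprS; ring.
by rewrite polyC_eqp1 mulf_neq0.
Qed.

Lemma nth_root_ex (n : nat) (a : L) : n%:R != 0 :> L -> exists b, b ^+ n = a.
Proof.
move=> n0; have npos : (0 < n)%N by rewrite lt0n; apply: contraNneq n0 => ->.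
have [->|a0] := eqVneq a 0; first by exists 0; rewrite expr0n gtn_eqF.
have [|b] := hL (separable_Xn_subC n0 a0).
  by rewrite size_XnsubC.
by rewrite rootE !hornerE subr_eq0 => /eqP; exists b.
Qed.

Lemma prim_root_ex (n : nat) : n%:R != 0 :> L -> exists w : L, n.-primitive_root w.
Proof.
move=> n0; have npos : (0 < n)%N by rewrite lt0n; apply: contraNneq n0 => ->.
have [rs urs rsP] := separable_poly_roots (separable_Xn_subC n0 (oner_neq0 L)).
have := @has_prim_root L n rs npos _ urs; case/(_ _ _)/hasP => //.
- apply/allP => x xrs; rewrite unity_rootE -subr_eq0.
  have : root ('X^n - 1%:P) x by rewrite (eqp_root rsP) root_prod_XsubC.
  by rewrite rootE !hornerE.
- by have := eqp_size rsP; rewrite size_XnsubC // size_prod_XsubC => -[->].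
by move=> w _ hw; exists w.
Qed.

End SeparablyClosed.

Lemma prim_root_neq0 (k : fieldType) (n : nat) (w : k) : n.-primitive_root w -> w != 0.
Proof.
move=> w_prim; apply: contra_eq_neq (prim_expr_order w_prim) => ->.
by rewrite expr0n gtn_eqF ?(prim_order_gt0 w_prim) // eq_sym oner_neq0.
Qed.

(** * Iterates and their separability *)

(** Modulo [h - c] the composite [q \Po h] is the nonzero constant [q.[c]]. *)
Lemma coprimep_comp_sub (L : fieldType) (q h : {poly L}) (c : L) :
  q.[c] != 0 -> coprimep (q \Po h) (h - c%:P).
Proof.
move=> qc; have : root (q - (q.[c])%:P) c by rewrite rootE !hornerE subrr.
move=> /factor_theorem[r Er]; apply/Bezout_coprimepP; exists (1, - (r \Po h)) => /=.
rewrite -[q](subrK (q.[c])%:P) Er comp_polyD comp_polyC comp_polyM comp_polyB.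
by rewrite comp_polyX comp_polyC mul1r mulNr addrC addKr polyC_eqp1.
Qed.

Section Iterates.
Variables (k : fieldType) (f : {poly k}).

Definition fiter n : {poly k} := iter n (fun p => f \Po p) 'X.

Lemma fiterS n : fiter n.+1 = f \Po fiter n. Proof. by []. Qed.

Lemma fiterD n m : fiter (n + m) = fiter n \Po fiter m.
Proof.
elim: n => [|n IH]; first by rewrite comp_polyX.
by rewrite addSn !fiterS IH comp_polyA.
Qed.


Lemma horner_fiter n x : (fiter n).[x] = iter n (horner f) x.
Proof. by elim: n => [|n IH]; rewrite /= ?hornerX // horner_comp IH. Qed.

Lemma size_fiter n : (1 < size f)%N -> size (fiter n) = ((size f).-1 ^ n).+1.
Proof.
move=> f1; elim: n => [|n IH]; first by rewrite size_polyX.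
have := size_comp_poly f (fiter n); rewrite -fiterS IH /= -expnS.
case: (size (fiter n.+1)) => [|m] /=; last by move=> ->.
by move=> /esym/eqP; rewrite expn_eq0 /= -subn1 subn_eq0 leqNgt f1.
Qed.

Lemma deriv_fiter n : (fiter n)^`() = \prod_(i < n) (f^`() \Po fiter i).
Proof.
elim: n => [|n IH]; first by rewrite derivX big_ord0.
by rewrite fiterS deriv_comp IH big_ord_recr /= mulrC.
Qed.

End Iterates.

Lemma map_fiter (k L : fieldType) (s : {rmorphism k -> L}) f n :
  map_poly s (fiter f n) = fiter (map_poly s f) n.
Proof.
elim: n => [|n IH]; first exact: map_polyX.
by rewrite !fiterS map_comp_poly IH.
Qed.

(** By the chain rule the derivative of [fiter f n] is, up to a unit, a product of factors
    [fiter f i - c] with [c] critical and [i < n]. At a root of such a factor, [fiter f n] takes the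
    value [(fiter f (n - i)).[c]], which [w] avoids. *)
Lemma separable_fiter (k L : fieldType) (s : {rmorphism k -> L}) (f : {poly k})
    (cs : seq k) (n : nat) (w : L) :
  f^`() %= \prod_(c <- cs) ('X - c%:P) ->
  (forall c m, c \in cs -> (0 < m <= n)%N -> w != s (fiter f m).[c]) ->
  separable_poly (map_poly s (fiter f n) - w%:P).
Proof.
move=> fcs wP; rewrite separable_poly.unlock derivB derivC subr0 deriv_map deriv_fiter.
rewrite rmorph_prod /=.
suff H (i : 'I_n) : coprimep (map_poly s (fiter f n) - w%:P)
    (map_poly s (f^`() \Po fiter f i)).
  elim/big_ind: _ => [|p q hp hq|i _]; [exact: coprimep1| |exact: H].
  by rewrite coprimepMr hp.
have /andP[/dvdpP[a Ea] _] := fcs.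
have : map_poly s (f^`() \Po fiter f i) %= map_poly s (\prod_(c <- cs) (fiter f i - c%:P)).
  rewrite eqp_map.
  have -> : \prod_(c <- cs) (fiter f i - c%:P) = (\prod_(c <- cs) ('X - c%:P)) \Po fiter f i.
    rewrite (big_morph (fun p => p \Po fiter f i) (id1 := 1) (op1 := *%R)) //.
    - by apply: eq_bigr => c _; rewrite comp_polyB comp_polyX comp_polyC.
    - by move=> p q; rewrite comp_polyM.
    - by rewrite comp_polyC.
  case/eqpP: fcs => -[u v] /= /andP[u0 v0] E; apply/eqpP; exists (u, v); rewrite /= ?u0 //.
  by rewrite -!comp_polyZ E.
move=> /eqp_coprimepr ->; rewrite rmorph_prod /=.
elim: cs {fcs Ea} wP => [|c cs IH] wP; first by rewrite big_nil coprimep1.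
rewrite big_cons coprimepMr IH ?andbT; last first.
  by move=> c' m c'cs; apply: wP; rewrite in_cons c'cs orbT.
rewrite rmorphB /= map_polyC.
have -> : fiter f n = fiter f (n - i) \Po fiter f i by rewrite -fiterD subnK // ltnW.
rewrite map_comp_poly -[w%:P](comp_polyC _ (map_poly s (fiter f i))) -comp_polyB.
apply: coprimep_comp_sub; rewrite !hornerE horner_map subr_eq0 eq_sym.
by apply: wP; rewrite ?mem_head // subn_gt0 ltn_ord leq_subr.
Qed.

Lemma fiter1 (k : fieldType) (f : {poly k}) : fiter f 1 = f.
Proof. exact: comp_polyXr. Qed.

(** * Tame polynomials *)

Section Valuations.
Import Order.TTheory Num.Theory.

Section FractionValuation.
Variables (R : idomainType) (v : R -> int).
Hypothesis vM : forall a b, a != 0 -> b != 0 -> v (a * b) = v a + v b.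
Hypothesis vD : forall a b, a != 0 -> b != 0 -> a + b != 0 -> Num.min (v a) (v b) <= v (a + b).

Definition frac_val (x : {fraction R}) : int :=
  let a := sval (cid (fractionP x)) in
  let b := sval (cid (svalP (cid (fractionP x)))) in v a - v b.

Lemma frac_valE a b : a != 0 -> b != 0 -> frac_val (tofrac a / tofrac b) = v a - v b.
Proof.
move=> a0 b0; rewrite /frac_val; case: cid => a' /= ex; case: cid => b' /= [b'0].
move/eqP; rewrite eqr_div ?tofrac_eq0 // -!tofracM tofrac_eq => /eqP E.
have a'0 : a' != 0.
  apply: contra_neq (mulf_neq0 a0 b'0); rewrite E => ->.
  by rewrite mul0r.
have := congr1 v E; rewrite !vM // => E'; lia.
Qed.

Lemma frac_val_tofrac a : a != 0 -> frac_val (tofrac a) = v a.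
Proof.
move=> a0; rewrite -[tofrac a]divr1 -tofrac1 frac_valE ?oner_neq0 //.
have := @vM 1 1; rewrite mulr1 !oner_neq0 => /(_ isT isT); lia.
Qed.

Lemma fraction_neq0P (x : {fraction R}) : x != 0 ->
  exists a b, [/\ a != 0, b != 0 & x = tofrac a / tofrac b].
Proof.
move=> x0; have [a [b [b0 Ex]]] := fractionP x; exists a, b; split=> //.
by apply: contraNneq x0 => a0; rewrite Ex a0 tofrac0 mul0r.
Qed.

Lemma frac_val_discrete : (exists2 x, x != 0 & frac_val x = 1) ->
  discrete_valuation frac_val.
Proof.
move=> h1; split=> // [x y|x y].
  move=> /fraction_neq0P[a [b [a0 b0 ->]]] /fraction_neq0P[c [d [c0 d0 ->]]].
  rewrite mulf_div -!tofracM !frac_valE ?mulf_neq0 // !vM //; lia.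
move=> /fraction_neq0P[a [b [a0 b0 ->]]] /fraction_neq0P[c [d [c0 d0 ->]]].
rewrite addf_div ?tofrac_eq0 // -!tofracM -tofracD => h.
have ac0 : a * d + c * b != 0.
  by apply: contraNneq h => ->; rewrite tofrac0 mul0r.
rewrite !frac_valE ?mulf_neq0 // !vM //.
have := vD (mulf_neq0 a0 d0) (mulf_neq0 c0 b0) ac0; rewrite !vM // !ge_min.
have shift (A B D X : int) : A + D <= X -> A - B <= X - (B + D).
  by move=> AX; rewrite opprD addrA lerBrDr addrAC lerD2r.
move=> /orP[h'|h']; apply/orP; [left|right]; first exact: shift.
by rewrite [v b + _]addrC; exact: shift.
Qed.

End FractionValuation.

Section IrreducibleValuation.
Variables (k : fieldType) (pi : {poly k}).
Hypothesis irr : irreducible_poly pi.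
Implicit Types p q : {poly k}.

Lemma irr_neq0 : pi != 0.
Proof. by case: irr => s _; rewrite -size_poly_gt0 ltnW. Qed.

Lemma irr_dvdM p q : (pi %| p * q) = (pi %| p) || (pi %| q).
Proof.
apply/idP/orP => [pq|[h|h]]; last 2 first.
- exact: dvdp_mulr.
- exact: dvdp_mull.
have [|np] := boolP (pi %| p); [by left|right].
have cop : coprimep pi p.
  case: irr => _ h; rewrite coprimep_def; apply: contraNT np => s1.
  have /(h _ s1)/eqp_dvdl <- := dvdp_gcdl pi p; exact: dvdp_gcdr.
by rewrite -(Gauss_dvdpr _ cop).
Qed.

Lemma pival_ex p : p != 0 -> exists n q, p = pi ^+ n * q /\ ~~ (pi %| q).
Proof.
have [m] := ubnP (size p); elim: m => // m IH in p *; rewrite ltnS => sm p0.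
have [/dvdpP[q Eq]|np] := boolP (pi %| p); last by exists 0%N, p; rewrite expr0 mul1r.
have q0 : q != 0 by apply: contraNneq p0 => q0; rewrite Eq q0 mul0r.
have [|n [r [Er nr]]] := IH q _ q0.
  apply: leq_trans sm; rewrite Eq size_mul ?irr_neq0 //.
  by case: irr; case: (size pi) => [|[|s]] // _ _; rewrite !addnS ltnS leq_addr.
by exists n.+1, r; rewrite Eq Er exprSr; split=> //; ring.
Qed.

Definition pival p : nat :=
  if pselect (p != 0) is left h then sval (cid (pival_ex h)) else 0.

Lemma pivalP p : p != 0 -> exists q, p = pi ^+ pival p * q /\ ~~ (pi %| q).
Proof. by move=> p0; rewrite /pival; case: pselect => // h; case: cid. Qed.

Lemma pival_uniq n p : ~~ (pi %| p) -> pival (pi ^+ n * p) = n.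
Proof.
move=> np; have p0 : p != 0 by apply: contraNneq np => ->; rewrite dvdp0.
have pin m : pi ^+ m != 0 by rewrite expf_neq0 ?irr_neq0.
have [q [E nq]] := pivalP (mulf_neq0 (pin n) p0); set m := pival _ in E *.
have key a b (u u' : {poly k}) : pi ^+ a * u = pi ^+ b * u' -> ~~ (pi %| u) -> (b <= a)%N.
  move=> E1 nu; rewrite leqNgt; apply: contra nu => ab.
  move: E1; rewrite -(subnK (ltnW ab)) addnC exprD -mulrA => /(mulfI (pin _)) ->.
  by rewrite -(ltn_predK (_ : 0 < b - a)%N) ?subn_gt0 // exprS -mulrA dvdp_mulr.
by apply/eqP; rewrite eqn_leq (key _ _ _ _ E np) (key _ _ _ _ (esym E) nq).
Qed.

Lemma pivalM p q : p != 0 -> q != 0 -> pival (p * q) = (pival p + pival q)%N.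
Proof.
move=> /pivalP[p' [Ep np]] /pivalP[q' [Eq nq]].
rewrite {1}Ep {1}Eq mulrACA -exprD pival_uniq //.
by rewrite irr_dvdM negb_or np.
Qed.

Lemma pival_geq p n : p != 0 -> (n <= pival p)%N = (pi ^+ n %| p).
Proof.
move=> p0; apply/idP/idP => [le|/dvdpP[q Eq]].
  have [q [-> _]] := pivalP p0; rewrite -(subnK le) exprD -mulrA mulrCA.
  exact: dvdp_mulr.
have q0 : q != 0 by apply: contraNneq p0 => q0; rewrite Eq q0 mul0r.
rewrite Eq pivalM ?expf_neq0 ?irr_neq0 //.
have -> : pival (pi ^+ n) = n; last exact: leq_addl.
rewrite -[pi ^+ n]mulr1 pival_uniq // dvdp1; case: irr => s1 _.
by rewrite neq_ltn s1 orbT.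
Qed.

Lemma pival_gt0 p : p != 0 -> (0 < pival p)%N = (pi %| p).
Proof. by move=> p0; rewrite pival_geq // expr1. Qed.

Definition pi_val : ratfun k -> int := frac_val (fun p => (pival p)%:Z).

Lemma pivalZM p q : p != 0 -> q != 0 -> (pival (p * q))%:Z = (pival p)%:Z + (pival q)%:Z.
Proof. by move=> p0 q0; rewrite pivalM // PoszD. Qed.

Lemma pi_val_discrete : discrete_valuation pi_val.
Proof.
apply: frac_val_discrete; first exact: pivalZM.
- move=> p q p0 q0 pq0.
  have : (minn (pival p) (pival q) <= pival (p + q))%N.
    by rewrite pival_geq // dvdp_add // -pival_geq // ?geq_minl ?geq_minr.
  by rewrite geq_min ge_min.
- exists (tofrac pi); first by rewrite tofrac_eq0 irr_neq0.
  rewrite frac_val_tofrac ?irr_neq0 //; last exact: pivalZM.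
  rewrite -[X in pival X]mulr1 -[X in X * 1]expr1 pival_uniq // dvdp1.
  by case: irr => s1 _; rewrite neq_ltn s1 orbT.
Qed.

Lemma pi_valE a b : a != 0 -> b != 0 ->
  pi_val (tofrac a / tofrac b) = (pival a)%:Z - (pival b)%:Z.
Proof. by move=> a0 b0; rewrite /pi_val frac_valE //; exact: pivalZM. Qed.

Lemma pi_val_tofrac a : a != 0 -> pi_val (tofrac a) = (pival a)%:Z.
Proof. by move=> a0; rewrite /pi_val frac_val_tofrac //; exact: pivalZM. Qed.

Lemma pi_val_const a : a != 0 -> pi_val (ratfun_const k a) = 0.
Proof.
move=> a0; rewrite pi_val_tofrac ?polyC_eq0 //; congr Posz.
apply/eqP; rewrite -leqn0 leqNgt pival_gt0 ?polyC_eq0 //.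
rewrite /dvdp modp_small ?polyC_eq0 //; case: irr => s1 _.
by apply: leq_ltn_trans s1; exact: size_polyC_leq1.
Qed.

End IrreducibleValuation.

(** Minus the degree, that is, the order of vanishing at infinity; [size] exceeds the degree by
    one. *)
Definition inf_val (k : fieldType) : ratfun k -> int :=
  frac_val (fun p : {poly k} => 1 - (size p)%:Z).

Lemma inf_valM (k : fieldType) (a b : {poly k}) : a != 0 -> b != 0 ->
  1 - (size (a * b))%:Z = (1 - (size a)%:Z) + (1 - (size b)%:Z).
Proof.
move=> a0 b0; rewrite size_mul //.
move: a0 b0; rewrite -!size_poly_gt0; case: (size a) => // n _; case: (size b) => // m _; rewrite addSn addnS /=; lia.
Qed.

Lemma inf_valE (k : fieldType) (a b : {poly k}) : a != 0 -> b != 0 ->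
  inf_val (tofrac a / tofrac b) = (size b)%:Z - (size a)%:Z.
Proof. by move=> a0 b0; rewrite /inf_val frac_valE //; [lia|exact: inf_valM]. Qed.

Lemma inf_val_discrete (k : fieldType) : discrete_valuation (@inf_val k).
Proof.
apply: frac_val_discrete; first exact: inf_valM.
- move=> a b a0 b0 ab0; have := size_polyD a b.
  rewrite leq_max ge_min => /orP[h|h]; apply/orP; [left|right]; by rewrite lerD2l lerN2 lez_nat.
- exists (tofrac 1 / tofrac 'X); last by rewrite frac_valE ?oner_neq0 ?polyX_eq0 ?size_polyX ?size_poly1 //; exact: inf_valM.
  by rewrite mulf_neq0 ?invr_eq0 ?tofrac_eq0 ?oner_neq0 ?polyX_eq0.
Qed.

Lemma irreducible_factor_ex (k : fieldType) (h : {poly k}) : (1 < size h)%N ->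
  exists2 p : {poly k}, irreducible_poly p & p %| h.
Proof.
have [n] := ubnP (size h); elim: n => // n IH in h *; rewrite ltnS => hn h1.
have [irr|nirr] := pselect (irreducible_poly h); first by exists h.
have [q [q1 qh nqh]] : exists q : {poly k}, [/\ size q != 1%N, q %| h & ~ (q %= h)].
  apply: contrapT => nex; apply: nirr; split=> // q q1 qh.
  by apply: contrapT => nqh; apply: nex; exists q; split.
have h0 : h != 0 by rewrite -size_poly_gt0 ltnW.
have q0 : q != 0 by apply: contraTneq qh => ->; rewrite dvd0p.
have [||p irr pq] := IH q.
- apply: leq_trans hn; rewrite ltn_neqAle dvdp_leq // andbT.
  by apply/negP => /eqP E; apply: nqh; rewrite -(dvdp_size_eqp qh) E.
- by rewrite ltn_neqAle eq_sym q1 size_poly_gt0.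
by exists p => //; exact: dvdp_trans qh.
Qed.

Section ResidueMap.
Variables (k kappa : fieldType) (w : ratfun k -> int) (r : ratfun k -> kappa).
Hypotheses (dw : discrete_valuation w) (rw : residue_map w r).
Hypothesis wc : forall a, a != 0 -> w (ratfun_const k a) = 0.

Lemma residueD x y : valuation_ring w x -> valuation_ring w y -> r (x + y) = r x + r y.
Proof. by case: rw => _ h _ _ vx vy; case: (h x y vx vy). Qed.

Lemma residueM x y : valuation_ring w x -> valuation_ring w y -> r (x * y) = r x * r y.
Proof. by case: rw => _ h _ _ vx vy; case: (h x y vx vy). Qed.

Lemma residue_eq0 x : valuation_ring w x -> r x = 0 <-> valuation_ideal w x.
Proof. by case: rw => _ _ h _; exact: h. Qed.

Lemma residue0 : r 0 = 0.
Proof. by apply/residue_eq0; left. Qed.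

Lemma residue1 : r 1 = 1. Proof. by case: rw. Qed.

Lemma valring_const a : valuation_ring w (ratfun_const k a).
Proof.
have [->|a0] := eqVneq a 0; first by left; rewrite rmorph0.
by right; rewrite wc.
Qed.

Lemma valringM x y : valuation_ring w x -> valuation_ring w y -> valuation_ring w (x * y).
Proof.
have [->|x0] := eqVneq x 0; first by rewrite mul0r; left.
have [->|y0] := eqVneq y 0; first by rewrite mulr0; left.
move=> [/eqP|vx]; first by rewrite (negPf x0).
move=> [/eqP|vy]; first by rewrite (negPf y0).
by right; case: dw => -> // _ _; rewrite addr_ge0.
Qed.

Lemma valringD x y : valuation_ring w x -> valuation_ring w y -> valuation_ring w (x + y).
Proof.
have [->|x0] := eqVneq x 0; first by rewrite add0r.
have [->|y0] := eqVneq y 0; first by rewrite addr0.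
move=> [/eqP|vx]; first by rewrite (negPf x0).
move=> [/eqP|vy]; first by rewrite (negPf y0).
have [->|xy0] := eqVneq (x + y) 0; first by left.
by right; case: dw => _ h _; apply: le_trans (h _ _ x0 y0 xy0); rewrite le_min vx vy.
Qed.

Lemma residue_nat n : r n%:R = n%:R.
Proof.
have vn m : valuation_ring w m%:R.
  by rewrite -(rmorph_nat (ratfun_const k)); exact: valring_const.
by elim: n => [|n IH]; rewrite ?residue0 // -addn1 !natrD residueD ?IH ?residue1 //; exact: (vn 1%N).
Qed.

Lemma residue_sum (n : nat) (F : 'I_n -> ratfun k) :
  (forall i, valuation_ring w (F i)) ->
  valuation_ring w (\sum_(i < n) F i) /\ r (\sum_(i < n) F i) = \sum_(i < n) r (F i).
Proof.
move=> vF; apply: (@big_ind2 _ _ (fun x y => valuation_ring w x /\ r x = y)).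
- by split; [left|exact: residue0].
- by move=> x x' y y' [vx <-] [vy <-]; split; [exact: valringD|exact: residueD].
- by [].
Qed.

Lemma residueX x n : valuation_ring w x -> valuation_ring w (x ^+ n) /\ r (x ^+ n) = r x ^+ n.
Proof.
move=> vx; elim: n => [|n [IH1 IH2]].
  by rewrite !expr0 residue1; split=> //; rewrite -(rmorph1 (ratfun_const k)); exact: valring_const.
by rewrite !exprS -IH2; split; [exact: valringM|exact: residueM].
Qed.

End ResidueMap.

Section TamePolynomial.
Variables (k : fieldType) (f : {poly k}) (phi : {rmorphism ratfun k -> ratfun k}).
Hypothesis phiC : forall a, phi (ratfun_const k a) = ratfun_const k a.
Hypothesis phiX : phi (ratfun_var k) = tofrac f.
Hypothesis tame : tamely_ramified_ext phi (ratfun_const k).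

Lemma phi_tofrac p : phi (tofrac p) = tofrac (p \Po f).
Proof.
elim/poly_ind: p => [|p c IH]; first by rewrite comp_poly0 !rmorph0.
rewrite comp_poly_MXaddC !rmorphD !rmorphM /= IH; congr (_ * _ + _).
  exact: phiX.
exact: phiC.
Qed.

Lemma comp_neq0 p : p != 0 -> p \Po f != 0.
Proof. by move=> p0; rewrite -tofrac_eq0 -phi_tofrac fmorph_eq0 tofrac_eq0. Qed.

Lemma tame_size : (1 < size f)%N.
Proof.
rewrite ltnNge; apply/negP => /size1_polyC fc.
have /comp_neq0 : ('X - (f`_0)%:P : {poly k}) != 0 by rewrite polyXsubC_eq0.
by rewrite comp_polyB comp_polyX comp_polyC {1}fc subrr eqxx.
Qed.

(** On the image of [phi] the values of [w] are multiples of [E], and [E] itself occurs, so [E] is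
    the ramification index. It is nonzero in the residue field, into which [k] maps. *)
Lemma tame_index (w w' : ratfun k -> int) (E : nat) : discrete_valuation w ->
  (forall a, a != 0 -> w (ratfun_const k a) = 0) ->
  (forall a, a != 0 -> w (phi a) = E%:Z * w' a) ->
  (exists2 a, a != 0 & w' a = 1) -> E%:R != 0 :> k.
Proof.
move=> dw wc ww' [a1 a10 w'a1].
have [e [[e0 eP] [kappa [r [rw e_kappa _]]]]] := (tame.2 w dw wc).
have eE : (e %| E%:Z)%Z by apply/eP; exists a1 => //; rewrite ww' // w'a1 mulr1.
have [a a0 wa] : exists2 a, a != 0 & w (phi a) = e by apply/eP; exact: dvdzz.
have Ee : (E %| e)%N.
  by have := dvdz_mulr (w' a) (dvdzz E%:Z); rewrite -ww' // wa dvdzE !absz_nat.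
have -> : E = e by apply/eqP; rewrite eqn_dvd Ee /=; move: eE; rewrite dvdzE !absz_nat.
apply: contra_neq e_kappa => e0k; rewrite -(residue_nat rw wc).
by rewrite -(rmorph_nat (ratfun_const k)) e0k rmorph0 (residue0 rw).
Qed.

(** Infinity is totally ramified, with index [deg f]. *)
Lemma tame_degree : ((size f).-1)%:R != 0 :> k.
Proof.
apply: (@tame_index (@inf_val k) (@inf_val k)).
- exact: inf_val_discrete.
- move=> a a0; rewrite /= -[tofrac _]divr1 -tofrac1 inf_valE ?oner_neq0 ?polyC_eq0 //.
  by rewrite size_poly1 size_polyC a0.
- move=> _ /fraction_neq0P[a [b [a0 b0 ->]]].
  rewrite rmorphM fmorphV /= !phi_tofrac !inf_valE ?comp_neq0 //.
  have sc p : p != 0 -> size (p \Po f) = ((size p).-1 * (size f).-1 + 1)%N.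
    by move=> p0; rewrite -size_comp_poly addn1 prednK // size_poly_gt0 comp_neq0.
  rewrite !sc // !PoszD !PoszM; move: a0 b0; rewrite -!size_poly_gt0.
  case: (size a) => // sa _; case: (size b) => // sb _ /=.
  rewrite -[sa.+1]addn1 -[sb.+1]addn1 !PoszD; ring.
- by case: (inf_val_discrete k).
Qed.

(** The place [x = c] lies above [t = f(c)], and its ramification index is the multiplicity [e]. *)
Lemma tame_mult (c : k) (e : nat) (u : {poly k}) :
  f - (f.[c])%:P = ('X - c%:P) ^+ e * u -> u.[c] != 0 -> e%:R != 0 :> k.
Proof.
move=> Ef uc; pose pc : {poly k} := 'X - c%:P; pose py : {poly k} := 'X - (f.[c])%:P.
have irrc : irreducible_poly pc by apply: irredp_XsubC.
have irry : irreducible_poly py by apply: irredp_XsubC.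
have npc q : (pc %| q) = root q c by rewrite /pc dvdp_XsubCl.
have vcomp p : p != 0 -> pival irrc (p \Po f) = (e * pival irry p)%N.
  move=> p0; have [q [Ep nq]] := pivalP irry p0; rewrite {1}Ep.
  rewrite comp_polyM (rmorphXn (comp_poly f)) /= /py comp_polyB comp_polyX comp_polyC Ef.
  rewrite exprMn -exprM -mulrA pival_uniq // npc rootM negb_or.
  rewrite rootE horner_exp expf_neq0 //= rootE horner_comp -rootE.
  by move: nq; rewrite /py dvdp_XsubCl.
apply: (@tame_index (pi_val irrc) (pi_val irry)).
- exact: pi_val_discrete.
- exact: pi_val_const.
- move=> _ /fraction_neq0P[a [b [a0 b0 ->]]].
  by rewrite rmorphM fmorphV /= !phi_tofrac !pi_valE ?comp_neq0 // !vcomp //; lia.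
- by case: (pi_val_discrete irry).
Qed.


(** In lowest terms, a Bezout relation between [A] and [B] composed with [f] shows that [pi] cannot
    divide both [A \Po f] and [B \Po f]; integrality then keeps it out of the denominator. *)
Lemma integral_fraction (pi : {poly k}) (irr : irreducible_poly pi) (a : ratfun k) :
  valuation_ring (pi_val irr) (phi a) ->
  exists A B, [/\ B != 0, a = tofrac A / tofrac B & ~~ (pi %| B \Po f)].
Proof.
have pi1 : ~~ (pi %| 1) by rewrite dvdp1 neq_ltn orbC; case: irr => ->.
have [->|a0] := eqVneq a 0.
  by exists 0, 1; rewrite oner_neq0 tofrac0 mul0r comp_polyC.
have [A' [B' [A'0 B'0 Ea]]] := fraction_neq0P a0.
pose g := gcdp A' B'; have g0 : g != 0 by rewrite gcdp_eq0 (negPf A'0).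
pose A := A' %/ g; pose B := B' %/ g.
have EA : A' = A * g by rewrite divpK // dvdp_gcdl.
have EB : B' = B * g by rewrite divpK // dvdp_gcdr.
have A0 : A != 0 by apply: contraNneq A'0 => h; rewrite EA h mul0r.
have B0 : B != 0 by apply: contraNneq B'0 => h; rewrite EB h mul0r.
have cAB : coprimep A B by rewrite coprimep_div_gcd // A'0.
have EaAB : a = tofrac A / tofrac B.
  by rewrite Ea EA EB !tofracM -mulf_div divff ?mulr1 // tofrac_eq0.
move=> [/eqP|]; first by rewrite fmorph_eq0 (negPf a0).
rewrite EaAB rmorphM fmorphV /= !phi_tofrac pi_valE ?comp_neq0 // subr_ge0 lez_nat => le.
exists A, B; split=> //; apply/negP => piB.
have piA : pi %| A \Po f.
  by rewrite -(pival_gt0 irr) ?comp_neq0 //; apply: leq_trans le; rewrite pival_gt0 ?comp_neq0.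
have /Bezout_eq1_coprimepP[[u v] /= E] := cAB.
case/negP: pi1; have <- : (u * A + v * B) \Po f = 1 by rewrite E comp_polyC.
by rewrite comp_polyD !comp_polyM dvdp_add // dvdp_mull.
Qed.

(* Differentiating G(x) = 0 mod pi for a separable relation G over k(f(x))  *)
(* kills the derivatives of the coefficients (pi divides f') and of the     *)
(* right-hand side (pi' = 0), so the residue of x is a double root of G.    *)
Lemma critical_not_inseparable (pi : {poly k}) : irreducible_poly pi ->
  pi %| f^`() -> pi^`() != 0.
Proof.
move=> irr pif; apply/eqP => dpi.
have dw := pi_val_discrete irr; have wc := pi_val_const irr.
have [e [_ [kappa [r [rw _ rsep]]]]] := tame.2 _ dw wc.
have vpoly p : valuation_ring (pi_val irr) (tofrac p).
  have [->|p0] := eqVneq p 0; first by left; rewrite tofrac0.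
  by right; rewrite pi_val_tofrac.
have rpoly p : r (tofrac p) = 0 <-> pi %| p.
  rewrite (residue_eq0 rw (vpoly p)); have [->|p0] := eqVneq p 0.
    by rewrite dvdp0; split=> // _; left; rewrite tofrac0.
  rewrite -(pival_gt0 irr) //; split=> [[/eqP|]|h].
  - by rewrite tofrac_eq0 (negPf p0).
  - by rewrite pi_val_tofrac.
  - by right; rewrite pi_val_tofrac.
have [g [ga sg rg]] := rsep (r (tofrac 'X)).
have {}ga i : exists AB : {poly k} * {poly k}, [/\ AB.2 != 0, ~~ (pi %| AB.2 \Po f),
    valuation_ring (pi_val irr) (phi (tofrac AB.1 / tofrac AB.2))
    & r (phi (tofrac AB.1 / tofrac AB.2)) = g`_i].
  have [a va ra] := ga i; have [A [B [B0 Ea nB]]] := integral_fraction va.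
  by exists (A, B); rewrite -Ea.
pose A i := (sval (cid (ga i))).1; pose B i := (sval (cid (ga i))).2.
have AB i : [/\ B i != 0, ~~ (pi %| B i \Po f),
    valuation_ring (pi_val irr) (phi (tofrac (A i) / tofrac (B i)))
    & r (phi (tofrac (A i) / tofrac (B i))) = g`_i] by rewrite /A /B; case: cid.
(* [D] clears the denominators of the chosen lifts of the coefficients of [g], so that the relation
   becomes one between polynomials. *)
pose n := size g; pose D := \prod_(i < n) B i.
pose C (i : 'I_n) := A i * \prod_(l < n | l != i) B l.
have nD : ~~ (pi %| D \Po f).
  rewrite /D; elim/big_ind: _ => [|p q hp hq|i _].
  - by rewrite comp_polyC dvdp1 neq_ltn orbC; have [->] := irr.
  - by rewrite comp_polyM irr_dvdM // negb_or hp.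
  - by case: (AB i).
have rD : r (tofrac (D \Po f)) != 0 by apply/negP => /eqP/rpoly; apply/negP.
have EC i : tofrac (C i \Po f) = phi (tofrac (A i) / tofrac (B i)) * tofrac (D \Po f).
  have ED : D = B i * \prod_(l < n | l != i) B l by rewrite /D (bigD1 i).
  rewrite -!phi_tofrac -(rmorphM phi) ED /C !tofracM mulrA divfK //.
  by rewrite tofrac_eq0; case: (AB i).
have rsum (h : 'I_n -> {poly k}) :
    r (tofrac (\sum_(i < n) (C i \Po f) * h i)) =
      r (tofrac (D \Po f)) * \sum_(i < n) g`_i * r (tofrac (h i)).
  rewrite rmorph_sum /=; have [|_ ->] := residue_sum dw rw (F := fun i => tofrac ((C i \Po f) * h i)).
    by move=> i; exact: vpoly.
  rewrite mulr_sumr; apply: eq_bigr => i _; rewrite tofracM (residueM rw) //.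
  rewrite EC (residueM rw) //; last by case: (AB i).
  by have [_ _ _ ->] := AB i; rewrite mulrCA mulrA.
pose Q := \sum_(i < n) (C i \Po f) * 'X^i.
pose Q' := \sum_(i < n) (C i \Po f) * ('X^i)^`().
have rX i : r (tofrac 'X^i) = r (tofrac 'X) ^+ i.
  by rewrite tofracXn; have [] := residueX dw rw wc i (vpoly 'X).
have piQ : pi %| Q.
  apply/rpoly; rewrite rsum (eq_bigr (fun i : 'I_n => g`_i * r (tofrac 'X) ^+ i)).
    by rewrite -horner_coef (rootP rg) mulr0.
  by move=> i _; rewrite rX.
have piQ' : pi %| Q'.
  have [u Eu] := dvdpP _ _ piQ.
  have -> : Q' = Q^`() - f^`() * \sum_(i < n) ((C i)^`() \Po f) * 'X^i.
    rewrite /Q' /Q raddf_sum /= mulr_sumr -sumrB; apply: eq_bigr => i _.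
    rewrite derivM deriv_comp; ring.
  by rewrite Eu derivM dpi mulr0 addr0; apply: dvdp_sub; [exact: dvdp_mull (dvdpp _)|exact: dvdp_mulr].
have rdX i : r (tofrac ('X^i)^`()) = ('X^i)^`().[r (tofrac 'X)].
  rewrite !derivXn hornerMn hornerXn -[_ *+ i]mulr_natl tofracM (residueM rw) //.
  by rewrite rX rmorph_nat (residue_nat rw wc) mulr_natl.
have rg' : root g^`() (r (tofrac 'X)).
  have /rpoly := piQ'; rewrite rsum => /eqP; rewrite mulf_eq0 (negPf rD) /= => /eqP E.
  apply/rootP; rewrite -{}E -{1}[g]coefK poly_def raddf_sum horner_sum.
  by apply: eq_bigr => i _; rewrite /= derivZ hornerZ rdX.
move: sg; rewrite separable_poly.unlock => /coprimep_root/(_ rg).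
by rewrite -rootE rg'.
Qed.

(** Every irreducible factor of [f'] has nonzero derivative, hence is separable and has a root. That
    [f'] itself is nonzero follows from its coefficient of degree [deg f - 1], which is [deg f]
    times the leading coefficient of [f]. *)
Lemma critical_splits : separably_closed k ->
  exists cs, f^`() %= \prod_(c <- cs) ('X - c%:P).
Proof.
move=> hk; have df0 : f^`() != 0.
  apply: contra_neq tame_degree => df0; have := coef0 k (size f).-2.
  rewrite -df0 coef_deriv; have := tame_size.
  case E: (size f) => [|[|n]] //= _ /eqP.
  have lf : f`_n.+1 != 0 by rewrite -[n.+1]/(n.+2.-1) -E -lead_coefE lead_coef_eq0 -size_poly_gt0 E.
  by rewrite -[f`_n.+1 *+ _]mulr_natr mulf_eq0 (negPf lf) => /eqP.
suff H (h : {poly k}) : h != 0 -> h %| f^`() -> splits h by exact: H.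
have [n] := ubnP (size h); elim: n => // n IH in h *; rewrite ltnS => hn h0 hf.
have [h1|h1] := leqP (size h) 1.
  exists [::]; rewrite big_nil -size_poly_eq1 eqn_leq h1 size_poly_gt0 //.
have [[c /factor_theorem[q Eq]]|noroot] := pselect (exists c, root h c).
  have q0 : q != 0 by apply: contraNneq h0 => q0; rewrite Eq q0 mul0r.
  have [|||rs qrs] := IH q => //.
  - by apply: leq_trans hn; rewrite Eq size_mul ?polyXsubC_eq0 // size_XsubC addn2.
  - by apply: dvdp_trans hf; rewrite Eq dvdp_mulr.
  by exists (c :: rs); rewrite big_cons Eq mulrC eqp_mull.
have [p irr ph] := irreducible_factor_ex h1.
have p1 : (1 < size p)%N by case: irr.
have p0 : p != 0 by rewrite -size_poly_gt0 ltnW.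
have d0 := critical_not_inseparable irr (dvdp_trans ph hf).
have [sp|] := boolP (separable_poly p).
  have [c rc] := hk p sp p1; case: noroot; exists c.
  by have /dvdpP[q ->] := ph; rewrite rootM rc orbT.
rewrite separable_poly.unlock coprimep_def => g1.
have := dvdp_gcdl p p^`(); case: irr => _ irr /(irr _ g1)/eqp_dvdl E.
have : p %| p^`() by rewrite -E dvdp_gcdr.
by move=> /(dvdp_leq d0); rewrite leqNgt lt_size_deriv.
Qed.

End TamePolynomial.

End Valuations.

(** * Choice of a critical orbit *)

Section OrbitChoice.
Variables (T : choiceType) (F : T -> T) (cs : seq T).

Lemma infinite_orbit_ex :
  infinite_set [set y | exists c n, [/\ c \in cs, (0 < n)%N & y = iter n F c]]%classic ->
  exists2 c, c \in cs & forall m n, iter m F c = iter n F c -> m = n.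
Proof.
move=> inf; apply: contrapT => no; apply: inf.
have per c : exists n, c \in cs -> forall m, iter m F c \in [seq iter i F c | i <- iota 0 n].
  have [cin|_] := boolP (c \in cs); last by exists 0%N.
  have [m [n [ltmn mn]]] : exists m n, (m < n)%N /\ iter m F c = iter n F c.
    apply: contrapT => inj; apply: no; exists c => // m n mn; apply: contrapT => /eqP.
    rewrite neq_ltn => /orP[lt|lt]; apply: inj; first by exists m, n.
    by exists n, m; split=> //; exact: esym.
  exists n => _ i; elim/ltn_ind: i => i IH; have [ltin|leni] := ltnP i n.
    by apply: map_f; rewrite mem_iota.
  rewrite -(subnK leni) iterD -mn -iterD; apply: IH.
  by rewrite -{2}(subnK leni) ltn_add2l.
pose b c := sval (cid (per c)); pose orb c := [seq iter i F c | i <- iota 0 (b c)].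
apply: (sub_finite_set (B := [set` flatten [seq orb c | c <- cs]]%classic)); last exact: finite_seq.
move=> _ [c [n [cin _ ->]]] /=; apply/flattenP; exists (orb c); first exact: map_f.
by rewrite /orb /b; case: cid => /= n' h; exact: h.
Qed.

(* The relation that some iterate of c is a strictly earlier iterate of c' is *)
(* transitive, and irreflexive on infinite orbits; take c maximal for it.      *)
Lemma late_orbit_ex :
  infinite_set [set y | exists c n, [/\ c \in cs, (0 < n)%N & y = iter n F c]]%classic ->
  exists2 c, c \in cs & forall c' m n, c' \in cs -> (m < n)%N -> iter n F c <> iter m F c'.
Proof.
move=> /infinite_orbit_ex[c0 c0in inj0].
pose R c c' := exists m n, (m < n)%N /\ iter n F c = iter m F c'.
pose rank c := #|[set i : 'I_(size cs) | `[< R c (tnth (in_tuple cs) i) >]]|.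
have [N] := ubnP (rank c0); elim: N c0 c0in inj0 => // N IH c cin inj ltN.
have [[c' [c'in [m [n [ltmn Emn]]]]]|no] := pselect (exists c', c' \in cs /\ R c c'); last first.
  by exists c => // c' m n c'in ltmn E; apply: no; exists c'; split=> //; exists m, n.
have inj' a b : iter a F c' = iter b F c' -> a = b.
  move=> Eab; apply: (@addIn n); apply: inj.
  by rewrite !iterD Emn -!iterD !(addnC _ m) !iterD Eab.
apply: (IH c' c'in inj'); rewrite ltnS in ltN; apply: leq_trans ltN.
apply: proper_card; apply/fintype.properP; split.
  apply/fintype.subsetP => i; rewrite !finset.inE => /asboolP[a [b [ltab Eab]]].
  apply/asboolP; exists (m + a)%N, (b + n)%N; split; first by rewrite [(b + _)%N]addnC -addnS leq_add // ltnW.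
  by rewrite iterD Emn -iterD addnC iterD Eab -iterD.
have ltc' : (index c' cs < size cs)%N by rewrite index_mem.
exists (Ordinal ltc'); rewrite finset.inE (tnth_nth c') /= nth_index //.
  by apply/asboolP; exists m, n.
apply/negP => /asboolP[a [b [ltab /inj' Eab]]].
by rewrite Eab ltnn in ltab.
Qed.

End OrbitChoice.

(** Powers of [t] commute, so one that fixes a point fixes every point of the orbit, and the action
    is regular. *)
Lemma transitive_cycle_order (I : finType) (t : {perm I}) (i0 : I) :
  (forall i, exists m, i = (t ^+ m)%g i0) ->
  #[t]%g = #|I| /\ forall i m, (t ^+ m)%g i = i -> (#|I| %| m)%N.
Proof.
move=> tr.
have st m i : (t ^+ m)%g i = i -> (t ^+ m = 1)%g.
  move=> ti; apply/permP => i'; rewrite perm1.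
  have [a Ea] := tr i; have [b Eb] := tr i'.
  have ex : exists c, i' = (t ^+ c)%g i.
    exists (b + (#[t]%g - a %% #[t]%g))%N; rewrite Eb Ea -permM -expgD addnC -addnA.
    rewrite expgD [X in (_ * X)%g](_ : _ = 1)%g ?mulg1 //.
    by rewrite -(expg_mod_order t (_ - _ + _)) -modnDmr subnK ?modnn // ltnW ?ltn_pmod.
  have [c ->] := ex; rewrite -permM -expgD addnC expgD permM ti //.
have ord : #[t]%g = #|I|.
  rewrite -finset.cardsT; have <- : orbit 'P <[t]>%g i0 = finset.setTfor I.
    apply/finset.setP => i; rewrite finset.inE; apply/orbitP.
    by have [m ->] := tr i; exists (t ^+ m)%g => //; rewrite mem_cycle.
  rewrite card_orbit orderE; have -> : ('C_<[t]>[i0 | 'P] = 1)%g.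
    apply/eqP; rewrite finset.eqEsubset sub1G andbT; apply/fintype.subsetP => s.
    rewrite finset.inE => /andP[/cycleP[m ->] /astab1P /= E].
    by rewrite (st m i0 E) group1.
  by rewrite indexg1.
by split=> // i m /st; rewrite -ord => /eqP; rewrite -order_dvdn.
Qed.

(** * Laurent series over the field of constants *)

Section LaurentSeries.
Variable k : fieldType.
Local Notation ps := (powser k).
Local Notation L := {fraction (powser k)}.

Definition psL : {rmorphism k -> L} := @FracField.tofrac ps \o @psC k.

Lemma psL_map p (a : ps) : (map_poly psL p).[tofrac a] = tofrac (map_poly (@psC k) p).[a].
Proof. by rewrite map_poly_comp horner_map. Qed.

(** Write [p = q * (X - ps0 a) ^+ m] with [q] nonzero at [ps0 a]. The value of [q] at [a] has a
    nonzero constant term and [a] differs from its constant term, so the product cannot vanish. *)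
Lemma ps_transc (a : ps) (p : {poly k}) :
  a != psC (ps0 a) -> (map_poly (@psC k) p).[a] = 0 -> p = 0.
Proof.
move=> na pa; apply/eqP; apply: contraT => p0.
have [m [q qc Ep]] := multiplicity_XsubC p (ps0 a); rewrite p0 /= in qc.
move: pa; rewrite Ep rmorphM rmorphXn rmorphB /= map_polyX map_polyC hornerM horner_exp.
rewrite !hornerE => /eqP; rewrite mulf_eq0 expf_eq0 subr_eq0 (negPf na) andbF orbF.
move=> /eqP/(congr1 (@ps0 k)); rewrite -horner_map -map_poly_comp.
rewrite map_poly_id => [/eqP|c _]; last exact: psCK.
by rewrite -rootE (negPf qc).
Qed.

Lemma psL_transc (a : ps) (p : {poly k}) :
  a != psC (ps0 a) -> (map_poly psL p).[tofrac a] = 0 -> p = 0.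
Proof. by move=> na; rewrite psL_map => /eqP; rewrite tofrac_eq0 => /eqP; exact: ps_transc. Qed.

(** Over a field algebraic elements are integral, and integral elements are closed under
    inversion. *)
Lemma psL_transcV (a : ps) (p : {poly k}) :
  a != psC (ps0 a) -> (map_poly psL p).[(tofrac a)^-1] = 0 -> p = 0.
Proof.
move=> na pa; apply/eqP; apply: contraT => p0.
have : integralOver psL (tofrac a)^-1.
  apply: (@integral_root _ _ psL (map_poly psL p)).
  - by rewrite map_poly_eq0.
  - exact/rootP.
  - by move=> _ /(nthP 0)[i _ <-]; rewrite coef_map; exact: integral_id.
move=> /integral_inv; rewrite invrK => -[q mq /rootP/(psL_transc na) q0].
by move: mq; rewrite q0 monicE lead_coef0 eq_sym oner_eq0.
Qed.

Lemma laurent_embedding (l : L) : (forall p, (map_poly psL p).[l] = 0 -> p = 0) ->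
  exists io : {rmorphism ratfun k -> L},
    (forall a, io (ratfun_const k a) = psL a) /\ io (ratfun_var k) = l.
Proof.
move=> tl; pose ev : {rmorphism {poly k} -> L} := horner_eval l \o map_poly psL.
have [|io ioE] := @frac_map_ex _ _ ev.
  move=> p q /eqP; rewrite -subr_eq0 -rmorphB => /eqP /tl /eqP.
  by rewrite subr_eq0 => /eqP.
by exists io; split=> [a|]; rewrite /= ioE /= /horner_eval ?map_polyC ?map_polyX ?hornerE.
Qed.

Lemma laurent_scale (w : k) : w != 0 -> exists th : {rmorphism L -> L},
  forall a, th (tofrac a) = tofrac (ps_scale w a).
Proof.
move=> w0; pose ev : {rmorphism ps -> L} := @FracField.tofrac ps \o ps_scale w.
apply: (@frac_map_ex _ _ ev) => a b /eqP.
by rewrite /= tofrac_eq => /eqP /ps_scale_inj; apply.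
Qed.

Lemma laurent_fixed (io : {rmorphism ratfun k -> L}) (th : {rmorphism L -> L}) (w : k) :
  (forall a, io (ratfun_const k a) = psL a) ->
  (forall a, th (tofrac a) = tofrac (ps_scale w a)) ->
  th (io (ratfun_var k)) = io (ratfun_var k) -> forall a, th (io a) = io a.
Proof.
move=> ioC thE thX a; have [p [q [q0 ->]]] := fractionP a.
have H p' : th (io (tofrac p')) = io (tofrac p').
  elim/poly_ind: p' => [|p' c IH]; first by rewrite !rmorph0.
  rewrite !rmorphD !rmorphM /= IH; congr (_ * _ + _); first exact: thX.
  by have /= := ioC c => ->; rewrite thE ps_scaleC.
by rewrite !fmorph_div !H.
Qed.

Lemma ps_scale_comp (w w' : k) (a : ps) : ps_scale w (ps_scale w' a) = ps_scale (w * w') a.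
Proof. by apply: powserP => n /=; rewrite mulrA exprMn. Qed.

Lemma ps_scale1 (a : ps) : ps_scale 1 a = a.
Proof. by apply: powserP => n /=; rewrite expr1n mul1r. Qed.

Lemma psXn_nconst n : (0 < n)%N -> (psX ^+ n : ps) != psC (ps0 (psX ^+ n)).
Proof.
case: n => // n _; rewrite -[_ ^+ _]mulr1 ps0_mulXn rmorph0 mulr1.
by rewrite expf_neq0 // psX_neq0.
Qed.

End LaurentSeries.

(** The polynomial ring is integrally closed: clearing denominators in the integral equation gives
    [B %| A ^+ n], which coprimality allows only for a unit. *)
Lemma integral_fraction_const (k E : fieldType) (ev : {rmorphism {poly k} -> E}) (A B : {poly k}) :
  injective ev -> B != 0 -> coprimep A B -> integralOver ev (ev A / ev B) -> size B = 1%N.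
Proof.
move=> ev_inj B0 cAB [p mp /rootP rp].
have evB0 : ev B != 0 by rewrite -(rmorph0 ev) (inj_eq ev_inj).
have sp : size (map_poly ev p) = size p.
  by apply: size_map_poly_id0; rewrite (monicP mp) rmorph1 oner_eq0.
case En: (size p) => [|n]; first by move: (monic_neq0 mp); rewrite -size_poly_eq0 En.
have lp : p`_n = 1 by have := monicP mp; rewrite /lead_coef En.
have : \sum_(i < n.+1) p`_i * A ^+ i * B ^+ (n - i) = 0.
  apply: ev_inj; rewrite rmorph0 -(mul0r (ev B ^+ n)) -rp horner_coef sp En.
  rewrite rmorph_sum mulr_suml; apply: eq_bigr => i _; rewrite coef_map /= !rmorphM !rmorphXn /=.
  rewrite expr_div_n -!mulrA; congr (_ * (_ * _)); rewrite mulrC.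
  have lein : (i <= n)%N by rewrite -ltnS.
  have -> : ev B ^+ n = ev B ^+ (n - i) * ev B ^+ i by rewrite -exprD subnK.
  by rewrite mulfK // expf_neq0.
rewrite big_ord_recr /= lp mul1r subnn expr0 mulr1 addrC => /eqP; rewrite addr_eq0 => /eqP An.
have : B %| A ^+ n.
  rewrite An dvdpNr; apply: (big_ind (fun x => B %| x)) => [|x y|i _]; rewrite ?dvdp0 //.
    exact: dvdp_add.
  apply: dvdp_mull; have : (0 < n - i)%N by rewrite subn_gt0.
  by case: (n - i)%N => // l _; rewrite exprS dvdp_mulr.
have cBA : coprimep B (A ^+ n) by rewrite coprimep_sym coprimep_expl.
by move=> BA; move: cBA; rewrite coprimep_sym /coprimep (eqp_size (dvdp_gcd_idr BA)) => /eqP.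
Qed.

Section Poles.
Variable k : fieldType.
Local Notation ps := (powser k).
Local Notation psL := (psL k).

(** The leading term dominates at a pole; this serves to read off a degree from a pole order. *)
Lemma horner_pole (q : {poly k}) (z : ps) : q != 0 -> ps0 z != 0 -> exists2 z' : ps, ps0 z' != 0 &
  (map_poly psL q).[tofrac z / tofrac psX] = tofrac z' / tofrac psX ^+ (size q).-1.
Proof.
move=> q0 z0; elim/poly_ind: q q0 => [|q c IH]; first by rewrite eqxx.
have X0 : tofrac (psX : ps) != 0 by rewrite tofrac_eq0 psX_neq0.
have [->|q0] := eqVneq q 0.
  rewrite mul0r add0r polyC_eq0 => c0; exists (psC c); first by rewrite psCK.
  by rewrite map_polyC hornerC size_polyC c0 expr0 divr1.
have [z1 z10 Ez1] := IH q0; rewrite -size_poly_gt0 in q0.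
exists (z1 * z + psC c * psX ^+ (size q)).
  by rewrite rmorphD !rmorphM rmorphXn /= ps0X expr0n gtn_eqF // mulr0 addr0 mulf_neq0.
rewrite rmorphD rmorphM /= map_polyX map_polyC hornerMXaddC Ez1.
have -> : size (q * 'X + c%:P) = (size q).+1 by rewrite size_MXaddC -size_poly_eq0 gtn_eqF.
rewrite tofracD !tofracM tofracXn mulrDl /= mulfK ?expf_neq0 //; congr (_ + _).
by rewrite mulf_div -exprSr prednK.
Qed.

Lemma pole_order_uniq (z z' : ps) m n : ps0 z != 0 -> ps0 z' != 0 ->
  tofrac z / tofrac psX ^+ m = tofrac z' / tofrac psX ^+ n -> m = n.
Proof.
have X0 : tofrac (psX : ps) != 0 by rewrite tofrac_eq0 psX_neq0.
wlog ltmn : z z' m n / (m < n)%N => [wl z0 z'0 E|].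
  case: (ltngtP m n) => [lmn|lnm|//]; first by have := wl _ _ _ _ lmn z0 z'0 E.
  by have := wl _ _ _ _ lnm z'0 z0 (esym E).
move=> z0 z'0 /eqP; rewrite eqr_div ?expf_neq0 // -!tofracXn -!tofracM tofrac_eq.
rewrite -(subnK ltmn) addnS exprS exprD mulrA mulrA => /eqP/(mulIf _).
rewrite expf_neq0 ?psX_neq0 // => /(_ isT)/(congr1 (@ps0 k)).
rewrite !rmorphM rmorphXn /= ps0X mulr0 mul0r => /esym/eqP.
by rewrite (negPf z'0).
Qed.

End Poles.

Section PolyGraph.
Variables (R : idomainType) (E : fieldType) (Gr : set ({fraction R} * E)).
Hypothesis gG : field_graph Gr.

Definition poly_graph (p : {poly R}) (q : {poly E}) : Prop := forall i, Gr (tofrac p`_i, q`_i).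

Lemma fgraph_sum (I : Type) (s : seq I) (F : I -> {fraction R}) (F' : I -> E) :
  (forall i, Gr (F i, F' i)) -> Gr (\sum_(i <- s) F i, \sum_(i <- s) F' i).
Proof.
by move=> h; elim/big_rec2: _ => [|i y x _]; [exact: fgraph0|exact: fgraphD].
Qed.

Lemma poly_graphC a x : Gr (tofrac a, x) -> poly_graph a%:P x%:P.
Proof. by move=> h i; rewrite !coefC; case: eqP => // _; rewrite tofrac0; exact: fgraph0. Qed.

Lemma poly_graphB p p' q q' : poly_graph p q -> poly_graph p' q' -> poly_graph (p - p') (q - q').
Proof. by move=> h h' i; rewrite !coefB tofracB; exact: fgraphB. Qed.

Lemma poly_graphM p p' q q' : poly_graph p q -> poly_graph p' q' -> poly_graph (p * p') (q * q').
Proof.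
move=> h h' i; rewrite !coefM rmorph_sum; apply: fgraph_sum => l.
by rewrite /= tofracM; exact: fgraphM.
Qed.

Lemma poly_graph_prod (I : Type) (s : seq I) (F : I -> {poly R}) (F' : I -> {poly E}) :
  (forall i, poly_graph (F i) (F' i)) -> poly_graph (\prod_(i <- s) F i) (\prod_(i <- s) F' i).
Proof.
move=> h; elim/big_rec2: _ => [|i y x _]; last exact: poly_graphM.
by rewrite -!polyC1; apply: poly_graphC; rewrite tofrac1; have [] := gG.
Qed.

Lemma poly_graph_inj p p' q : poly_graph p q -> poly_graph p' q -> p = p'.
Proof.
move=> h h'; apply/polyP => i; have /eqP := fgraph_inj gG (h i) (h' i).
by rewrite tofrac_eq => /eqP.
Qed.

End PolyGraph.

Lemma horner_pow_shift (k E : fieldType) (sg : {rmorphism k -> E}) (q q' : {poly k}) (C a : k)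
    (p : nat) (z : E) : q - (q.[a])%:P = C *: (q' - (q'.[a])%:P) ^+ p ->
  sg q.[a] - (map_poly sg q).[z] = sg (- C) * ((map_poly sg q').[z] - sg q'.[a]) ^+ p.
Proof.
move=> /(congr1 (fun q => (map_poly sg q).[z])).
rewrite map_polyZ rmorphXn !rmorphB /= !map_polyC hornerZ horner_exp !hornerD !hornerN !hornerC.
by rewrite rmorphN mulNr => <-; rewrite opprB.
Qed.

(** * The Galois action on the tree of preimages *)

Lemma divring_ind (E : fieldType) (F : fieldType) (phi : {rmorphism F -> E})
    (S : set E) (P : E -> Prop) :
  (forall a, P (phi a)) -> (forall x, S x -> P x) ->
  (forall x y, P x -> P y -> P (x - y)) -> (forall x y, P x -> P y -> P (x / y)) ->
  forall x, x \in adjoin_pred phi S -> P x.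
Proof.
move=> PF PS PB Pdiv x /adjoin_predP h.
have Pcl : divring_closed (fun z => `[< P z >]).
  split=> [|u v /asboolP Pu /asboolP Pv|u v /asboolP Pu /asboolP Pv]; apply/asboolP.
  - by rewrite -(rmorph1 phi).
  - exact: PB.
  - exact: Pdiv.
pose D : divringClosed E := HB.pack (fun z => `[< P z >])
  (GRing.isDivringClosed.Build E (fun z => `[< P z >]) Pcl).
apply/asboolP; apply: (h D) => [a|y /PS Py]; exact/asboolP.
Qed.

Lemma fgraph_horner (k E1 E2 : fieldType) (s1 : {rmorphism k -> E1})
    (s2 : {rmorphism k -> E2}) (G : set (E1 * E2)) (p : {poly k}) x y :
  field_graph G -> (forall a, G (s1 a, s2 a)) -> G (x, y) ->
  G ((map_poly s1 p).[x], (map_poly s2 p).[y]).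
Proof.
move=> gG Gk Gxy; elim/poly_ind: p => [|p c IH].
  by rewrite !rmorph0 !horner0; exact: fgraph0.
rewrite !rmorphD !rmorphM /= !map_polyX !map_polyC !hornerE.
exact: (fgraphD gG (fgraphM gG IH Gxy) (Gk c)).
Qed.

Section Arboreal.
Variables (K Kbar Omega : fieldType) (iota : {rmorphism K -> Kbar}).
Variables (j : {rmorphism ratfun Kbar -> Omega}) (f : {poly K}).
Hypothesis hK : separably_closed Kbar.
Hypothesis hO : separable_closure j.

Local Notation fb := (map_poly iota f).
Local Notation T := (backward_orbit iota f j).
Local Notation G := (galois_group (adjoin_base j T)).
Local Notation M := (adjoin_pred j T).

Variable cs : seq Kbar.
Hypothesis fcs : fb^`() %= \prod_(c <- cs) ('X - c%:P).
Hypothesis f1 : (1 < size fb)%N.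

Let hOm : separably_closed Omega := hO.2.

Definition cst : {rmorphism Kbar -> Omega} := j \o ratfun_const Kbar.
Definition tO : Omega := j (ratfun_var Kbar).
Definition fO n : {poly Omega} := map_poly cst (fiter fb n).
Definition level n : set Omega := [set x | (fO n).[x] = tO].
Local Notation d := (size fb).-1.

Let d_gt0 : (0 < d)%N. Proof. by rewrite -subn1 subn_gt0. Qed.

Lemma horner_tofrac (L : fieldType) (phi : {rmorphism ratfun Kbar -> L}) (p : {poly Kbar}) :
  phi (tofrac p) = (map_poly (phi \o ratfun_const Kbar) p).[phi (ratfun_var Kbar)].
Proof.
elim/poly_ind: p => [|p c IH]; first by rewrite !rmorph0 horner0.
by rewrite !rmorphD !rmorphM /= IH map_polyX map_polyC !hornerE.
Qed.

Lemma j_tofrac p : j (tofrac p) = (map_poly cst p).[tO].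
Proof. exact: horner_tofrac. Qed.

Lemma backward_orbitE x : T x <-> exists n, level n x.
Proof.
have E n : iter n (horner (map_poly (j \o ratfun_const Kbar \o iota) f)) x = (fO n).[x].
  rewrite /fO map_fiter horner_fiter -map_poly_comp.
  by congr (iter _ (horner _) _); apply: eq_map_poly.
by split=> -[n h]; exists n; move: h; rewrite /level /= E.
Qed.

Lemma level_orbit n x : level n x -> T x.
Proof. by move=> h; apply/backward_orbitE; exists n. Qed.

Lemma level_mem n x : level n x -> x \in M.
Proof. by move=> /level_orbit h; apply/adjoin_predP => D _; apply. Qed.

Lemma j_mem a : j a \in M. Proof. exact: base_adjoin_pred. Qed.
Lemma cst_mem a : cst a \in M. Proof. exact: j_mem. Qed.

Lemma horner_mem p x : x \in M -> (map_poly cst p).[x] \in M.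
Proof.
move=> xM; elim/poly_ind: p => [|p c IH]; first by rewrite rmorph0 horner0 rpred0.
by rewrite rmorphD rmorphM /= map_polyX map_polyC !hornerE rpredD ?rpredM ?cst_mem.
Qed.

Definition transc (v : Omega) : Prop := forall p, (map_poly cst p).[v] = 0 -> p = 0.

Lemma transc_t : transc tO.
Proof.
by move=> p; rewrite -j_tofrac => /eqP; rewrite fmorph_eq0 tofrac_eq0 => /eqP.
Qed.

Lemma transc_level n u : level n u -> transc u.
Proof.
move=> lu p pu; apply/eqP; apply: contrapT => /negP p0.
have iu : integralOver cst u.
  apply: (@integral_root _ _ cst (map_poly cst p)).
  - by rewrite map_poly_eq0.
  - exact/rootP.
  - by move=> _ /(nthP 0)[i _ <-]; rewrite coef_map; exact: integral_id.
have [q mq] : integralOver cst tO.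
  rewrite -lu; apply: integral_horner => //.
  by move=> _ /(nthP 0)[i _ <-]; rewrite coef_map; exact: integral_id.
by move=> /rootP/transc_t q0; move: mq; rewrite q0 monicE lead_coef0 eq_sym oner_eq0.
Qed.

Lemma transc_neq v a : transc v -> v != cst a.
Proof.
move=> tv; apply/eqP => va; have := tv ('X - a%:P).
rewrite rmorphB /= map_polyX map_polyC !hornerE va subrr => /(_ erefl) /eqP.
by rewrite polyXsubC_eq0.
Qed.

Lemma transc_emb v : transc v -> exists phi : {rmorphism ratfun Kbar -> Omega},
  (forall a, phi (ratfun_const Kbar a) = cst a) /\ phi (ratfun_var Kbar) = v.
Proof.
move=> tv; pose ev : {rmorphism {poly Kbar} -> Omega} := horner_eval v \o map_poly cst.
have [|phi phiE] := @frac_map_ex _ _ ev.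
  move=> p q /eqP; rewrite -subr_eq0 -rmorphB => /eqP /tv /eqP.
  by rewrite subr_eq0 => /eqP.
exists phi; split=> [a|]; rewrite /= phiE /= /horner_eval ?map_polyC ?map_polyX ?hornerE //.
Qed.

Lemma separable_fO n v : transc v -> separable_poly (fO n - v%:P).
Proof. by move=> tv; apply: separable_fiter fcs _ => c m _ _; exact: transc_neq. Qed.

Lemma size_fO n v : size (fO n - v%:P) = (d ^ n).+1.
Proof.
have s : size (fO n) = (d ^ n).+1 by rewrite size_map_poly size_fiter.
rewrite size_polyDl s // size_polyN; apply: leq_ltn_trans (size_polyC_leq1 _) _.
by rewrite ltnS expn_gt0 d_gt0.
Qed.

(** The solutions are distinct because [t] is transcendental and so avoids the critical values.
    Numbering them by ordinals makes finite permutation groups available. *)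
Lemma level_roots n : exists r : 'I_(d ^ n) -> Omega,
  injective r /\ forall x, level n x <-> exists i, x = r i.
Proof.
have [rs urs rsP] := separable_poly_roots hOm (separable_fO n transc_t).
have srs : size rs = (d ^ n)%N.
  by have := eqp_size rsP; rewrite size_fO size_prod_XsubC => -[].
have lrs x : level n x <-> x \in rs.
  rewrite -root_prod_XsubC -(eqp_root rsP) rootE !hornerE subr_eq0.
  by split=> /eqP.
exists (fun i => nth 0 rs i); split=> [i i' /eqP|x].
  by rewrite nth_uniq ?srs // => /eqP /val_inj.
rewrite lrs; split=> [/(nthP 0)[i ltis <-]|[i ->]].
  by rewrite srs in ltis; exists (Ordinal ltis).
by rewrite mem_nth // srs.
Qed.

Lemma fO_D n m x : (fO (n + m)).[x] = (fO n).[(fO m).[x]].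
Proof. by rewrite /fO fiterD map_comp_poly horner_comp. Qed.

Lemma level_up n m x : level (n + m) x -> level n (fO m).[x].
Proof. by rewrite /level /= fO_D. Qed.

Lemma level_child n u : level n u -> exists2 x, level n.+1 x & (fO 1).[x] = u.
Proof.
move=> lu; have tu := transc_level lu.
have [|x] := hOm (separable_fO 1 tu); first by rewrite size_fO ltnS expn_gt0 d_gt0.
rewrite rootE !hornerE subr_eq0 => /eqP xu; exists x => //.
by rewrite /level /= -addn1 fO_D xu.
Qed.

(* galact g is the identity outside M (a junk value). *)
Definition galact (g : G) (x : Omega) : Omega :=
  oapp (fun m : adjoin j T => val (g m)) x (insub x).

Lemma galactE (g : G) (m : adjoin j T) : galact g (val m) = val (g m).
Proof. by rewrite /galact valK. Qed.

Lemma galact_mem g x : x \in M -> galact g x \in M.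
Proof. by move=> xM; rewrite -[x](SubK (adjoin j T) xM) galactE; exact: valP. Qed.

Lemma galactB g x y : x \in M -> y \in M -> galact g (x - y) = galact g x - galact g y.
Proof.
move=> xM yM; rewrite -[x](SubK (adjoin j T) xM) -[y](SubK (adjoin j T) yM).
have [gB _ _ _] := galoisP g.
by rewrite -(rmorphB (\val : adjoin j T -> Omega)) !galactE gB rmorphB.
Qed.

Lemma galactM g x y : x \in M -> y \in M -> galact g (x * y) = galact g x * galact g y.
Proof.
move=> xM yM; rewrite -[x](SubK (adjoin j T) xM) -[y](SubK (adjoin j T) yM).
have [_ [_ gM] _ _] := galoisP g.
by rewrite -(rmorphM (\val : adjoin j T -> Omega)) !galactE gM rmorphM.
Qed.

Lemma galact_j g a : galact g (j a) = j a.
Proof.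
have [_ _ _ gF] := galoisP g.
have -> : j a = val (adjoin_base j T a) by [].
by rewrite galactE gF.
Qed.

Lemma galact_cst g a : galact g (cst a) = cst a. Proof. exact: galact_j. Qed.

Lemma galact0 g : galact g 0 = 0. Proof. by rewrite -(rmorph0 j) galact_j. Qed.
Lemma galact1 g : galact g 1 = 1. Proof. by rewrite -(rmorph1 j) galact_j. Qed.

Lemma galactN g x : x \in M -> galact g (- x) = - galact g x.
Proof. by move=> xM; rewrite -sub0r galactB ?rpred0 // galact0 sub0r. Qed.

Lemma galactD g x y : x \in M -> y \in M -> galact g (x + y) = galact g x + galact g y.
Proof. by move=> xM yM; rewrite -{1}[y]opprK galactB ?rpredN // galactN // opprK. Qed.

Lemma galact_inj g x y : x \in M -> y \in M -> galact g x = galact g y -> x = y.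
Proof.
move=> xM yM; rewrite -[x](SubK (adjoin j T) xM) -[y](SubK (adjoin j T) yM) !galactE.
by have [_ _ /bij_inj gi _] := galoisP g; move=> /val_inj /gi ->.
Qed.

Lemma galact_div g x y : x \in M -> y \in M -> galact g (x / y) = galact g x / galact g y.
Proof.
move=> xM yM; have [->|y0] := eqVneq y 0; first by rewrite invr0 galact0 invr0 !mulr0 galact0.
have gy0 : galact g y != 0.
  by apply: contra_neq y0 => gy0; apply: (@galact_inj g); rewrite ?rpred0 // galact0.
by apply: (mulIf gy0); rewrite -galactM ?rpred_div // !divfK.
Qed.

Lemma galact_one x : galact 1%g x = x.
Proof.
have [xM|xM] := boolP (x \in M); last by rewrite /galact insubN.
by rewrite -[x](SubK (adjoin j T) xM) galactE.
Qed.

Lemma galact_mul (g h : G) x : x \in M -> galact (g * h)%g x = galact g (galact h x).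
Proof. by move=> xM; rewrite -[x](SubK (adjoin j T) xM) !galactE. Qed.

Lemma galactVK (g : G) x : x \in M -> galact (g^-1)%g (galact g x) = x.
Proof. by move=> xM; rewrite -galact_mul // mulVg galact_one. Qed.

Lemma galactK (g : G) x : x \in M -> galact g (galact (g^-1)%g x) = x.
Proof. by move=> xM; rewrite -galact_mul // mulgV galact_one. Qed.


Lemma galact_horner g p x : x \in M ->
  galact g (map_poly cst p).[x] = (map_poly cst p).[galact g x].
Proof.
move=> xM; elim/poly_ind: p => [|p c IH]; first by rewrite rmorph0 !horner0 galact0.
rewrite rmorphD rmorphM /= map_polyX map_polyC !hornerE.
by rewrite galactD ?rpredM ?horner_mem ?cst_mem // galactM ?horner_mem // IH galact_cst.
Qed.

Lemma galact_level g n x : level n x -> level n (galact g x).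
Proof.
move=> lx; rewrite /level /= -galact_horner ?(level_mem lx) // lx; exact: galact_j.
Qed.

Lemma galactX g x n : x \in M -> galact g (x ^+ n) = galact g x ^+ n.
Proof.
by move=> xM; elim: n => [|n IH]; rewrite ?galact1 // !exprS galactM ?rpredX // IH.
Qed.

Lemma galact_prod g (I : Type) (s : seq I) (P : pred I) (F : I -> Omega) :
  (forall i, F i \in M) ->
  galact g (\prod_(i <- s | P i) F i) = \prod_(i <- s | P i) galact g (F i).
Proof.
move=> FM; elim: s => [|i s IH]; first by rewrite !big_nil galact1.
by rewrite !big_cons; case: ifP => // _; rewrite galactM ?IH // rpred_prod.
Qed.

Definition fix_level n (g : G) : Prop := forall x, level n x -> galact g x = x.

Lemma fix_levelS n g : fix_level n.+1 g -> fix_level n g.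
Proof.
move=> gx u /level_child[x lx <-].
by rewrite galact_horner ?(level_mem lx) // gx.
Qed.

Lemma fix_level_le n m g : (n <= m)%N -> fix_level m g -> fix_level n g.
Proof. by move=> /subnK <-; elim: (m - n)%N => [|i IH] // /fix_levelS. Qed.

Lemma fix_level_mem x : x \in M -> exists n, forall g, fix_level n g -> galact g x = x.
Proof.
move=> xM; suff : x \in M /\ exists n, forall g, fix_level n g -> galact g x = x by case.
have mono n m x' : (forall g, fix_level n g -> galact g x' = x') ->
    forall g, fix_level (maxn n m) g -> galact g x' = x'.
  by move=> h g /(fix_level_le (leq_maxl n m)); exact: h.
move: x xM; apply: divring_ind => [a|x Tx|x y [xM [n hn]] [yM [m hm]]|x y [xM [n hn]] [yM [m hm]]].
- by split; [exact: j_mem|exists 0%N => g _; rewrite galact_j].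
- have [n lx] := (backward_orbitE x).1 Tx.
  by split; [exact: level_mem lx|exists n => g; apply].
- split; first exact: rpredB.
  exists (maxn n m) => g hg; rewrite galactB // (mono n m) // (mono m n) // maxnC //.
- split; first exact: rpred_div.
  exists (maxn n m) => g hg; rewrite galact_div // (mono n m) // (mono m n) // maxnC //.
Qed.


(** The graph respects the equation [f^n(x) = t], so it maps each finite level into itself
    injectively, hence onto. This makes its restriction to [M] surjective. *)
Lemma galois_of_graph (Gr : set (Omega * Omega)) : field_graph Gr ->
  (forall a, Gr (j a, j a)) -> (forall x, T x -> exists y, Gr (x, y)) ->
  exists g : G, forall x, x \in M -> Gr (x, galact g x).
Proof.
move=> gG Gj GT.
have lev n x y : level n x -> Gr (x, y) -> level n y.
  move=> lx Gxy; have := fgraph_horner (s1 := cst) (s2 := cst) (fiter fb n) gG (fun a => Gj _) Gxy.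
  by rewrite lx => h; rewrite /level /= (fgraph_fun gG h (Gj _)).
have dom x : x \in M -> exists y, y \in M /\ Gr (x, y).
  move: x; apply: divring_ind => [a|x Tx|x y [x' [x'M Gx]] [y' [y'M Gy]]|x y [x' [x'M Gx]] [y' [y'M Gy]]].
  - by exists (j a); rewrite j_mem.
  - have [y Gxy] := GT x Tx; exists y; split=> //.
    by have [n lx] := (backward_orbitE x).1 Tx; apply: level_mem (lev _ _ _ lx Gxy).
  - by exists (x' - y'); rewrite rpredB //; split=> //; exact: fgraphB.
  - by exists (x' / y'); rewrite rpred_div //; split=> //; exact: fgraph_div.
have cod y : y \in M -> exists x, x \in M /\ Gr (x, y).
  move: y; apply: divring_ind => [a|y Ty|x y [x' [x'M Gx]] [y' [y'M Gy]]|x y [x' [x'M Gx]] [y' [y'M Gy]]].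
  - by exists (j a); rewrite j_mem.
  - have [n ly] := (backward_orbitE y).1 Ty; have [r [rinj rP]] := level_roots n.
    have ex i : exists i', Gr (r i, r i').
      have li : level n (r i) by apply/rP; exists i.
      have [z Gz] := GT _ (level_orbit li); have [i' Ei'] := (rP z).1 (lev _ _ _ li Gz).
      by exists i'; rewrite -Ei'.
    pose sg i := sval (cid (ex i)).
    have sgP i : Gr (r i, r (sg i)) by rewrite /sg; case: cid.
    have sginj : injective sg.
      by move=> i i' E; apply: rinj; apply: (fgraph_inj gG) (sgP i) _; rewrite E.
    have [i Ei] := (rP y).1 ly; have /codomP[i' Ei'] := injF_onto sginj i.
    exists (r i'); split; first by apply: (@level_mem n); apply/rP; exists i'.
    by rewrite Ei Ei'.
  - by exists (x' - y'); rewrite rpredB //; split=> //; exact: fgraphB.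
  - by exists (x' / y'); rewrite rpred_div //; split=> //; exact: fgraph_div.
pose s (m : adjoin j T) : adjoin j T :=
  let h := svalP (cid (dom (val m) (valP m))) in Adjoin h.1.
have sP m : Gr (val m, val (s m)) by rewrite /s; case: cid => y [].
have uniq m m' : Gr (val m, val m') -> m' = s m.
  by move=> h; apply: val_inj; exact: (fgraph_fun gG h (sP m)).
have sA : is_galois_auto (adjoin_base j T) s.
  split.
  - move=> x y; apply/esym/uniq; rewrite !rmorphB /=; exact: fgraphB (sP x) (sP y).
  - split=> [|x y]; apply/esym/uniq; first by rewrite !rmorph1; exact: fgraph1.
    by rewrite !rmorphM /=; exact: fgraphM (sP x) (sP y).
  - have surj m : exists m', s m' = m.
      have [x [xM Gx]] := cod _ (valP m); exists (Adjoin xM).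
      by apply/esym/uniq.
    exists (fun m => sval (cid (surj m))) => m; last by case: cid.
    case: cid => m' /= E; apply: val_inj.
    by apply: (fgraph_inj gG (sP m')); rewrite E; exact: sP.
  - by move=> a; apply/esym/uniq; exact: Gj.
exists (GaloisAuto (introT (asboolP _) sA)) => x xM.
by rewrite -[x](SubK (adjoin j T) xM) galactE; exact: sP.
Qed.

(** * Automorphisms over the field generated by a vertex *)

Section BasePoint.
Variables (n0 : nat) (v : Omega) (phi : {rmorphism ratfun Kbar -> Omega}).
Hypotheses (lv : level n0 v) (phiC : forall a, phi (ratfun_const Kbar a) = cst a).
Hypothesis phiX : phi (ratfun_var Kbar) = v.

Lemma phi_poly p : phi (tofrac p) = (map_poly cst p).[v].
Proof. by rewrite horner_tofrac phiX; congr (_.[_]); apply: eq_map_poly. Qed.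

Lemma j_phi : exists h : {rmorphism ratfun Kbar -> ratfun Kbar}, forall a, j a = phi (h a).
Proof.
pose ev : {rmorphism {poly Kbar} -> ratfun Kbar} := @FracField.tofrac _ \o comp_poly (fiter fb n0).
have [|h hE] := @frac_map_ex _ _ ev.
  move=> p q /= /eqP; rewrite tofrac_eq -subr_eq0 -rmorphB comp_poly_eq0.
    by rewrite subr_eq0 => /eqP.
  by rewrite size_fiter // ltnS expn_gt0 d_gt0.
exists h => a; have [p [q [q0 ->]]] := fractionP a.
by rewrite !fmorph_div !hE /= !phi_poly !j_tofrac !map_comp_poly !horner_comp lv.
Qed.

Lemma level_algebraic n x : level n x -> exists p : {poly ratfun Kbar},
  [/\ p != 0, root (map_poly phi p) x & splits (map_poly phi p)].
Proof.
move=> lx; pose p := map_poly (ratfun_const Kbar) (fiter fb n) - (tofrac (fiter fb n0))%:P.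
have Ep : map_poly phi p = fO n - tO%:P.
  rewrite rmorphB /= map_polyC /= phi_poly lv -map_poly_comp.
  by congr (_ - _); apply: eq_map_poly.
exists p; rewrite Ep; split.
- by rewrite -(map_poly_eq0 phi) Ep -size_poly_eq0 size_fO.
- by rewrite rootE !hornerE lx subrr.
- by apply: separable_poly_splits => //; apply: separable_fO; exact: transc_t.
Qed.

Lemma galois_extend (G0 : set (Omega * Omega)) : field_graph G0 ->
  (forall a, G0 (phi a, phi a)) ->
  exists g : G, galact g v = v /\ forall x y, x \in M -> G0 (x, y) -> galact g x = y.
Proof.
move=> gG0 G0phi.
have [|Gr [gG G0G GT]] := field_graph_extend (S := T) gG0 G0phi.
  by move=> x /backward_orbitE[n]; exact: level_algebraic.
have [h hE] := j_phi.
have Gj a : Gr (j a, j a) by rewrite hE; exact/G0G/G0phi.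
have [g gP] := galois_of_graph gG Gj GT.
have key x y : x \in M -> G0 (x, y) -> galact g x = y.
  by move=> xM /G0G; apply: (fgraph_fun gG); exact: gP.
by exists g; split=> //; apply: key; [exact: level_mem lv|rewrite -phiX; exact: G0phi].
Qed.

(** A second root of the minimal polynomial of [x] over [Kbar(v)] would be the image of [x] under an
    automorphism fixing [v]. This separable polynomial therefore has degree one. *)
Lemma galois_fixed x : x \in M -> (forall g : G, galact g v = v -> galact g x = x) ->
  exists a, x = phi a.
Proof.
move=> xM fx; have [h hE] := j_phi.
have [q sq rq] := hO.1 x; pose p0 := map_poly h q.
have Ep0 : map_poly phi p0 = map_poly j q.
  by rewrite /p0 -map_poly_comp; apply: eq_map_poly => a /=; rewrite hE.
have sp0 : separable_poly p0 by rewrite separable_map.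
have p00 : p0 != 0.
  apply: contraTneq sp0 => ->; rewrite separable_poly.unlock deriv0 coprimep0.
  by rewrite -size_poly_eq1 size_poly0.
have rp0 : root (map_poly phi p0) x by rewrite Ep0.
have [m mP] := min_poly_ex p00 rp0.
have mp0 : m %| p0 by rewrite -mP.
have m0 : m != 0 by apply: contraTneq mp0 => ->; rewrite dvd0p.
have rm : root (map_poly phi m) x by rewrite mP dvdpp.
have sm : separable_poly (map_poly phi m) by rewrite separable_map; exact: dvdp_separable mp0 sp0.
have [rs urs rsP] := separable_poly_roots hOm sm.
have xrs : x \in rs by rewrite -root_prod_XsubC -(eqp_root rsP).
have [/hasP[y yrs yx]|/hasPn allx] := boolP (has (predC1 x) rs).
  have ry : root (map_poly phi m) y by rewrite (eqp_root rsP) root_prod_XsubC.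
  have [G0 [gG0 G0phi G0xy]] := field_graph_conj (min_poly_conj m0 mP ry).
  have [g [gv gP]] := galois_extend gG0 G0phi.
  by move: yx; rewrite /= -(gP _ _ xM G0xy) fx // eqxx.
have rs1 : size rs = 1%N.
  have rsx y : y \in rs -> y = x by move=> /allx /=; rewrite negbK => /eqP.
  case: rs urs xrs rsx {rsP allx} => [|a [|b rs]] //= /andP[+ _] _ rsx.
  by rewrite (rsx a) ?mem_head // (rsx b) ?in_cons ?eqxx ?orbT.
have sm2 : size m = 2.
  by rewrite -(size_map_poly phi) (eqp_size rsP) size_prod_XsubC rs1.
exists (- m`_0 / m`_1).
have m1 : m`_1 != 0 by have := lead_coef_eq0 m; rewrite lead_coefE sm2 /= => ->.
have : phi m`_0 + phi m`_1 * x = 0.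
  have /rootP := rm; rewrite horner_coef size_map_poly sm2 big_ord_recl big_ord1 !coef_map /=.
  by rewrite expr0 mulr1 expr1.
move/eqP; rewrite addrC addr_eq0 => /eqP E.
by rewrite fmorph_div rmorphN -E mulrC mulKf // fmorph_eq0.
Qed.

Section Lift.
Variables (L : fieldType) (io : {rmorphism ratfun Kbar -> L}) (th : {rmorphism L -> L}).
Hypothesis th_io : forall a, th (io a) = io a.
Variable S : set L.
Hypothesis algS : forall s, S s -> exists p : {poly ratfun Kbar},
  [/\ p != 0, root (map_poly io p) s & splits (map_poly phi p)].

(** Conjugating [th] by the partial isomorphism [Gr] gives the relation [G2] on [Omega], again a
    partial isomorphism over [Kbar(v)], which [galois_extend] completes. This is how local
    automorphisms become Galois elements. *)
Lemma galois_lift : exists (Gr : set (L * Omega)) (g : G),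
  [/\ field_graph Gr, forall a, Gr (io a, phi a), (forall s, S s -> exists x, Gr (s, x)),
      galact g v = v
    & forall s x x', x \in M -> Gr (s, x) -> Gr (th s, x') -> galact g x = x'].
Proof.
(* Taking [0] as a conjugate of [0] yields just the isomorphism between the two images of the
   rational function field. *)
have [|G1 [gG1 G1F _]] := @field_graph_conj _ _ _ io phi 0 0.
  by move=> p; rewrite /root !horner_coef0 !coef_map /= !fmorph_eq0.
have [Gr [gG G1G GS]] := field_graph_extend gG1 G1F algS.
have GF a : Gr (io a, phi a) by apply: G1G; exact: G1F.
pose G2 : set (Omega * Omega) := fun z => exists s, Gr (s, z.1) /\ Gr (th s, z.2).
have gG2 : field_graph G2.
  split.
  - by exists 1; rewrite rmorph1; split; exact: fgraph1.
  - move=> x y x' y' [s [h1 h2]] [s' [h1' h2']]; exists (s - s').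
    by rewrite rmorphB; split; exact: fgraphB.
  - move=> x y x' y' [s [h1 h2]] [s' [h1' h2']]; exists (s / s').
    by rewrite fmorph_div; split; exact: fgraph_div.
  - move=> y [s [/= h1 h2]]; have s0 : s = 0 by exact: (fgraph_inj gG h1 (fgraph0 gG)).
    by move: h2; rewrite s0 rmorph0 => h2; exact: (fgraph_fun gG h2 (fgraph0 gG)).
have [|g [gv gP]] := galois_extend gG2.
  by move=> a; exists (io a); rewrite th_io; split; exact: GF.
exists Gr, g; split=> // s x x' xM h1 h2; apply: gP => //; by exists s.
Qed.

End Lift.
End BasePoint.


(** * The action on one level and the Frattini subgroup *)

Lemma group_closed_setP (Gt : groupType) (H : set Gt) :
  group_closed (mem H) <-> H 1%g /\ forall x y, H x -> H y -> H (x * y^-1)%g.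
Proof.
split=> [[h1 h2]|[h1 h2]].
  split=> [|x y Hx Hy]; first by move: h1; rewrite inE.
  by have := h2 x y; rewrite !inE; apply.
by split=> [|x y]; rewrite !inE //; exact: h2.
Qed.

Section LevelGroup.
Variables (n : nat) (r : 'I_(d ^ n) -> Omega).
Hypotheses (r_inj : injective r) (rP : forall x, level n x <-> exists i, x = r i).

Definition induces (g : G) (s : {perm 'I_(d ^ n)}) : Prop := forall i, galact g (r i) = r (s i).

Lemma level_r i : level n (r i). Proof. by apply/rP; exists i. Qed.
Lemma r_mem i : r i \in M. Proof. exact: level_mem (level_r i). Qed.

Lemma induces_ex g : exists s, induces g s.
Proof.
have ex i : exists i', galact g (r i) = r i' by apply/rP/galact_level/level_r.
pose sg i := sval (cid (ex i)).
have sgP i : galact g (r i) = r (sg i) by rewrite /sg; case: cid.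
have sginj : injective sg.
  by move=> i i' E; apply/r_inj/(@galact_inj g); rewrite ?r_mem // !sgP E.
by exists (perm sginj) => i; rewrite permE.
Qed.

Lemma induces_uniq g s s' : induces g s -> induces g s' -> s = s'.
Proof. by move=> h h'; apply/permP => i; apply: r_inj; rewrite -h -h'. Qed.

(** A product of Galois elements applies the right factor first, a product of permutations the left
    one, hence the reversal. *)
Lemma induces_mul g g' s s' : induces g s -> induces g' s' -> induces (g' * g)%g (s * s')%g.
Proof. by move=> h h' i; rewrite galact_mul ?r_mem // h h' permM. Qed.

Lemma induces_one : induces 1%g 1%g.
Proof. by move=> i; rewrite galact_one perm1. Qed.

Lemma induces_inv g s : induces g s -> induces (g^-1)%g (s^-1)%g.
Proof. by move=> h i; rewrite -{1}[i](permKV s) -h galactVK ?r_mem. Qed.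

Lemma induces_exp g s m : induces g s -> induces (g ^+ m)%g (s ^+ m)%g.
Proof.
move=> h; elim: m => [|m IH]; first by rewrite expg0; exact: induces_one.
by rewrite expgSr expgS; exact: induces_mul.
Qed.

Definition induced_set (H : set G) : {set {perm 'I_(d ^ n)}} :=
  [set s | `[< exists2 g, H g & induces g s >]].

Lemma induced_setP (H : set G) s :
  reflect (exists2 g, H g & induces g s) (s \in induced_set H).
Proof. by rewrite inE; exact: asboolP. Qed.

Lemma induced_group_set (H : set G) : group_closed (mem H) -> group_set (induced_set H).
Proof.
move=> /group_closed_setP[H1 Hdiv]; apply/group_setP; split=> [|s s'].
  by apply/induced_setP; exists 1%g => //; exact: induces_one.
move=> /induced_setP[g Hg gs] /induced_setP[g' Hg' gs'].
apply/induced_setP; exists (g' * g)%g; last exact: induces_mul.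
have Hg1 : H (g^-1)%g by rewrite -[(g^-1)%g]mul1g; exact: Hdiv.
by rewrite -[g]invgK; exact: Hdiv.
Qed.

Lemma setT_group_closed : group_closed (mem ([set: G]%classic)).
Proof. exact/group_closed_setP. Qed.

Definition level_group : {group {perm 'I_(d ^ n)}} := Group (induced_group_set setT_group_closed).

Lemma induces_level_group g s : induces g s -> s \in level_group.
Proof. by move=> h; apply/induced_setP; exists g. Qed.

(** The preimage [H'] of a maximal subgroup [H] of the finite group is a maximal open subgroup: any
    subgroup above [H'] contains the kernel of the action on level [n], so it is the preimage of its
    image [H3]. *)
Lemma frattini_induced (g : G) s : frattini (arboreal_group iota f j) g -> induces g s ->
  s \in ('Phi(level_group))%g.
Proof.
move=> Fg gs; apply/bigcapP => H /orP[/eqP ->|maxH]; first exact: induces_level_group gs.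
have /andP[sHG _] := maxgroupp maxH.
pose H' : set G := fun h => exists2 s', s' \in H & induces h s'.
have clH' : group_closed (mem H').
  apply/group_closed_setP; split=> [|x y [sx Hx xs] [sy Hy ys]].
    by exists 1%g; [exact: group1|exact: induces_one].
  exists (sy^-1 * sx)%g; first by rewrite groupM ?groupV.
  by apply: induces_mul => //; exact: induces_inv.
suff [s' Hs' gs'] : H' g by rewrite (induces_uniq gs gs').
apply: Fg; split.
- split=> //; apply/open_krullE => h [s' Hs' hs'].
  exists [seq Adjoin (r_mem i) | i <- enum 'I_(d ^ n)] => h' hh'.
  exists s' => // i; rewrite -hs'.
  have := hh' (Adjoin (r_mem i)); rewrite map_f ?mem_enum // => /(_ isT) E.
  by rewrite -[r i]/(val (Adjoin (r_mem i))) !galactE E.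
- move=> HT; have /properP[_ [s' Gs' nHs']] := maxgroupp maxH.
  have /induced_setP[h _ hs'] := Gs'.
  have [s'' Hs'' hs''] : H' h by rewrite HT.
  by move: nHs'; rewrite (induces_uniq hs' hs'') Hs''.
- move=> H2 [clH2 _] HH2; have /group_closed_setP[H21 H2div] := clH2.
  pose H3 : {group {perm 'I_(d ^ n)}} := Group (induced_group_set clH2).
  have sH3 : H3 \subset level_group.
    by apply/fintype.subsetP => s' /induced_setP[h _ hs']; exact: induces_level_group hs'.
  have sHH3 : H \subset H3.
    apply/fintype.subsetP => s' Hs'; have /induced_setP[h _ hs'] := fintype.subsetP sHG _ Hs'.
    by apply/induced_setP; exists h => //; apply: HH2; exists s'.
  have [E|pr] := eqVneq (H3 : {set _}) (level_group : {set _}); [right|left].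
    apply/seteqP; split=> // h _; have [s' hs'] := induces_ex h.
    have := induces_level_group hs'; rewrite -E => /induced_setP[h' H2h' h's'].
    have : H2 (h'^-1 * h)%g.
      apply: HH2; exists 1%g; first exact: group1.
      by rewrite -[1%g](mulgV s'); apply: induces_mul => //; exact: induces_inv.
    move=> /(H2div 1%g) -/(_ H21) H2i; have := H2div _ _ H2h' H2i.
    by rewrite mul1g invgK mulKVg.
  apply/seteqP; split=> // h H2h; have [s' hs'] := induces_ex h; exists s' => //.
  have <- : H3 :=: H.
    have [_ maxP] := maxgroupP maxH; apply: maxP => //.
    by rewrite finset.properEneq pr.
  by apply/induced_setP; exists h.
Qed.

End LevelGroup.

(** A Krull neighbourhood of the identity is controlled by finitely many elements of [M], and each
    of these is fixed by the stabilizer of some level. *)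
Lemma open_level (H : set (arboreal_group iota f j)) : open H -> H 1%g ->
  exists k, forall g : G, fix_level k g -> H g.
Proof.
move=> /open_krullE/(_ 1%g) hH /hH[A hA].
have [k hk] : exists k, forall g : G, fix_level k g -> {in A, forall m, g m = m}.
  elim: A {hA} => [|m A [k hk]]; first by exists 0%N.
  have [l hl] := fix_level_mem (valP m); exists (maxn k l) => g hg m'.
  rewrite in_cons => /orP[/eqP ->|m'A].
    apply: val_inj; rewrite -galactE; apply: hl; exact: fix_level_le (leq_maxr k l) hg.
  by apply: hk => //; exact: fix_level_le (leq_maxl k l) hg.
by exists k => g /hk hg; apply: hA => m mA; rewrite (hg m mA).
Qed.

Lemma frattini_level : open (frattini (arboreal_group iota f j)) ->
  exists k, forall g : G, fix_level k g -> frattini (arboreal_group iota f j) g.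
Proof. by move=> /open_level; apply=> H [[/group_closed_setP[]]]. Qed.

Lemma fix_level_closed k : group_closed (mem (fix_level k : set G)).
Proof.
apply/group_closed_setP; split=> [x _|g h hg hh x lx]; first exact: galact_one.
have lM := level_mem lx.
by rewrite galact_mul // -{1}(hh x lx) galactVK // hg.
Qed.

Section LevelKernel.
Variables (n k : nat) (r : 'I_(d ^ n) -> Omega).
Hypotheses (r_inj : injective r) (rP : forall x, level n x <-> exists i, x = r i).
Hypothesis Phik : forall g : G, fix_level k g -> frattini (arboreal_group iota f j) g.

Definition level_kernel : {group {perm 'I_(d ^ n)}} :=
  Group (induced_group_set rP (fix_level_closed k)).

Lemma level_kernel_normal : (level_kernel <| level_group rP)%g.
Proof.
apply/andP; split.
  by apply/fintype.subsetP => s /induced_setP[g _ gs]; exact: induces_level_group gs.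
apply/fintype.subsetP => s /induced_setP[g _ gs]; rewrite inE; apply/fintype.subsetP => _ /imsetP[s' + ->].
move=> /induced_setP[h hk hs']; apply/induced_setP; exists ((g * h) * g^-1)%g.
  move=> x lx; have lgx := galact_level (g^-1)%g lx; have gM := level_mem lgx.
  by rewrite !galact_mul ?galact_mem ?(level_mem lx) // hk // galactK ?(level_mem lx).
by rewrite /conjg; apply: (induces_mul rP); [exact: induces_inv|exact: induces_mul].
Qed.

Lemma level_kernel_nilpotent : nilpotent level_kernel.
Proof.
apply: nilpotentS (Phi_nilpotent (level_group rP)).
by apply/fintype.subsetP => s /induced_setP[g /Phik gF gs]; exact: frattini_induced gF gs.
Qed.

End LevelKernel.

(** * Inertia elements from Laurent series *)

Local Notation ps := (powser Kbar).
Local Notation L := {fraction (powser Kbar)}.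
Local Notation psL := (psL Kbar).
Local Notation mapC := (map_poly (@psC Kbar)).
Local Notation map0 := (map_poly (@ps0 Kbar)).
Local Notation orb := (orbit 'P%act).
Hypothesis d0 : d%:R != 0 :> Kbar.

Lemma level0_t : level 0 tO.
Proof. by rewrite /level /= /fO map_polyX hornerX. Qed.

Lemma preimage_algebraic (v : Omega) (phi : {rmorphism ratfun Kbar -> Omega})
    (io : {rmorphism ratfun Kbar -> L}) (m : nat) (s : L) : transc v ->
  (forall a, phi (ratfun_const Kbar a) = cst a) -> phi (ratfun_var Kbar) = v ->
  (forall a, io (ratfun_const Kbar a) = psL a) ->
  (map_poly psL (fiter fb m)).[s] = io (ratfun_var Kbar) ->
  exists p : {poly ratfun Kbar},
  [/\ p != 0, root (map_poly io p) s & splits (map_poly phi p)].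
Proof.
move=> tv phiC phiX ioC ms.
pose p := map_poly (ratfun_const Kbar) (fiter fb m) - (ratfun_var Kbar)%:P.
have Ep : map_poly phi p = fO m - v%:P.
  rewrite rmorphB /= map_polyC /= phiX -map_poly_comp.
  by congr (_ - _); apply: eq_map_poly.
exists p; rewrite Ep; split.
- by rewrite -(map_poly_eq0 phi) Ep -size_poly_eq0 size_fO.
- rewrite rmorphB /= map_polyC /= -map_poly_comp rootE !hornerE.
  by rewrite (eq_map_poly (g := psL)) ?ms ?subrr.
- by apply: (separable_poly_splits hO.2); exact: separable_fO.
Qed.

(* With t = w^(-d^n), the solutions of f^n(x) = t are Laurent series in w with  *)
(* a simple pole, permuted cyclically by w |-> zeta w.                          *)
Lemma inertia_infinity n : exists (Gr : set (L * Omega)) (g : G) (x0 : Omega),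
  [/\ field_graph Gr, forall a, Gr (psL a, cst a),
      level n x0,
      forall x, level n x -> exists m, x = galact (g ^+ m)%g x0
    & forall x, level n x -> exists2 z : ps, ps0 z != 0 & Gr (tofrac z / tofrac psX, x)].
Proof.
pose N := (d ^ n)%N; have N0 : N%:R != 0 :> Kbar by rewrite natrX expf_neq0.
have Npos : (0 < N)%N by rewrite lt0n; apply: contraNneq N0 => ->.
have [w w_prim] := prim_root_ex hK N0.
have w0 := prim_root_neq0 w_prim.
have sfn : size (fiter fb n) = N.+1 by rewrite size_fiter.
pose a i := (fiter fb n)`_i.
have aN : a N != 0 by rewrite /a -[N]/(N.+1.-1) -sfn -lead_coefE lead_coef_eq0 -size_poly_gt0 sfn.
have [y0 y0N] := nth_root_ex hK (a N)^-1 N0.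
have y00 : y0 != 0.
  apply/eqP => E; move: y0N; rewrite E expr0n gtn_eqF // => /esym/eqP.
  by rewrite invr_eq0 (negPf aN).
(* [P(Y) = 0] is the equation [f^n(Y / X) = X^(-N)] multiplied by [X^N]; modulo [X] only
   [a N * Y^N = 1] remains, which is the equation of [y0]. *)
pose P : {poly ps} := \sum_(i < N.+1) (psC (a i) * psX ^+ (N - i)) *: 'X^i - 1.
have P0 : map0 P = a N *: 'X^N - 1.
  rewrite /P rmorphB rmorph1 rmorph_sum /= big_ord_recr /= subnn expr0 mulr1.
  rewrite map_polyZ /= psCK map_polyXn big1 ?add0r // => i _.
  have : (0 < N - i)%N by rewrite subn_gt0 ltn_ord.
  case: (N - i)%N => // m _; rewrite map_polyZ /= mulrC.
  by rewrite ps0_mulXn scale0r.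
have [||Y0 rY0 Y0y0] := @hensel _ P y0.
- by rewrite P0 rootE !hornerE y0N divff ?subrr.
- rewrite P0 derivB derivZ derivXn -polyC1 derivC subr0 !hornerE hornerMn hornerXn.
  by rewrite -mulr_natr !mulf_neq0 // expf_neq0.
have tX0 : tofrac (psX : ps) != 0 by rewrite tofrac_eq0 psX_neq0.
pose l : L := (tofrac (psX ^+ N))^-1.
have [|io [ioC ioX]] := @laurent_embedding _ l.
  by move=> p; apply: psL_transcV; exact: psXn_nconst.
have [th thE] := laurent_scale w0.
have th_io : forall b, th (io b) = io b.
  apply: (laurent_fixed ioC thE); rewrite ioX /l fmorphV thE rmorphXn /= ps_scaleX.
  by rewrite exprMn -rmorphXn /= (prim_expr_order w_prim) rmorph1 mul1r.
pose s0 : L := tofrac Y0 / tofrac psX.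
have s0n : (map_poly psL (fiter fb n)).[s0] = io (ratfun_var Kbar).
  rewrite ioX /l horner_coef size_map_poly sfn; apply: (mulIf (x := tofrac (psX ^+ N))).
    by rewrite tofracXn expf_neq0.
  rewrite mulVf ?tofracXn ?expf_neq0 // mulr_suml.
  have /rootP := rY0; rewrite /P !hornerE horner_sum => /eqP; rewrite subr_eq0 => /eqP/(congr1 (@tofrac _)).
  rewrite rmorph1 rmorph_sum /= => <-; apply: eq_bigr => i _.
  rewrite hornerZ hornerXn !tofracM !tofracXn coef_map /= /s0 exprMn exprVn.
  have -> : tofrac (psX : ps) ^+ N = tofrac psX ^+ (N - i) * tofrac psX ^+ i.
    by rewrite -exprD subnK // -ltnS.
  have ti0 : tofrac (psX : ps) ^+ i != 0 by rewrite expf_neq0.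
  rewrite -!mulrA; congr (_ * _); rewrite [(tofrac psX ^+ i)^-1 * _]mulrCA mulVf // mulr1.
  exact: mulrC.
have th_psL b : th (psL b) = psL b by rewrite /= thE ps_scaleC.
have th_horner p s : th (map_poly psL p).[s] = (map_poly psL p).[th s].
  rewrite -horner_map -map_poly_comp; congr (_.[_]).
  by apply: eq_map_poly => b; rewrite /= -[RHS]th_psL.
pose sq m := iter m th s0.
have sqn m : (map_poly psL (fiter fb n)).[sq m] = io (ratfun_var Kbar).
  by elim: m => // m IH; rewrite /sq iterS -th_horner IH th_io.
(* [sq m] is [s0] with [w^m X] in place of [X], and [z m] is its numerator over [psX]. The leading
   coefficients [w^(-m) y0] are distinct for [m < N], so these series account for all [N] vertices
   of the level. *)
pose z m := psC (w^-1 ^+ m) * ps_scale (w ^+ m) Y0.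
have sqE m : sq m = tofrac (z m) / tofrac psX.
  elim: m => [|m IH]; first by rewrite /z !expr0 rmorph1 mul1r ps_scale1.
  rewrite /sq iterS -/(sq m) IH fmorph_div !thE ps_scaleX.
  apply/eqP; rewrite eqr_div ?tX0 //; last by rewrite tofrac_eq0 mulf_neq0 ?psX_neq0 // fmorph_eq0.
  rewrite -!tofracM tofrac_eq /z rmorphM /= ps_scaleC ps_scale_comp -exprS.
  have -> : psC (w^-1 ^+ m) = psC (w^-1 ^+ m.+1) * psC w :> ps.
    by rewrite -rmorphM /= exprSr divfK.
  by apply/eqP; rewrite -!mulrA; congr (_ * _); rewrite mulrCA.
have z0 m : ps0 (z m) = w^-1 ^+ m * y0.
  by rewrite /z rmorphM /= psCK ps0_scale Y0y0.
pose S : set L := fun s => exists m, s = sq m.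
have [|Gr [g [gG GF GS gv gP]]] := galois_lift level0_t
    (fun a => erefl) erefl th_io (S := S).
  by move=> _ [m ->]; apply: preimage_algebraic ioC (sqn m) => //; exact: transc_t.
have Gk b : Gr (psL b, cst b) by rewrite -ioC; exact: GF.
have [x0 Gx0] := GS s0 (ex_intro _ 0%N erefl).
have lev s x : (map_poly psL (fiter fb n)).[s] = io (ratfun_var Kbar) -> Gr (s, x) -> level n x.
  move=> sn Gsx; have := fgraph_horner (fiter fb n) gG Gk Gsx; rewrite sn => h.
  exact: (fgraph_fun gG h (GF _)).
have lx0 : level n x0 := lev _ _ s0n Gx0.
have Gm m : Gr (sq m, galact (g ^+ m)%g x0).
  elim: m => [|m IH]; first by rewrite expg0 galact_one.
  have [x' Gx'] := GS (sq m.+1) (ex_intro _ m.+1 erefl).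
  rewrite expgS galact_mul ?(level_mem lx0) //.
  rewrite (gP (sq m) _ x') //; exact: level_mem (lev _ _ (sqn m) IH).
have surj x : level n x -> exists m, x = galact (g ^+ m)%g x0.
  move=> lx; have [r [r_inj rP]] := level_roots n.
  have ex (m : 'I_N) : exists i, galact (g ^+ m)%g x0 = r i.
    by apply/rP; exact: lev (sqn m) (Gm m).
  pose sg m := sval (cid (ex m)).
  have sgP (m : 'I_N) : galact (g ^+ m)%g x0 = r (sg m) by rewrite /sg; case: cid.
  have sg_inj : injective sg.
    move=> m m' E; have : sq m = sq m'.
      by apply: (fgraph_inj gG (Gm m)); rewrite sgP E -sgP.
    rewrite !sqE => /(mulIf _); rewrite invr_eq0 => /(_ tX0)/eqP.
    rewrite tofrac_eq => /eqP/(congr1 (@ps0 Kbar)); rewrite !z0 => /(mulIf y00).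
    rewrite !exprVn => /invr_inj /eqP; rewrite (eq_prim_root_expr w_prim) !modn_small //.
    by move=> /eqP/val_inj.
  have [i Ei] := (rP x).1 lx; have /codomP[m Em] := injF_onto sg_inj i.
  by exists m; rewrite Ei Em sgP.
exists Gr, g, x0; split=> // x /surj[m ->].
exists (z m); last by rewrite -sqE.
by rewrite z0 mulf_neq0 // expf_neq0 // invr_eq0.
Qed.

Lemma level_lift k m u : level k u -> exists2 x, level (k + m) x & (fO m).[x] = u.
Proof.
move=> lu; elim: m => [|m [x lx xu]].
  by exists u; rewrite ?addn0 // /fO map_polyX hornerX.
have [y ly yx] := level_child lx; exists y; first by rewrite addnS.
by rewrite -addn1 fO_D yx.
Qed.

Lemma cyclic_on_level (g : G) (n : nat) (x0 : Omega) : level n x0 ->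
  (forall x, level n x -> exists m, x = galact (g ^+ m)%g x0) ->
  fix_level n (g ^+ (d ^ n))%g /\
  forall x m, level n x -> galact (g ^+ m)%g x = x -> (d ^ n %| m)%N.
Proof.
move=> lx0 tr; have [r [r_inj rP]] := level_roots n.
have [s gs] := induces_ex r_inj rP g.
have [i0 Ei0] := (rP x0).1 lx0.
have gsm m i : galact (g ^+ m)%g (r i) = r ((s ^+ m)%g i) by exact: induces_exp.
have [|os sfix] := @transitive_cycle_order _ s i0.
  move=> i; have [|m Em] := tr (r i); first by apply/rP; exists i.
  by exists m; apply: r_inj; rewrite Em Ei0 gsm.
rewrite card_ord in os sfix; split=> [x /rP[i ->]|x m /rP[i ->]].
  have s1 : (s ^+ (d ^ n) = 1)%g by apply/eqP; rewrite -order_dvdn os.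
  by rewrite gsm s1 perm1.
by rewrite gsm => /r_inj; exact: sfix.
Qed.

Lemma cyclic_below (g : G) (k m : nat) (x0 : Omega) : level (k + m) x0 ->
  (forall x, level (k + m) x -> exists a, x = galact (g ^+ a)%g x0) ->
  [/\ fix_level k (g ^+ (d ^ k))%g,
      forall u a, level k u -> galact (g ^+ a)%g u = u -> (d ^ k %| a)%N
    & forall x y, level (k + m) x -> level (k + m) y -> (fO m).[x] = (fO m).[y] ->
      exists a, y = galact ((g ^+ (d ^ k)) ^+ a)%g x].
Proof.
move=> lx0 tr; have [fN _] := cyclic_on_level lx0 tr.
have [|fk fixk] := @cyclic_on_level g k (fO m).[x0] (level_up lx0).
  move=> u lu; have [x lx <-] := level_lift m lu; have [a ->] := tr x lx.
  by exists a; rewrite galact_horner // (level_mem lx0).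
split=> // x y lx ly xy.
have [a Ea] := tr x lx; have [b Eb] := tr y ly; set N := (d ^ (k + m))%N in fN.
have Npos : (0 < N)%N by rewrite expn_gt0 d_gt0.
(* [N.-1] stands for [-1], since [g ^+ N] acts trivially on the level. *)
pose c := (b + N.-1 * a)%N.
have Ec : galact (g ^+ c)%g x = y.
  rewrite Ea -galact_mul ?(level_mem lx0) // -expgD /c -addnA -mulSnr prednK //.
  rewrite expgD expgM galact_mul ?(level_mem lx0) // Eb; congr (galact _ _).
  elim: a {Ea c} => [|a IH]; first by rewrite expg0 galact_one.
  by rewrite expgS galact_mul ?(level_mem lx0) // IH fN.
have /dvdnP[e Ee] : (d ^ k %| c)%N.
  apply: (fixk (fO m).[x]); first exact: level_up.
  by rewrite galact_horner ?(level_mem lx) // Ec; exact: esym xy.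
by exists e; rewrite -expgM mulnC -Ee.
Qed.

(** The vertex [v] is identified with a series [U] invariant under scaling by [w]. Power series
    solutions of [f^n = U] become descendants of [v], on which [g] acts by scaling. The clause on
    [p]-th roots of [U - b] serves the Kummer argument. *)
Lemma local_lift (n0 : nat) (v : Omega) (U : ps) (w : Kbar) :
  level n0 v -> U != psC (ps0 U) -> w != 0 -> ps_scale w U = U ->
  exists (Gr : set (L * Omega)) (g : G),
  [/\ field_graph Gr /\ (forall a, Gr (psL a, cst a)), galact g v = v,
      forall n (a : ps), (mapC (fiter fb n)).[a] = U ->
        exists x, [/\ level (n0 + n) x, (fO n).[x] = v & Gr (tofrac a, x)],
      forall (p : nat) b (a : ps), p%:R != 0 :> Kbar -> a ^+ p = U - psC b ->
        exists x, Gr (tofrac a, x)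
    & forall (a : ps) x x', x \in M -> Gr (tofrac a, x) ->
        Gr (tofrac (ps_scale w a), x') -> galact g x = x'].
Proof.
move=> lv ncU w0 wU; have tv := transc_level lv.
have [phi [phiC phiX]] := transc_emb tv.
have [io [ioC ioX]] := laurent_embedding (fun p => @psL_transc _ U p ncU).
have [th thE] := laurent_scale w0.
have th_io : forall b, th (io b) = io b.
  by apply: (laurent_fixed ioC thE); rewrite ioX thE wU.
have [|Gr [g [gG GF GS gv gP]]] := galois_lift lv phiC phiX th_io
    (S := [set s | exists p : {poly ratfun Kbar},
      [/\ p != 0, root (map_poly io p) s & splits (map_poly phi p)]]%classic).
  by [].
have Gk b : Gr (psL b, cst b) by rewrite -ioC -phiC; exact: GF.
have GU : Gr (tofrac U, v) by rewrite -ioX -phiX; exact: GF.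
exists Gr, g; split=> // [n a aU|p b a p0 aU|a x x' xM Gax]; last first.
- by rewrite -thE; exact: gP.
- apply: GS; exists ('X^p - (ratfun_var Kbar - ratfun_const Kbar b)%:P).
  have vb : v - cst b != 0 by rewrite subr_eq0; exact: transc_neq.
  have E (E' : fieldType) (s : {rmorphism ratfun Kbar -> E'}) : map_poly s
      ('X^p - (ratfun_var Kbar - ratfun_const Kbar b)%:P) =
      'X^p - (s (ratfun_var Kbar) - s (ratfun_const Kbar b))%:P.
    by rewrite rmorphB /= map_polyXn map_polyC /= rmorphB.
  have sep : separable_poly (map_poly phi ('X^p - (ratfun_var Kbar - ratfun_const Kbar b)%:P)).
    rewrite E phiX phiC; apply: separable_Xn_subC vb.
    by rewrite -(rmorph_nat cst) fmorph_eq0.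
  split; last exact: separable_poly_splits hO.2 _ sep.
    by have /separable_poly_neq0 := sep; rewrite map_poly_eq0.
  rewrite E ioX ioC rootE !hornerE -tofracXn aU tofracB subrr.
  by [].
- have [|x Gx] := GS (tofrac a).
    apply: (preimage_algebraic tv phiC phiX ioC (m := n)).
    by rewrite psL_map aU ioX.
  have xv : (fO n).[x] = v.
    have := fgraph_horner (fiter fb n) gG Gk Gx; rewrite psL_map aU => h.
    exact: (fgraph_fun gG h GU).
  by exists x; split=> //; rewrite /level /= fO_D xv.
Qed.

(** * Unicritical polynomials *)

Section Unicritical.

Variables a b c : Kbar.
Hypothesis a0 : a != 0.
Hypothesis fE : fb = a *: ('X - c%:P) ^+ d + b%:P.

Lemma shape_horner (E : comNzRingType) (s : {rmorphism Kbar -> E}) x :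
  (map_poly s fb).[x] = s a * (x - s c) ^+ d + s b.
Proof.
rewrite [in LHS]fE rmorphD /= map_polyZ rmorphXn rmorphB /= map_polyX !map_polyC.
by rewrite !hornerE.
Qed.

Lemma shape_unity (E : fieldType) (s : {rmorphism Kbar -> E}) (w : Kbar) x y :
  d.-primitive_root w -> y != s c -> (map_poly s fb).[x] = (map_poly s fb).[y] ->
  exists i, x - s c = s (w ^+ i) * (y - s c).
Proof.
move=> w_prim yc; rewrite !shape_horner => /addIr/mulfI; rewrite fmorph_eq0 => /(_ a0) xy.
have yc0 : y - s c != 0 by rewrite subr_eq0.
have sw : d.-primitive_root (s w) by rewrite fmorph_primitive_root.
have [|i Ei] := prim_rootP sw (x := (x - s c) / (y - s c)).
  by rewrite expr_div_n xy divff // expf_neq0.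
by exists i; rewrite rmorphXn -Ei divfK.
Qed.

Lemma fO1 : fO 1 = map_poly cst fb.
Proof. by rewrite /fO fiter1. Qed.

(** By induction [h = g ^+ (d ^ n)] fixes the parent of [x], so it multiplies [x - c] by a [d]-th
    root of unity. That root is a constant, hence fixed by [h], and so [h ^+ d] multiplies by its
    [d]-th power. *)
Lemma unicritical_exponent n (g : G) : fix_level n (g ^+ (d ^ n))%g.
Proof.
elim: n => [x|n IH x lx].
  by rewrite /level /= /fO map_polyX hornerX expg1 => ->; rewrite galact_j.
rewrite expnSr expgM; set h := (g ^+ (d ^ n))%g in IH *.
have [w w_prim] := prim_root_ex hK d0.
have xM := level_mem lx; have xc : x != cst c := transc_neq c (transc_level lx).
have hx : (map_poly cst fb).[galact h x] = (map_poly cst fb).[x].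
  rewrite -galact_horner //; apply: IH; rewrite -fO1; apply: level_up.
  by rewrite addn1.
have [i Ei] := shape_unity w_prim xc hx.
have hm m : galact (h ^+ m)%g x = cst c + cst (w ^+ (i * m)) * (x - cst c).
  elim: m => [|m IHm]; first by rewrite muln0 expr0 rmorph1 mul1r expg0 galact_one addrC subrK.
  have xcM : x - cst c \in M by rewrite rpredB ?cst_mem.
  rewrite expgS galact_mul // IHm galactD ?rpredM ?cst_mem // galactM ?cst_mem //.
  rewrite galactB ?cst_mem // !galact_cst Ei mulrA -rmorphM -exprD.
  by rewrite mulnS addnC.
by rewrite hm mulnC exprM (prim_expr_order w_prim) expr1n rmorph1 mul1r addrC subrK.
Qed.

(** [N] contains the kernel of the action on some level [n], so its index is that of its image [H]
    in the level group. Every element of this group has order dividing [d ^ n], and Cauchy's theorem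
    leaves [p] as the only possible prime divisor of the group order. *)
Lemma unicritical_pro_p (p s : nat) : prime p -> d = (p ^ s)%N ->
  pro_p (arboreal_group iota f j) p.
Proof.
move=> pr_p dps N [clN oN] nN.
have /group_closed_setP[N1 Ndiv] := clN.
have [n Nn] := open_level oN N1.
have [r [r_inj rP]] := level_roots n.
pose H : {group {perm 'I_(d ^ n)}} := Group (induced_group_set rP clN).
pose Gn := level_group rP.
have [e He] : exists e, #|Gn : H|%g = (p ^ e)%N.
  suff /p_natP[e ->] : p.-nat #|Gn : H|%g by exists e.
  apply: pnat_dvd (dvdn_indexg _ _) _; apply/pgroupP => q pr_q /(Cauchy pr_q)[x xG ox].
  have /induced_setP[g _ gx] := xG.
  have : (x ^+ (d ^ n) = 1)%g.
    apply/permP => i; rewrite perm1; apply: r_inj.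
    by rewrite -(induces_exp rP (d ^ n) gx); apply: unicritical_exponent; apply/rP; exists i.
  move=> /eqP; rewrite -order_dvdn ox dps -expnM Euclid_dvdX // => /andP[+ _].
  by rewrite dvdn_prime2 // => /eqP ->; rewrite inE.
(* Left cosets of [N] correspond to right cosets of [H], because [induces] reverses products. *)
exists e; pose F (X : {set {perm 'I_(d ^ n)}}) : set G := fun g => exists2 s, s \in X & induces r g s.
have indN g g' t : induces r g t -> induces r g' t -> N g -> N g'.
  move=> gt g't Ng; have N' : N (g'^-1 * g)%g.
    apply: Nn => _ /rP[i ->].
    by rewrite (induces_mul rP gt (induces_inv rP g't)) mulgV perm1.
  by have := Ndiv _ _ Ng N'; rewrite invMg invgK mulKVg.
have cosE g t : induces r g t -> [set (g * h)%g | h in N]%classic = F (H :* t)%g.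
  move=> gt; apply/seteqP; split=> [_ [h Nh <-]|g' [t' /rcosetP[sh shH ->] g't']].
    have [sh hsh] := induces_ex r_inj rP h; exists (sh * t)%g; last exact: induces_mul.
    by rewrite mem_rcoset mulgK; apply/induced_setP; exists h.
  exists (g^-1 * g')%g; last exact: mulKVg.
  have /induced_setP[h Nh hsh] := shH; apply: indN hsh _ Nh.
  by rewrite -[sh](mulgK t); apply: induces_mul => //; exact: induces_inv.
pose rs := enum (mem (rcosets H Gn)).
have srs : size rs = (p ^ e)%N by rewrite -cardE -He.
have memrs X : X \in rs -> exists2 t, t \in Gn & X = (H :* t)%g.
  by rewrite mem_enum => /rcosetsP[t tG ->]; exists t.
have -> : left_cosets N = [set F (nth finset.set0 rs i) | i in `I_(p ^ e)]%classic.
  apply/seteqP; split=> [_ [g _ <-]|_ [i /= lti <-]].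
    have [t gt] := induces_ex r_inj rP g.
    have tR : (H :* t)%g \in rs.
      by rewrite mem_enum; apply/rcosetsP; exists t => //; exact: induces_level_group gt.
    exists (index (H :* t)%g rs); first by rewrite /= -srs index_mem.
    by rewrite nth_index // (cosE _ _ gt).
  have [|t /induced_setP[g _ gt] ->] := memrs (nth finset.set0 rs i).
    by rewrite mem_nth // srs.
  by exists g => //; exact: cosE.
suff Finj : {in `I_(p ^ e)%N &, injective (fun i => F (nth finset.set0 rs i))}.
  exact: (inj_card_eq Finj).
move=> i i'; rewrite !inE /= => lti lti' FF.
have [|t tG Et] := memrs (nth finset.set0 rs i); first by rewrite mem_nth // srs.
have [|t' tG' Et'] := memrs (nth finset.set0 rs i'); first by rewrite mem_nth // srs.
have /induced_setP[g _ gt] := tG.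
have [t2 t2X gt2] : F (nth finset.set0 rs i') g by rewrite -FF Et; exists t; rewrite ?rcoset_refl.
apply/eqP; rewrite -(nth_uniq finset.set0 _ _ (enum_uniq (mem (rcosets H Gn)))) ?srs //.
move: t2X; rewrite Et Et' (induces_uniq r_inj gt2 gt) => /rcoset_eqP ->.
exact: eqxx.
Qed.

(** A constant term other than the critical value [b] has a simple preimage under [f], so Hensel's
    lemma applies; uniqueness of the lift makes it invariant under each scaling that fixes [xi]. *)
Lemma shape_hensel (xi : ps) : ps0 xi != b -> exists2 y : ps,
  (mapC fb).[y] = xi & forall w, ps_scale w xi = xi -> ps_scale w y = y.
Proof.
move=> xb; pose P : {poly ps} := mapC fb - xi%:P.
have P0 : map0 P = fb - (ps0 xi)%:P.
  rewrite rmorphB /= map_polyC -(map_poly_comp (@ps0 Kbar)) map_poly_id //.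
have [t tE] := nth_root_ex hK ((ps0 xi - b) / a) d0.
have t0 : t != 0.
  apply/eqP => t0; move: tE; rewrite t0 expr0n gtn_eqF // => /esym/eqP.
  by rewrite mulf_eq0 invr_eq0 (negPf a0) orbF subr_eq0 (negPf xb).
have hid x : fb.[x] = a * (x - c) ^+ d + b.
  by have := shape_horner idfun x; rewrite map_poly_id.
have rt : root (map0 P) (t + c).
  by rewrite P0 rootE !hornerE hid addrK tE mulrC divfK // subrK subrr.
have dt : (map0 P)^`().[t + c] != 0.
  rewrite P0 derivB derivC subr0 fE derivD derivC addr0 derivZ deriv_exp derivXsubC mul1r.
  by rewrite hornerZ hornerMn !hornerE addrK -mulr_natr !mulf_neq0 ?expf_neq0.
have [y ry y0] := hensel rt dt; exists y.
  by apply/eqP; rewrite -subr_eq0; move: ry; rewrite /P rootE !hornerE.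
move=> w wxi; apply: (@hensel_uniq _ P); rewrite ?ps0_scale ?y0 //.
move: ry; rewrite !rootE !hornerE !subr_eq0 => /eqP yx.
apply/eqP; rewrite -[RHS]wxi -yx -horner_map -(map_poly_comp (ps_scale w)).
by rewrite (eq_map_poly (g := @psC Kbar)) // => e /=; rewrite ps_scaleC.
Qed.

Variable k : nat.
Hypothesis Phik : forall g : G, fix_level k g -> frattini (arboreal_group iota f j) g.

Lemma unicritical_not_frattini (q r : nat) : b != c -> prime q -> prime r ->
  (q %| d)%N -> (r %| d)%N -> odd r -> q != r -> False.
Proof.
move=> bc pr_q pr_r qd rd odd_r qr.
have [w w_prim] := prim_root_ex hK d0.
have w0 := prim_root_neq0 w_prim.
(* Two levels beyond [k] are used: in the first the cycle at infinity moves [x1] among its siblings,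
   in the second inertia rotates the children of [x1]. *)
have [_ [tau [z0 [_ _ lz0 tr _]]]] := inertia_infinity (k + 2).
have [_ _ tau2] := cyclic_below lz0 tr.
have [tau_k1 tau1 _] : [/\ fix_level k.+1 (tau ^+ (d ^ k.+1))%g,
    forall u a, level k.+1 u -> galact (tau ^+ a)%g u = u -> (d ^ k.+1 %| a)%N & True].
  have lz1 : level (k.+1 + 1) z0 by rewrite addn1 -addn2.
  have tr1 x : level (k.+1 + 1) x -> exists a, x = galact (tau ^+ a)%g z0.
    by rewrite addn1 -addn2 => /tr.
  by have [h1 h2 _] := cyclic_below lz1 tr1.
have [tau_k _ _] := cyclic_below lz0 tr.
pose u := (fO 2).[z0]; have lu : level k u by exact: level_up.
(* [X1] is [f(c + X)]: its preimages under [f] are the [d] series [c + w^l X], which scaling by [w]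
   permutes cyclically. *)
pose X1 : ps := psC b + psC a * psX ^+ d.
pose FX (x : ps) := (mapC fb).[x].
have FXE x : FX x = psC a * (x - psC c) ^+ d + psC b by exact: shape_horner.
pose U := FX X1.
have X10 : ps0 X1 = b.
  by rewrite rmorphD rmorphM !rmorphXn /= !psCK ps0X expr0n gtn_eqF // mulr0 addr0.
have ncX1 : X1 != psC (ps0 X1).
  rewrite X10 -subr_eq0 [_ - _]addrAC subrr add0r mulf_eq0 fmorph_eq0 (negPf a0) /=.
  by rewrite expf_neq0 // psX_neq0.
have ncU : U != psC (ps0 U).
  apply/eqP => E; have /(ps_transc ncX1)/eqP : (mapC (fb - (ps0 U)%:P)).[X1] = 0.
    rewrite rmorphB /= map_polyC hornerD hornerN hornerC; apply/eqP; rewrite subr_eq0; exact/eqP.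
  rewrite subr_eq0 => /eqP fc; move: f1; rewrite fc => /leq_trans/(_ (size_polyC_leq1 _)).
  by rewrite ltnn.
have wX1 : ps_scale w X1 = X1.
  rewrite rmorphD rmorphM rmorphXn /= !ps_scaleC ps_scaleX exprMn -rmorphXn /=.
  by rewrite (prim_expr_order w_prim) rmorph1 mul1r.
have wFX x : ps_scale w (FX x) = FX (ps_scale w x).
  rewrite /FX -horner_map -(map_poly_comp (ps_scale w)); congr (_.[_]).
  by apply: eq_map_poly => e /=; rewrite ps_scaleC.
have wU : ps_scale w U = U by rewrite /U wFX wX1.
have [Gr [g [[gG Gk] gu GS _ gP]]] := local_lift lu ncU w0 wU.
have F1 x : (mapC (fiter fb 1)).[x] = FX x by rewrite fiter1.
have F2 x : (mapC (fiter fb 2)).[x] = FX (FX x).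
  by rewrite -[2%N]/(1 + 1)%N fiterD map_comp_poly horner_comp !F1.
have GrF x y : Gr (tofrac x, y) -> Gr (tofrac (FX x), (fO 1).[y]).
  by move=> h; rewrite -F1 -psL_map; exact: fgraph_horner.
pose Y : ps := psC c + psX.
have FY : FX Y = X1 by rewrite FXE /Y [_ - _]addrAC subrr add0r addrC.
have [x1 [lx1 x1u Gx1]] := GS 1%N X1 (F1 X1).
have [x0 [lx0 x0u Gx0]] : exists x, [/\ level (k + 2) x, (fO 2).[x] = u & Gr (tofrac Y, x)].
  by apply: GS; rewrite F2 FY.
have x0x1 : (fO 1).[x0] = x1.
  by have := GrF _ _ Gx0; rewrite FY => h; exact: (fgraph_fun gG h Gx1).
have ncst n (x : Omega) e : level n x -> x != cst e by move=> /transc_level; exact: transc_neq.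
have gx1 : galact g x1 = x1 by apply: (gP X1); rewrite ?wX1 // (level_mem lx1).
have Gzeta l x y : Gr (tofrac x, y) ->
    Gr (tofrac (psC c + psC (w ^+ l) * (x - psC c)), cst c + cst (w ^+ l) * (y - cst c)).
  move=> h; rewrite tofracD tofracM tofracB; apply: (fgraphD gG (Gk _)).
  by apply: (fgraphM gG (Gk _)); exact: (fgraphB gG h (Gk _)).
(* A sibling of [x1] is given by [Xi = c + w^i (X1 - c)] with [w^i] other than [1]. Its constant
   term differs from [b] because [b] is not [c], so its preimages under [f] are power series fixed
   by scaling. *)
have gfix y : level (k + 2) y -> (fO 2).[y] = u -> (fO 1).[y] != x1 -> galact g y = y.
  move=> ly yu yx1; pose x' := (fO 1).[y].
  have fx' : (fO 1).[x'] = (fO 1).[x1] by rewrite x1u -yu -[2%N]/(1 + 1)%N fO_D.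
  have [|i Ei] := shape_unity w_prim (ncst _ _ c lx1) (x := x'); first by rewrite -!fO1.
  pose Xi := psC c + psC (w ^+ i) * (X1 - psC c).
  have Gx' : Gr (tofrac Xi, x').
    have -> : x' = cst c + cst (w ^+ i) * (x1 - cst c) by rewrite -Ei addrC subrK.
    exact: Gzeta.
  have Xib : ps0 Xi != b.
    rewrite rmorphD rmorphM rmorphB /= !psCK X10; apply: contraNneq yx1 => E.
    have wi : w ^+ i = 1.
      apply: (mulIf (x := b - c)); first by rewrite subr_eq0.
      by rewrite mul1r; apply: (addrI c); rewrite E addrC subrK.
    by apply/eqP/(addIr (- cst c)); rewrite Ei wi rmorph1 mul1r.
  have [Yi FYi wYi] := shape_hensel Xib.
  have wYi' : ps_scale w Yi = Yi.
    by apply: wYi; rewrite rmorphD rmorphM rmorphB /= !ps_scaleC wX1.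
  have [yi [lyi _ Gyi]] : exists x, [/\ level (k + 2) x, (fO 2).[x] = u & Gr (tofrac Yi, x)].
    apply: GS; rewrite F2 -/(FX Yi) [FX Yi]FYi FXE /Xi [psC c + _]addrC addrK.
    rewrite exprMn -rmorphXn /= exprAC (prim_expr_order w_prim) expr1n rmorph1 mul1r.
    by rewrite -FXE.
  have yix' : (fO 1).[yi] = x'.
    have := GrF _ _ Gyi; rewrite [FX Yi]FYi => h; exact: (fgraph_fun gG h Gx').
  have [|l El] := shape_unity w_prim (ncst _ _ c lyi) (x := y); first by rewrite -!fO1 yix'.
  have -> : y = cst c + cst (w ^+ l) * (yi - cst c) by rewrite -El addrC subrK.
  apply: (gP _ _ _ _ (Gzeta l _ _ Gyi)).
    by rewrite rpredD ?rpredM ?rpredB ?cst_mem ?(level_mem lyi).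
  by rewrite rmorphD rmorphM rmorphB /= !ps_scaleC wYi'; exact: Gzeta.
have gx0 m : galact (g ^+ m)%g x0 = x0 -> (d %| m)%N.
  have Gm : Gr (tofrac (psC c + psC (w ^+ m) * psX), galact (g ^+ m)%g x0).
    elim: m => [|m IH]; first by rewrite expr0 expg0 rmorph1 mul1r galact_one.
    have [|x' [lx' _ Gx']] := GS 2%N (psC c + psC (w ^+ m.+1) * psX).
      rewrite F2 [FX (_ + _)]FXE [psC c + _]addrC addrK.
      rewrite exprMn -rmorphXn /= exprAC (prim_expr_order w_prim) expr1n rmorph1 mul1r.
      by rewrite addrC.
    rewrite expgS galact_mul ?(level_mem lx0) // (gP _ _ x' _ IH) //.
      by rewrite galact_mem ?(level_mem lx0).
    rewrite rmorphD rmorphM /= !ps_scaleC ps_scaleX mulrA -rmorphM /= -exprSr.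
    exact: Gx'.
  move=> E; rewrite E in Gm; have := fgraph_inj gG Gm Gx0.
  move=> /eqP; rewrite tofrac_eq /Y => /eqP/addrI/eqP; rewrite -subr_eq0.
  rewrite -[X in _ - X]mul1r -mulrBl mulf_eq0 (negPf (psX_neq0 _)) orbF -(rmorph1 (@psC Kbar)).
  rewrite subr_eq0 => /eqP/(congr1 (@ps0 Kbar)); rewrite !psCK => /eqP.
  by rewrite -(prim_order_dvd w_prim).
have [rt [r_inj rP]] := level_roots (k + 2).
have [t gt] := induces_ex r_inj rP (tau ^+ (d ^ k))%g.
have [xi gxi] := induces_ex r_inj rP g.
have [i0 Ei0] := (rP x0).1 lx0.
have lr i : level (k + 2) (rt i) by apply/rP; exists i.
have rM i : rt i \in M := level_mem (lr i).
have gtm m i : galact (tau ^+ (d ^ k * m))%g (rt i) = rt ((t ^+ m)%g i).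
  by rewrite expgM; exact: induces_exp.
have fO2 x : (fO 2).[x] = (fO 1).[(fO 1).[x]] by rewrite -fO_D.
pose pa i := (fO 1).[rt i].
have pa0 : pa i0 = x1 by rewrite /pa -Ei0.
have lpa i : level k.+1 (pa i) by apply: level_up; rewrite addSnnS.
apply: (@no_partial_rotation _ _ (level_group rP) (level_kernel k rP) pa t xi i0 d q r) => //.
- exact: level_kernel_normal.
- exact: level_kernel_nilpotent.
- by apply/induced_setP; exists (tau ^+ (d ^ k))%g.
- exact: induces_level_group gxi.
- move=> s i i' /induced_setP[h _ hs]; rewrite /pa => E.
  by rewrite -!hs -!galact_horner // E.
- move=> i Ei; have [|m Em] := tau2 (rt i0) (rt i) (lr _) (lr _).
    by rewrite !fO2 -/(pa i) -/(pa i0) Ei.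
  by exists m; apply: r_inj; rewrite -gtm expgM.
- move=> m; rewrite /pa -gtm -galact_horner //; split=> [/tau1|/dvdnP[m' ->]].
    by rewrite expnSr dvdn_pmul2l ?expn_gt0 ?d_gt0 //; apply; exact: lpa.
  rewrite [(m' * d)%N]mulnC mulnA -expnSr expgM.
  have: fix_level k.+1 ((tau ^+ (d ^ k.+1)) ^+ m')%g.
    elim: m' => [|m' IH] x lx; first by rewrite expg0 galact_one.
    by rewrite expgS galact_mul ?(level_mem lx) // IH // tau_k1.
  by apply; exact: lpa.
- by move=> i Ei; rewrite /pa -gxi -galact_horner // -/(pa i) Ei pa0 gx1.
- move=> m Em; apply: r_inj; rewrite -gxi; apply: gfix => //; last first.
    by apply/eqP; rewrite -pa0.
  rewrite -gtm -galact_horner // -Ei0 x0u expgM.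
  have: fix_level k ((tau ^+ (d ^ k)) ^+ m)%g.
    elim: m {Em} => [|m' IH] x lx; first by rewrite expg0 galact_one.
    by rewrite expgS galact_mul ?(level_mem lx) // IH // tau_k.
  exact.
- move=> m E; apply: gx0; rewrite Ei0 (induces_exp rP m gxi) E.
  by [].
Qed.

End Unicritical.

(** * Critical points with infinite orbit *)

Section OrbitPolynomials.

Definition point_stab (v : Omega) : set G := fun g => galact g v = v.

Lemma point_stab_closed v : v \in M -> group_closed (mem (point_stab v)).
Proof.
move=> vM; apply/group_closed_setP; split=> [|g h gv hv]; first exact: galact_one.
by rewrite /point_stab galact_mul // -{1}hv galactVK // gv.
Qed.

Variables (k : nat) (r : 'I_(d ^ k.+1) -> Omega) (u : Omega).
Hypotheses (r_inj : injective r) (rP : forall x, level k.+1 x <-> exists i, x = r i).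
Hypothesis lu : level k u.

Definition stab_group : {group {perm 'I_(d ^ k.+1)}} :=
  Group (induced_group_set rP (point_stab_closed (level_mem lu))).

Variables (R : {group {perm 'I_(d ^ k.+1)}}) (i0 : 'I_(d ^ k.+1)).
Hypotheses (nR : (R <| stab_group)%g) (r0u : (fO 1).[r i0] = u).

(** Among the symmetric functions of a block the product is convenient because every vertex has a
    pole at infinity, so that it cannot degenerate to a constant. *)
Definition orbit_prod i : Omega := \prod_(y in orb R i) r y.

Lemma orbit_prod_mem i : orbit_prod i \in M.
Proof. by apply: rpred_prod => y _; exact: (r_mem rP). Qed.

Lemma orbit_stab s i y : s \in stab_group ->
  (s y \in orb R (s i)) = (y \in orb R i).
Proof.
have /andP[_ /fintype.subsetP nR'] := nR => sG.
apply/idP/idP => [|h]; last by apply: orbit_norm; rewrite ?nR'.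
by rewrite -{2}[y](permK s) -{2}[i](permK s); apply: orbit_norm; rewrite nR' ?groupV.
Qed.

Lemma galact_orbit_prod (g : G) s i : galact g u = u -> induces r g s ->
  galact g (orbit_prod i) = orbit_prod (s i).
Proof.
move=> gu gs; have sG : s \in stab_group by apply/induced_setP; exists g.
rewrite galact_prod; last exact: (r_mem rP).
rewrite /orbit_prod [RHS](reindex_inj (@perm_inj _ s)) /=.
by apply: eq_big => [y|y _]; rewrite ?orbit_stab ?gs.
Qed.

(* This is where Lueroth's theorem would enter: the orbit product is fixed by    *)
(* the stabilizer of x = r i0, so it is a rational function of x, and even a     *)
(* polynomial in x since it is integral over Kbar[x].                            *)
Lemma orbit_prod_poly : exists q : {poly Kbar}, (map_poly cst q).[r i0] = orbit_prod i0.
Proof.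
have tv := transc_level (level_r rP i0).
have [phi [phiC phiX]] := transc_emb tv.
have [|a Ea] := galois_fixed (level_r rP i0) phiC phiX (orbit_prod_mem i0).
  move=> g gr; have gu : galact g u = u by rewrite -r0u galact_horner ?(r_mem rP) ?gr.
  have [s gs] := induces_ex r_inj rP g; rewrite (galact_orbit_prod _ gu gs).
  by congr orbit_prod; apply: r_inj; rewrite -gs.
pose ev : {rmorphism {poly Kbar} -> Omega} := horner_eval (r i0) \o map_poly cst.
have ev_inj : injective ev.
  by move=> p q /eqP; rewrite -subr_eq0 -rmorphB => /eqP /tv /eqP; rewrite subr_eq0 => /eqP.
have evE p : phi (tofrac p) = ev p by apply: (phi_poly phiC phiX).
have [A0 [B0 [B00 Eab]]] := fractionP a.
pose D := gcdp A0 B0; pose A := A0 %/ D; pose B := B0 %/ D.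
have D0 : D != 0 by rewrite gcdp_eq0 negb_and B00 orbT.
have EA : A0 = A * D by rewrite divpK // dvdp_gcdl.
have EB : B0 = B * D by rewrite divpK // dvdp_gcdr.
have B_neq0 : B != 0 by apply: contraNneq B00 => B0'; rewrite EB B0' mul0r.
have cAB : coprimep A B by apply: coprimep_div_gcd; rewrite B00 orbT.
have EpAB : orbit_prod i0 = ev A / ev B.
  have evD0 : ev D != 0 by rewrite -(rmorph0 ev) (inj_eq ev_inj).
  by rewrite Ea Eab fmorph_div !evE EA EB !rmorphM /= -mulf_div divff // mulr1.
have sB : size B = 1%N.
  apply: (integral_fraction_const ev_inj B_neq0 cAB); rewrite -EpAB.
  apply: (big_ind (integralOver ev)) => [||y yR]; [exact: integral1|exact: integral_mul|].
  have yu : (fO 1).[r y] = u.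
    have /orbit_permP[s sR ->] := yR.
    have /(fintype.subsetP (normal_sub nR))/induced_setP[g gu gs] := sR.
    by rewrite -gs -galact_horner ?(r_mem rP) // [(_ _).[_]]r0u.
  have l0 : lead_coef fb != 0 by rewrite lead_coef_eq0 -size_poly_gt0 ltnW.
  (* This is [f(Y) - f(X)] as a polynomial in [Y]. Its leading coefficient is a nonzero constant,
     and the siblings of [r i0] are its roots at [X = r i0], which makes them integral. *)
  pose p : {poly {poly Kbar}} := map_poly polyC fb - fb%:P.
  have lp : lead_coef p = (lead_coef fb)%:P.
    rewrite lead_coefDl; first by apply: lead_coef_map_inj; [exact: polyC_inj|exact: polyC0].
    by rewrite size_polyN size_map_polyC (leq_ltn_trans (size_polyC_leq1 _)).
  exists (((lead_coef fb)^-1)%:P *: p).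
    by rewrite monicE lead_coefZ lp -polyCM mulVf.
  rewrite map_polyZ rootZ; last by rewrite -(rmorph0 ev) (inj_eq ev_inj) polyC_eq0 invr_eq0.
  rewrite rmorphB /= map_polyC -map_poly_comp rootE !hornerE /=.
  rewrite (eq_map_poly (g := cst)) => [|e]; last by rewrite /= map_polyC /horner_eval hornerC.
  by rewrite subr_eq0 /horner_eval -!fO1 r0u yu.
have /size_poly1P[e e0 Be] : size B == 1%N by rewrite sB.
exists (e^-1 *: A).
rewrite EpAB Be /= /horner_eval map_polyC hornerC map_polyZ hornerZ fmorphV.
exact: mulrC.
Qed.

(** Pole orders at infinity are compared: each factor of the orbit product has a simple pole, while
    [q] turns the simple pole of [r i0] into one of order [deg q]. *)
Lemma orbit_poly_size (q : {poly Kbar}) : (map_poly cst q).[r i0] = orbit_prod i0 ->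
  size q = #|orb R i0|.+1.
Proof.
move=> Eq; have [Gr [_ [_ [gG Gk _ _ Gz]]]] := inertia_infinity k.+1.
have prodE (s : seq 'I_(d ^ k.+1)) : exists2 z : ps, ps0 z != 0 &
    Gr (tofrac z / tofrac psX ^+ size s, \prod_(y <- s) r y).
  elim: s => [|y s [z z0 Gs]].
    by exists 1; rewrite ?rmorph1 ?oner_eq0 // big_nil expr0 divr1; have [] := gG.
  have [z' z'0 Gy] := Gz _ (level_r rP y); exists (z' * z); first by rewrite rmorphM mulf_neq0.
  by rewrite big_cons /= exprS tofracM -mulf_div; exact: fgraphM.
have [z z0 Gs] := prodE (enum (orb R i0)).
rewrite big_enum -cardE -/(orbit_prod i0) in Gs.
have [z1 z10 G1] := Gz _ (level_r rP i0).
have q0 : q != 0.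
  apply/eqP => q0; move: Eq; rewrite q0 rmorph0 horner0 => /esym/eqP/prodf_eq0[y _ /eqP ry0].
  by have := transc_neq 0 (transc_level (level_r rP y)); rewrite rmorph0 ry0 eqxx.
have [z2 z20 E2] := horner_pole q0 z10.
have := fgraph_horner q gG Gk G1; rewrite E2 Eq => /(fgraph_inj gG Gs).
by move=> /(pole_order_uniq z0 z20) ->; rewrite prednK // size_poly_gt0.
Qed.

Lemma orbit_poly : exists2 q : {poly Kbar}, q != 0 &
  forall s, s \in stab_group ->
    map_poly cst q - ((map_poly cst q).[r (s i0)])%:P =
    cst (lead_coef q) *: \prod_(y in orb R (s i0)) ('X - (r y)%:P).
Proof.
have [q Eq] := orbit_prod_poly; have sq := orbit_poly_size Eq.
have q1 : (1 < size q)%N by rewrite sq ltnS; apply/card_gt0P; exists i0; exact: orbit_refl.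
exists q => [|s sG]; first by rewrite -size_poly_gt0 ltnW.
have Eqs s' : s' \in stab_group -> (map_poly cst q).[r (s' i0)] = orbit_prod (s' i0).
  move=> /induced_setP[g gu gs].
  by rewrite -gs -galact_horner ?(r_mem rP) // Eq (galact_orbit_prod _ gu gs).
set v := _.[_]; pose rs := [seq r y | y <- enum (orb R (s i0))].
have sv : (size (- v%:P) < size (map_poly cst q))%N.
  by rewrite size_polyN size_map_poly (leq_ltn_trans (size_polyC_leq1 _)).
have -> : cst (lead_coef q) = lead_coef (map_poly cst q - v%:P).
  by rewrite lead_coefDl // lead_coef_map.
rewrite {1}(@all_roots_prod_XsubC _ (map_poly cst q - v%:P) rs).
- by rewrite big_map big_enum.
- rewrite size_polyDl // size_map_poly sq size_map -cardE; congr _.+1.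
  rewrite -(card_imset (orb R i0) (@perm_inj _ s)); apply: eq_card => y.
  by rewrite -[y](permKV s) orbit_stab // mem_imset //; exact: perm_inj.
- apply/allP => _ /mapP[y + ->]; rewrite mem_enum => yR.
  rewrite rootE !hornerE subr_eq0 /v; apply/eqP.
  have /orbit_permP[s' s'R ->] := yR.
  have s'G := fintype.subsetP (normal_sub nR) _ s'R.
  rewrite -permM !Eqs ?groupM // /orbit_prod permM.
  suff -> : orb R (s' (s i0)) = orb R (s i0) by [].
  by apply/orbit_eqP; exact: mem_orbit.
- by rewrite uniq_rootsE map_inj_uniq // enum_uniq.
Qed.

End OrbitPolynomials.

(** * Inertia at a critical point *)

Section CriticalInertia.

Variables (c : Kbar) (e k : nat) (h : {poly Kbar}).
Hypothesis fE : fb - (fb.[c])%:P = ('X - c%:P) ^+ e * h.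
Hypotheses (hc : h.[c] != 0) (e0 : e%:R != 0 :> Kbar) (e1 : (1 < e)%N).
Hypothesis late : forall c' m, c' \in cs -> (0 < m <= k)%N ->
  (fiter fb k).[fb.[c]] != (fiter fb m).[c'].

Let y1 := fb.[c].
Let b := (fiter fb k).[y1].
Let U1 : ps := psC y1 + psX ^+ e.
Let FX m (x : ps) := (mapC (fiter fb m)).[x].
Let U := FX k U1.
Let epos : (0 < e)%N. Proof. exact: ltnW. Qed.

Let ps0D (x y : ps) : ps0 (x + y) = ps0 x + ps0 y. Proof. exact: rmorphD. Qed.
Let ps0Xn (x : ps) : ps0 (psX ^+ e * x) = 0.
Proof. by case: e epos => // m _; exact: ps0_mulXn. Qed.
Let scD w (x y : ps) : ps_scale w (x + y) = ps_scale w x + ps_scale w y.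
Proof. exact: rmorphD. Qed.
Let scXn w (x : ps) : w ^+ e = 1 -> ps_scale w (psX ^+ e * x) = psX ^+ e * ps_scale w x.
Proof.
by move=> we; rewrite rmorphM rmorphXn /= ps_scaleX exprMn -rmorphXn we rmorph1 mul1r.
Qed.

Let sep : separable_poly (fiter fb k - b%:P).
Proof.
have := @separable_fiter _ _ idfun fb cs k b fcs; rewrite map_poly_id //; apply=> c' m c'in mk.
exact: late.
Qed.

Let simple_root y : root (fiter fb k - b%:P) y -> (fiter fb k - b%:P)^`().[y] != 0.
Proof. by have := sep; rewrite unlock => /coprimep_root; apply. Qed.

Let D := (fiter fb k)^`().[y1].
Let D0 : D != 0.
Proof. by have := simple_root (y := y1); rewrite derivB derivC subr0 rootE !hornerE subrr; apply. Qed.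

Let sizeP : size (fiter fb k - b%:P) = (d ^ k).+1.
Proof.
rewrite size_polyDl size_fiter // size_polyN (leq_ltn_trans (size_polyC_leq1 _)) //.
by rewrite ltnS expn_gt0 d_gt0.
Qed.

Let ps0F m x : ps0 (FX m x) = (fiter fb m).[ps0 x].
Proof. by rewrite /FX -horner_map -(map_poly_comp (@ps0 Kbar)) map_poly_id. Qed.

Let scaleF w m x : ps_scale w (FX m x) = FX m (ps_scale w x).
Proof.
rewrite /FX -horner_map -(map_poly_comp (ps_scale w)); congr (_.[_]).
by apply: eq_map_poly => a /=; rewrite ps_scaleC.
Qed.

Let U1_scale w : w ^+ e = 1 -> ps_scale w U1 = U1.
Proof. by move=> we; rewrite /U1 scD ps_scaleC -[psX ^+ e]mulr1 scXn // rmorph1. Qed.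

Let ncU : U != psC (ps0 U).
Proof.
apply/eqP => E; have ncU1 : U1 != psC (ps0 U1).
  rewrite /U1 ps0D -[psX ^+ e]mulr1 ps0Xn psCK mulr1 addr0 -subr_eq0.
  by rewrite [_ - _]addrAC subrr add0r expf_neq0 // psX_neq0.
have /(ps_transc ncU1)/eqP : (mapC (fiter fb k - (ps0 U)%:P)).[U1] = 0.
  by rewrite rmorphB /= map_polyC hornerD hornerN hornerC; apply/eqP; rewrite subr_eq0; exact/eqP.
rewrite subr_eq0 => /eqP fc; have := size_fiter k f1; rewrite fc => E'.
by have := size_polyC_leq1 (ps0 U); rewrite E' ltnS leqNgt expn_gt0 d_gt0.
Qed.

(** Substituting [c + X Y] for [x] in [f = f(c) + (x - c)^e h] and dividing by [X^e] leaves
    [Y^e h(c + X Y) = 1]. Its reduction [h(c) Y^e = 1] has simple roots because [e] is nonzero in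
    [Kbar]. *)
Let branch : exists2 Y0 : ps, ps0 Y0 != 0 & FX 1 (psC c + psX * Y0) = U1.
Proof.
have [y0 y0E] := nth_root_ex hK (h.[c])^-1 e0.
have y00 : y0 != 0.
  apply/eqP => E; move: y0E; rewrite E expr0n gtn_eqF // => /esym/eqP.
  by rewrite invr_eq0 (negPf hc).
pose lin : {poly ps} := (psC c)%:P + psX *: 'X.
pose Q : {poly ps} := 'X^e * (mapC h \Po lin) - 1.
have Q0 : map0 Q = h.[c] *: 'X^e - 1.
  rewrite rmorphB rmorphM rmorph1 /= map_polyXn map_comp_poly -(map_poly_comp (@ps0 Kbar)).
  rewrite (map_poly_id (p := h)) // rmorphD /= map_polyC map_polyZ map_polyX /= psCK ps0X.
  by rewrite scale0r addr0 comp_polyCr mulrC mul_polyC.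
have [||Y0 rY0 Y00] := @hensel _ Q y0.
- by rewrite Q0 rootE !hornerE y0E divff ?subrr.
- rewrite Q0 derivB derivZ derivXn -polyC1 derivC subr0 hornerZ hornerMn hornerXn.
  by rewrite -mulr_natr !mulf_neq0 // expf_neq0.
exists Y0; first by rewrite Y00.
have fE' : FX 1 (psC c + psX * Y0) - psC y1 =
    (psX * Y0) ^+ e * (mapC h).[psC c + psX * Y0].
  have := congr1 (fun p => (mapC p).[psC c + psX * Y0]) fE.
  rewrite rmorphB rmorphM rmorphXn rmorphB /= !map_polyC map_polyX hornerM horner_exp.
  rewrite !hornerD !hornerN !hornerC hornerX => E; rewrite /FX fiter1.
  by rewrite [LHS]E [psC c + _]addrC addrK.
apply/eqP; rewrite /U1 [X in _ == X]addrC -subr_eq fE' exprMn -mulrA.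
move: rY0; rewrite rootE /Q hornerD hornerN hornerM hornerXn horner_comp /lin.
rewrite hornerD !hornerC hornerZ hornerX subr_eq0 => /eqP ->.
by rewrite mulr1.
Qed.

(** The derivative [D] of [f^k] at [f(c)] is nonzero, so [U - b] is [X^e] times a unit [W]. Hensel's
    lemma gives a [p]-th root [V] of [W], and [X^e] has one because [p] divides [e]. *)
Let kummer p : p%:R != 0 :> Kbar -> (p %| e)%N -> exists2 V : ps,
  (psX ^+ (e %/ p) * V) ^+ p = U - psC b & forall w, w ^+ e = 1 -> ps_scale w V = V.
Proof.
move=> p0 pe; have ppos : (0 < p)%N by rewrite lt0n; apply: contraNneq p0 => ->.
have [R ER] := horner_taylor2 (mapC (fiter fb k)) (psC y1) (psX ^+ e).
pose W : ps := psC D + psX ^+ e * R.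
have UW : U = psC b + psX ^+ e * W.
  rewrite [LHS]ER !horner_map deriv_map horner_map /= -/D -/b /W mulrDr -addrA.
  by congr (_ + (_ + _)); [exact: mulrC|rewrite mulrA -expr2].
have W0 : ps0 W = D.
  by rewrite ps0D ps0Xn psCK addr0.
have [v0 v0E] := nth_root_ex hK D p0.
have v00 : v0 != 0.
  by apply/eqP => E; move: v0E D0; rewrite E expr0n gtn_eqF // => <-; rewrite eqxx.
pose Q : {poly ps} := 'X^p - W%:P.
have Q0 : map0 Q = 'X^p - D%:P by rewrite rmorphB /= map_polyXn map_polyC /= W0.
have dQ : (map0 Q)^`().[v0] != 0.
  rewrite Q0 derivB derivXn derivC subr0 hornerMn hornerXn -mulr_natr.
  by rewrite mulf_neq0 // expf_neq0.
have [||V rV V0] := @hensel _ Q v0; [by rewrite Q0 rootE !hornerE v0E subrr|by []|].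
have VW : V ^+ p = W by move: rV; rewrite rootE !hornerE subr_eq0 => /eqP.
exists V; first by rewrite exprMn -exprM divnK // VW UW addrC addKr.
move=> w we; apply: (@hensel_uniq _ Q); rewrite ?ps0_scale ?V0 //.
rewrite rootE !hornerE -rmorphXn /= VW subr_eq0; apply/eqP.
have Xe0 : psX ^+ e != 0 :> ps by rewrite expf_neq0 // psX_neq0.
apply: (mulfI Xe0); apply: (addrI (psC b)); rewrite -UW.
have : ps_scale w U = U by rewrite /U scaleF U1_scale.
by rewrite {1}UW scD ps_scaleC scXn.
Qed.

(** With [t] sent to [U], the element [g] is scaling by a primitive [e]-th root of unity [w]. Level
    [k] consists of Hensel lifts of the simple roots of [f^k - b], which scaling fixes; [x0] is the
    branch [c + X Y0]; and [beta], a constant times [X^(e/p) V], is multiplied by [w^(e/p)], which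
    is not [1]. *)
Lemma critical_inertia : exists (Gr : set (L * Omega)) (g : G) (x0 : Omega),
  [/\ field_graph Gr /\ (forall a, Gr (psL a, cst a)), fix_level k g,
      level k.+1 x0 /\ galact g x0 != x0,
      forall m, exists2 x : ps, ps0 x = c & Gr (tofrac x, galact (g ^+ m)%g x0)
    & galact (g ^+ e)%g x0 = x0 /\ forall p (beta : Omega), p%:R != 0 :> Kbar ->
       (1 < p)%N -> (p %| e)%N -> beta \in M -> beta ^+ p = tO - cst b -> galact g beta != beta].
Proof.
have [w w_prim] := prim_root_ex hK e0; have we := prim_expr_order w_prim.
have w0 := prim_root_neq0 w_prim.
have wU : ps_scale w U = U by rewrite /U scaleF U1_scale.
have [Gr [g [[gG Gk] _ GS GB gP]]] := local_lift level0_t ncU w0 wU.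
have GU : Gr (tofrac U, tO).
  have [|x [_ <- Gx]] := GS 0%N U; first by rewrite map_polyX hornerX.
  by rewrite /fO map_polyX hornerX.
have [Y0 Y00 FY0] := branch.
pose X m : ps := ps_scale (w ^+ m) (psC c + psX * Y0).
have FX1 m : FX k.+1 (X m) = U.
  have wm : (w ^+ m) ^+ e = 1 by rewrite exprAC we expr1n.
  rewrite -addn1 /FX fiterD map_comp_poly horner_comp -/(FX 1 _) -/(FX k _).
  by rewrite /X -scaleF FY0 U1_scale.
have X0 m : ps0 (X m) = c by rewrite ps0_scale ps0D rmorphM /= ps0X mul0r addr0 psCK.
have XS m : ps_scale w (X m) = X m.+1 by rewrite /X ps_scale_comp -exprS.
have X0E : X 0%N = psC c + psX * Y0 by rewrite /X expr0 ps_scale1.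
have [x0 [lx0 _ Gx0]] := GS _ _ (FX1 0%N); rewrite add0n in lx0.
have Gm m : Gr (tofrac (X m), galact (g ^+ m)%g x0).
  elim: m => [|m IH]; first by rewrite expg0 galact_one.
  have [x' [_ _ Gx']] := GS _ _ (FX1 m.+1).
  rewrite expgS galact_mul ?(level_mem lx0) // (gP (X m) _ x') ?XS //.
  by rewrite galact_mem ?(level_mem lx0).
have tofrac_inj (x y : ps) : tofrac x = tofrac y -> x = y by move=> /eqP; rewrite tofrac_eq => /eqP.
exists Gr, g, x0; split=> //.
- have [rs urs rsP] := separable_poly_roots hK sep.
  have srs : size rs = (d ^ k)%N.
    by have := eqp_size rsP; rewrite sizeP size_prod_XsubC => -[->].
  pose P : {poly ps} := mapC (fiter fb k) - U%:P.
  have P0 : map0 P = fiter fb k - b%:P.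
    rewrite rmorphB /= map_polyC -(map_poly_comp (@ps0 Kbar)) map_poly_id //=.
    by rewrite /U ps0F /U1 ps0D -[psX ^+ e]mulr1 ps0Xn psCK addr0.
  have ex (i : 'I_(d ^ k)) : exists2 y : ps, ps0 y = nth 0 rs i & ps_scale w y = y /\ FX k y = U.
    have ry : root (fiter fb k - b%:P) (nth 0 rs i).
      by rewrite (eqp_root rsP) root_prod_XsubC mem_nth // srs.
    have [||y yr y0] := @hensel _ P (nth 0 rs i); rewrite ?P0 ?simple_root //.
    have FyU : FX k y = U by move: yr; rewrite rootE !hornerE subr_eq0 => /eqP.
    exists y => //; split=> //; apply: (@hensel_uniq _ P); rewrite ?ps0_scale ?y0 ?P0 ?simple_root //.
    by rewrite rootE !hornerE -/(FX k _) -scaleF FyU wU subrr.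
  have [r [r_inj rP]] := level_roots k.
  have ex' (i : 'I_(d ^ k)) : exists i', exists2 y : ps, ps0 y = nth 0 rs i &
      ps_scale w y = y /\ Gr (tofrac y, r i').
    have [y y0 [wy /GS[x [lx _ Gx]]]] := ex i; rewrite add0n in lx.
    have [i' Ei'] := (rP x).1 lx; exists i', y => //; split=> //.
    by rewrite -Ei'.
  pose sg i := sval (cid (ex' i)).
  have sgP (i : 'I_(d ^ k)) : exists2 y : ps, ps0 y = nth 0 rs i & ps_scale w y = y /\ Gr (tofrac y, r (sg i)).
    by rewrite /sg; case: cid.
  have sg_inj : injective sg.
    move=> i i' E; have [y y0 [_ Gy]] := sgP i; have [y' y'0 [_ Gy']] := sgP i'.
    rewrite E in Gy; have /tofrac_inj yy' := fgraph_inj gG Gy Gy'.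
    apply/val_inj/eqP; rewrite -(nth_uniq 0 _ _ urs) ?srs ?ltn_ord //.
    by rewrite -y0 -y'0 yy'.
  move=> x lx; have [i Ei] := (rP x).1 lx; have /codomP[i' Ei'] := injF_onto sg_inj i.
  have [y _ [wy Gy]] := sgP i'; rewrite -Ei' -Ei in Gy.
  by apply: (gP y); rewrite ?wy // (level_mem lx).
- split=> //; apply/eqP => E; have := Gm 1%N; rewrite expg1 E => /(fgraph_inj gG Gx0)/tofrac_inj.
  rewrite X0E -XS X0E scD ps_scaleC rmorphM /= ps_scaleX => /addrI.
  rewrite [psC w * _]mulrC -mulrA => /(mulfI (psX_neq0 _))/(congr1 (@ps0 Kbar)).
  rewrite rmorphM /= psCK ps0_scale -{1}[ps0 Y0]mul1r => /(mulIf Y00) w1.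
  move: (prim_order_dvd w_prim 1); rewrite expr1 -w1 eqxx dvdn1.
  by rewrite gtn_eqF.
- by move=> m; exists (X m).
split.
  have := Gm e; have -> : X e = X 0%N by rewrite X0E /X we ps_scale1.
  by move=> h1; exact: (fgraph_fun gG h1 Gx0).
move=> p beta p0 p1 pe bM Eb; have [V VE wV] := kummer p0 pe.
have [x Gx] := GB _ _ _ p0 VE.
have xp : x ^+ p = tO - cst b.
  have GX n : Gr ((tofrac (psX ^+ (e %/ p) * V)) ^+ n, x ^+ n).
    elim: n => [|n IH]; first by rewrite !expr0; have [] := gG.
    by rewrite !exprS; exact: fgraphM.
  have := GX p; rewrite -tofracXn VE tofracB => h1.
  exact: (fgraph_fun gG h1 (fgraphB gG GU (Gk b))).
have tb0 : tO - cst b != 0 by rewrite subr_eq0; apply: transc_neq; exact: transc_t.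
have x_neq0 : x != 0 by apply: contraNneq tb0 => x0'; rewrite -xp x0' expr0n gtn_eqF // ltnW.
(* An arbitrary [p]-th root [beta] of [t - b] differs from the one given by [V] by a constant root
   of unity, which inertia fixes. *)
have [z z_prim] := prim_root_ex hK p0.
have zO : p.-primitive_root (cst z) by rewrite fmorph_primitive_root.
have [|i Ei] := prim_rootP zO (x := beta / x).
  by rewrite expr_div_n Eb xp divff // -xp expf_neq0.
have Bx : beta = cst (z ^+ i) * x by rewrite rmorphXn -Ei divfK.
pose B : ps := psC (z ^+ i) * (psX ^+ (e %/ p) * V).
have GrB : Gr (tofrac B, beta) by rewrite Bx tofracM; exact: (fgraphM gG (Gk _) Gx).
have -> : galact g beta = cst (w ^+ (e %/ p)) * beta.
  apply: (gP B) => //.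
  have -> : ps_scale w B = psC (w ^+ (e %/ p)) * B.
    rewrite /B !rmorphM !rmorphXn /= ps_scaleC ps_scaleX wV // exprMn.
    ring.
  by rewrite tofracM; exact: (fgraphM gG (Gk _) GrB).
rewrite -subr_eq0 -[X in _ - X]mul1r -mulrBl mulf_neq0 //; last first.
  by apply: contraNneq tb0 => B0; rewrite -Eb B0 expr0n gtn_eqF // ltnW.
rewrite subr_eq0 -(rmorph1 cst) fmorph_eq -(prim_order_dvd w_prim).
have ep : (0 < e %/ p)%N by rewrite divn_gt0 ?(ltnW p1) // dvdn_leq.
by rewrite gtnNdvd // ltn_Pdiv.
Qed.

End CriticalInertia.

(* The stabilizer of beta has prime index p, hence is maximal, unless it is G. *)
Lemma frattini_kummer (p : nat) (b : Kbar) (beta : Omega) : prime p -> p%:R != 0 :> Kbar ->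
  beta \in M -> beta ^+ p = tO - cst b ->
  forall g : G, frattini (arboreal_group iota f j) g -> galact g beta = beta.
Proof.
move=> pr_p p0 bM bp g Fg.
have beta0 : beta != 0.
  have : tO - cst b != 0 by rewrite subr_eq0; apply: transc_neq; exact: transc_t.
  by apply: contraNneq => B0; rewrite -bp B0 expr0n gtn_eqF // prime_gt0.
pose H : set G := point_stab beta.
have [HT|HT] := pselect (H = setT); first by have : H g by rewrite HT.
have clH := point_stab_closed bM; have /group_closed_setP[_ Hdiv] := clH.
have oH : open H.
  apply/open_krullE => s Hs; exists [:: Adjoin bM] => s' ss'.
  have := ss' (Adjoin bM); rewrite mem_seq1 eqxx => /(_ isT) E.
  rewrite /H /point_stab -[X in galact _ X]/(val (Adjoin bM)) galactE -E -galactE.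
  exact: Hs.
apply: (Fg H); split=> // H' [clH' oH'] HH'; have /group_closed_setP[oneH2 divH2] := clH'.
have [sH'|] := pselect (H' `<=` H)%classic; first by left; apply/seteqP; split.
move=> nsub; right; apply/seteqP; split=> // s _.
have [s1 H's1 nHs1] : exists2 s1, H' s1 & ~ H s1.
  apply: contrapT => no; apply: nsub => s1 H's1; apply: contrapT => nHs1.
  by apply: no; exists s1.
have unity (s2 : G) : (galact s2 beta / beta) ^+ p = 1.
  rewrite expr_div_n -galactX // bp galactB ?j_mem ?cst_mem // galact_cst galact_j.
  by rewrite -bp divff // expf_neq0.
have [z z_prim] := prim_root_ex hK p0.
have zO : p.-primitive_root (cst z) by rewrite fmorph_primitive_root.
have [i Ei] := prim_rootP zO (unity s1); have [l El] := prim_rootP zO (unity s).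
have s1X m : galact (s1 ^+ m)%g beta = cst (z ^+ (i * m)) * beta.
  elim: m => [|m IH]; first by rewrite muln0 expr0 expg0 rmorph1 mul1r galact_one.
  rewrite expgS galact_mul // IH galactM ?cst_mem // galact_cst.
  rewrite -[galact s1 beta](divfK beta0) Ei mulrA -rmorphXn -rmorphM -exprD /=.
  by rewrite mulnS addnC.
have ci : coprime i p.
  rewrite coprime_sym prime_coprime //; apply/negP => pi; apply: nHs1.
  rewrite /H /point_stab -[LHS](divfK beta0) Ei.
  by move: pi; rewrite (prim_order_dvd zO) => /eqP ->; rewrite mul1r.
have ip : (0 < i)%N.
  by rewrite lt0n; apply: contraTneq ci => ->; rewrite /coprime gcd0n gtn_eqF // prime_gt1.
(* [s1] multiplies [beta] by a primitive [p]-th root of unity, so some power [s1 ^+ m] agrees with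
   [s] at [beta], and [s] differs from it by an element of [H]. *)
have [m /eqP Em] : exists m, i * m == l %[mod p].
  have [u v Euv _] := egcdnP p ip; rewrite (eqP ci) in Euv.
  exists (u * l)%N; rewrite mulnA [(i * u)%N]mulnC Euv mulnDl mul1n mulnAC.
  by rewrite modnMDl.
have Hs2 : H ((s1 ^+ m)^-1 * s)%g.
  rewrite /H /point_stab galact_mul // -[galact s beta](divfK beta0) El.
  have -> : cst z ^+ l = cst (z ^+ (i * m)).
    by rewrite rmorphXn; apply/eqP; rewrite (eq_prim_root_expr zO) Em.
  by rewrite -s1X galactVK.
have H'm : H' (s1 ^+ m)%g.
  elim: {Em Hs2} m => [|m IH]; first by rewrite expg0.
  rewrite expgS -[(s1 ^+ m)%g]invgK; apply: (divH2 _ _) => //.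
  by rewrite -[(_^-1)%g]mul1g; exact: divH2.
rewrite -[s](mulKVg (s1 ^+ m)%g).
rewrite -[((s1 ^+ m)^-1 * s)%g]invgK; apply: (divH2 _ _) => //.
by rewrite -[(_^-1)%g]mul1g; apply: (divH2 _ _) => //; exact: HH'.
Qed.

(** * Powers in the tower obtained from blocks *)

Definition is_power (p : nat) (z : Omega) : Prop := exists2 W, W \in M & z = W ^+ p.

Lemma is_powerM p z z' : is_power p z -> is_power p z' -> is_power p (z * z').
Proof.
by move=> [W WM ->] [W' W'M ->]; exists (W * W'); rewrite ?rpredM // exprMn.
Qed.

Lemma is_power_cst p a : p%:R != 0 :> Kbar -> is_power p (cst a).
Proof.
move=> p0; have [a' a'p] := nth_root_ex hK a p0.
by exists (cst a'); rewrite ?cst_mem // -rmorphXn a'p.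
Qed.

Section BlockPower.

Lemma fiber_product (m : nat) (v : Omega) (c : Kbar) : transc v -> exists rs : seq Omega,
  [/\ uniq rs, forall z, z \in rs <-> (fO m).[z] = v
    & cst (fiter fb m).[c] - v = cst (lead_coef (fiter fb m)) * \prod_(z <- rs) (cst c - z)].
Proof.
move=> tv; have [rs urs rsP] := separable_poly_roots hO.2 (separable_fO m tv).
exists rs; split=> // [z|].
  rewrite -root_prod_XsubC -(eqp_root rsP) rootE !hornerE subr_eq0.
  by split=> /eqP.
have sv : (size (- v%:P) < size (fO m))%N.
  rewrite size_polyN (leq_ltn_trans (size_polyC_leq1 _)) // /fO size_map_poly size_fiter //.
  by rewrite ltnS expn_gt0 d_gt0.
have := eqp_eq rsP; rewrite (monicP (monic_prod_XsubC _ _ _)) scale1r lead_coefDl //.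
rewrite lead_coef_map => /(congr1 (horner_eval (cst c))).
rewrite /horner_eval hornerZ hornerD hornerN hornerC (horner_map cst) => ->.
by rewrite horner_prod; congr (_ * _); apply: eq_bigr => z _; rewrite hornerXsubC.
Qed.

Variables (k : nat) (r : 'I_(d ^ k.+1) -> Omega) (u : Omega).
Hypotheses (r_inj : injective r) (rP : forall x, level k.+1 x <-> exists i, x = r i).
Hypothesis lu : level k u.
Local Notation Gm := (stab_group rP lu).
Variables (i0 : 'I_(d ^ k.+1)) (h : {perm 'I_(d ^ k.+1)}) (R R' : {group {perm 'I_(d ^ k.+1)}}).
Variables (p s : nat) (c : Kbar) (Gr : set (L * Omega)).
Hypotheses (r0u : (fO 1).[r i0] = u) (nR : (R <| Gm)%g) (nR' : (R' <| Gm)%g) (hG : h \in Gm).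
Hypothesis fiber : forall i, (fO 1).[r i] = u -> exists2 t, t \in Gm & i = t i0.
Hypothesis blocks : forall y, (y \in orb R' i0) =
  [exists a : 'I_p, y \in orb R ((h ^+ (s * a))%g i0)].
Hypothesis disj : forall a b : 'I_p,
  (h ^+ (s * a))%g i0 \in orb R ((h ^+ (s * b))%g i0) -> a = b.
Hypotheses (gG : field_graph Gr) (Gk : forall a, Gr (psL a, cst a)).
Hypothesis Grc : forall m, exists2 x : ps, ps0 x = c & Gr (tofrac x, r ((h ^+ m)%g i0)).
Hypothesis p0 : p%:R != 0 :> Kbar.

(* K(X) - K(x0) is a constant times the product of the k(X) - k(e_a), where the  *)
(* e_a are conjugates of x0 under inertia at c; all of them specialize to c.     *)
Lemma block_reduction : exists qK qk : {poly Kbar}, exists2 C : Kbar,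
  (forall t, t \in Gm -> exists l, \prod_(y in orb R' (t i0)) (cst c - r y) =
     cst l * (cst qK.[c] - (map_poly cst qK).[r (t i0)]))
  & qK - (qK.[c])%:P = C *: (qk - (qk.[c])%:P) ^+ p.
Proof.
have [qK qK0 EK] := orbit_poly r_inj nR' r0u.
have [qk qk0 Ek] := orbit_poly r_inj nR r0u.
have lK0 : lead_coef qK != 0 by rewrite lead_coef_eq0.
have lk0 : lead_coef qk != 0 by rewrite lead_coef_eq0.
pose C := lead_coef qK / lead_coef qk ^+ p; exists qK, qk, C => [t tG|].
  exists (lead_coef qK)^-1.
  have := congr1 (horner_eval (cst c)) (EK t tG); rewrite /horner_eval hornerZ hornerD hornerN hornerC.
  rewrite (horner_map cst) => ->; rewrite fmorphV mulKf ?fmorph_eq0 //.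
  by rewrite horner_prod; apply: eq_bigr => y _; rewrite hornerXsubC.
pose e (a : 'I_p) := (h ^+ (s * a))%g i0.
have split_prod (F : 'I_(d ^ k.+1) -> {poly Omega}) :
    \prod_(y in orb R' i0) F y = \prod_(a < p) \prod_(y in orb R (e a)) F y.
  rewrite -(@finset.partition_disjoint_bigcup _ _ _ _ _ (fun a => orb R (e a))).
    apply: eq_bigl => y; rewrite blocks; apply/existsP/finset.bigcupP => -[a]; first by exists a.
    by move=> _; exists a.
  move=> a b; apply: contraNT => /pred0Pn[y /= /andP[ya yb]]; apply/eqP/disj.
  by apply: orbit_trans yb; rewrite orbit_sym.
have I3 : map_poly cst qK - ((map_poly cst qK).[r i0])%:P =
    (cst C)%:P * \prod_(a < p) (map_poly cst qk - ((map_poly cst qk).[r (e a)])%:P).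
  have := EK 1%g (group1 _); rewrite perm1 => ->; rewrite split_prod.
  have -> : \prod_(a < p) (map_poly cst qk - ((map_poly cst qk).[r (e a)])%:P) =
      (cst (lead_coef qk ^+ p))%:P * \prod_(a < p) \prod_(y in orb R (e a)) ('X - (r y)%:P).
    under eq_bigr => a _ do rewrite Ek ?groupX // -mul_polyC.
    by rewrite big_split /= prodr_const card_ord -polyC_exp -(rmorphXn cst).
  by rewrite mulrA -polyCM -rmorphM divfK ?expf_neq0 // mul_polyC.
have [x x0 Gx] := Grc 0; rewrite expg0 perm1 in Gx.
pose X (a : 'I_p) := sval (cid2 (Grc (s * a))).
have X0 a : ps0 (X a) = c by rewrite /X; case: cid2.
have GX a : Gr (tofrac (X a), r (e a)) by rewrite /X; case: cid2.
pose qP (q : {poly Kbar}) (x : ps) : {poly ps} :=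
  mapC q - ((mapC q).[x])%:P.
have GqP q y z : Gr (tofrac y, z) ->
    poly_graph Gr (qP q y) (map_poly cst q - ((map_poly cst q).[z])%:P).
  move=> Gy; apply: poly_graphB => // [i|]; first by rewrite !coef_map; exact: Gk.
  by apply: poly_graphC => //; rewrite -psL_map; exact: fgraph_horner.
(* The factorization holds over [Omega]; it is pulled back along [Gr] to power series, where
   constant terms can be taken. *)
have : qP qK x = (psC C)%:P * \prod_(a < p) qP qk (X a).
  apply: (poly_graph_inj gG (GqP _ _ _ Gx)); rewrite I3.
  apply: poly_graphM => //; first by apply: poly_graphC => //; exact: Gk.
  by apply: poly_graph_prod => // a; exact: GqP.
move=> /(congr1 (map0)).
have red q y : ps0 y = c -> map0 (qP q y) = q - (q.[c])%:P.
  move=> y0; rewrite rmorphB /= map_polyC -(map_poly_comp (@ps0 Kbar)) map_poly_id //=.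
  by rewrite -y0 -horner_map -(map_poly_comp (@ps0 Kbar)) map_poly_id.
rewrite red // rmorphM rmorph_prod /= map_polyC /= psCK mul_polyC => ->.
congr (_ *: _); under eq_bigr => a _ do rewrite red ?X0 //.
by rewrite prodr_const card_ord.
Qed.

(** Up to a constant, [f(c) - u] is the product of [c - x] over the children [x] of [u]. It is
    grouped by the blocks of [R'], which are conjugate to that of [i0], and each partial product is
    a [p]-th power by [block_reduction]. Constants are [p]-th powers since [p] is nonzero in
    [Kbar]. *)
Lemma block_power : is_power p (cst fb.[c] - u).
Proof.
have [qK [qk [C El Eq]]] := block_reduction.
have Qorb t : t \in Gm -> is_power p (\prod_(y in orb R' (t i0)) (cst c - r y)).
  move=> /El[l ->]; apply: is_powerM (is_power_cst _ p0) _.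
  rewrite (horner_pow_shift cst _ Eq).
  apply: is_powerM (is_power_cst _ p0) _; eexists; last by [].
  by rewrite rpredB ?horner_mem ?cst_mem ?(r_mem rP).
pose X := [set i | (fO 1).[r i] == u].
have actX : [acts R', on X | 'P].
  apply/actsP => t tR' i; rewrite !finset.inE.
  have /induced_setP[g gu gt] := fintype.subsetP (normal_sub nR') _ tR'.
  apply/eqP/eqP => /= E.
    apply: (galact_inj (g := g)); rewrite ?horner_mem ?(r_mem rP) ?(level_mem lu) //.
    by rewrite galact_horner ?(r_mem rP) // gt E.
  by rewrite /aperm -gt -galact_horner ?(r_mem rP) // E.
have [rs [urs rsP Ers]] := fiber_product 1 c (transc_level lu).
have prs : perm_eq rs [seq r i | i <- enum X].
  apply: uniq_perm; rewrite ?map_inj_uniq ?enum_uniq // => z.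
  apply/idP/mapP => [/rsP zu|[i]].
    have [|i Ei] := (rP z).1; first by rewrite -addn1 /level /= fO_D zu.
    by exists i => //; rewrite mem_enum finset.inE -Ei zu.
  by rewrite mem_enum finset.inE => /eqP iu ->; apply/rsP.
have Qprod : is_power p (\prod_(i in X) (cst c - r i)).
  have /and3P[/eqP covX tX _] := orbit_partition actX.
  rewrite -{1}covX finset.big_trivIset //. elim/big_rec: _ => [|A z]; first by rewrite -(rmorph1 cst); exact: is_power_cst.
  move=> /imsetP[i]; rewrite finset.inE => /eqP/fiber[t tG ->] -> Qz; apply: is_powerM Qz.
  exact: Qorb.
rewrite fiter1 in Ers; rewrite Ers.
by rewrite (perm_big _ prs) big_map big_enum; apply: is_powerM (is_power_cst _ p0) _.
Qed.

End BlockPower.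

Section CriticalCase.

Variables (c : Kbar) (e k : nat) (h : {poly Kbar}).
Hypothesis fE : fb - (fb.[c])%:P = ('X - c%:P) ^+ e * h.
Hypotheses (hc : h.[c] != 0) (e0 : e%:R != 0 :> Kbar) (e1 : (1 < e)%N).
Hypothesis late : forall c' m, c' \in cs -> (0 < m <= k)%N ->
  (fiter fb k).[fb.[c]] != (fiter fb m).[c'].
Hypothesis Phik : forall g : G, fix_level k g -> frattini (arboreal_group iota f j) g.

Lemma critical_not_frattini : False.
Proof.
have [Gr [g [x0 [[gG Gk] fixg [lx0 gx0] Gx [gex0 gbeta]]]]] :=
  critical_inertia fE hc e0 e1 late.
pose u := (fO 1).[x0].
have lu : level k u by apply: level_up; rewrite addn1.
have [r [r_inj rP]] := level_roots k.+1.
have [i0 Ei0] := (rP x0).1 lx0.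
have r0u : (fO 1).[r i0] = u by rewrite -Ei0.
have lr i : level (k + 1) (r i) by rewrite addn1; apply/rP; exists i.
have [_ [tau [z0 [_ _ lz0 tr _]]]] := inertia_infinity (k + 1).
have [tau_k _ tau1] := cyclic_below lz0 tr.
have [t gt] := induces_ex r_inj rP (tau ^+ (d ^ k))%g.
have [hp gh] := induces_ex r_inj rP g.
pose P := level_kernel k rP; pose Gm := stab_group rP lu.
pose X := [set i | (fO 1).[r i] == u].
have tP : t \in P by apply/induced_setP; exists (tau ^+ (d ^ k))%g.
have hP : hp \in P by apply/induced_setP; exists g.
have sPG : P \subset Gm.
  by apply/fintype.subsetP => s /induced_setP[s' s'k ss']; apply/induced_setP; exists s' => //; exact: s'k.
have nPG : (P <| Gm)%g.
  apply: normalS sPG _ (level_kernel_normal k rP).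
  by apply/fintype.subsetP => s /induced_setP[s' _ ss']; exact: induces_level_group ss'.
have x0X : i0 \in X by rewrite finset.inE r0u.
have GX s i : s \in Gm -> i \in X -> s i \in X.
  move=> /induced_setP[s' s'u ss']; rewrite !finset.inE => /eqP iu.
  by rewrite -ss' -galact_horner ?(r_mem rP) // iu s'u.
have tX i : i \in X -> exists m, i = (t ^+ m)%g i0.
  rewrite finset.inE => /eqP iu; have [|m Em] := tau1 (r i0) (r i) (lr _) (lr _).
    by rewrite r0u iu.
  by exists m; apply: r_inj; rewrite Em (induces_exp rP m gt).
have hx0 : hp i0 != i0 by apply: contraNneq gx0 => E; rewrite Ei0 gh E.
have nilP := level_kernel_nilpotent r_inj rP Phik.
have [R [R' [p [s [pr_p nR nR' blocks [disj pm]]]]]] := block_step nPG nilP tP hP x0X GX tX hx0.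
have pe : (p %| e)%N.
  by apply: pm; apply: r_inj; rewrite -(induces_exp rP e gh) -Ei0.
have p0 : p%:R != 0 :> Kbar.
  by apply: contraNneq e0 => E; have /dvdnP[m ->] := pe; rewrite natrM E mulr0.
have [W WM EW] : is_power p (cst fb.[c] - u).
  apply: (block_power r_inj r0u nR nR' _ _ blocks disj gG Gk _ p0).
  - exact: (fintype.subsetP sPG).
  - move=> i iu; have [|m ->] := tX i; first by rewrite finset.inE iu.
    by exists (t ^+ m)%g => //; rewrite groupX // (fintype.subsetP sPG).
  - by move=> m; rewrite -(induces_exp rP m gh) -Ei0.
(* The Galois group is transitive on level [k] by the cycle at infinity, so the property of [u]
   passes to every vertex of the level. *)
have Qlevel v : level k v -> is_power p (cst fb.[c] - v).
  have [_ [tauk [zk [_ _ lzk0 trk _]]]] := inertia_infinity k.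
  move=> /trk[m ->]; have [m' Em'] := trk u lu.
  pose s' := ((tauk ^+ m) * (tauk ^+ m')^-1)%g.
  have -> : galact (tauk ^+ m)%g zk = galact s' u.
    by rewrite /s' galact_mul ?(level_mem lu) // Em' galactVK // (level_mem lzk0).
  exists (galact s' W); first exact: galact_mem.
  by rewrite -galactX // -EW galactB ?cst_mem ?(level_mem lu) // galact_cst.
(* [f^k(f(c)) - t] is a constant times the product of [f(c) - v] over level [k]; the constants, the
   sign included, are [p]-th powers. *)
have [rs [_ rsP Ers]] := fiber_product k fb.[c] transc_t.
have [beta bM bE] : is_power p (tO - cst (fiter fb k).[fb.[c]]).
  have -> : tO - cst (fiter fb k).[fb.[c]] = cst (-1) * (cst (fiter fb k).[fb.[c]] - tO).
    by rewrite rmorphN rmorph1 mulN1r opprB.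
  rewrite Ers; do 2!apply: is_powerM (is_power_cst _ p0) _.
  rewrite big_seq; elim/big_rec: _ => [|z y /rsP zr Qy]; first by rewrite -(rmorph1 cst); exact: is_power_cst.
  by apply: is_powerM Qy; exact: Qlevel.
have := gbeta p beta p0 (prime_gt1 pr_p) pe bM (esym bE).
by rewrite (frattini_kummer pr_p p0 bM (esym bE) (Phik fixg)) eqxx.
Qed.

End CriticalCase.

End Arboreal.

(** * Multiplicities and the shape of a unicritical polynomial *)

Lemma multiplicity_ex (k : fieldType) (f : {poly k}) (c : k) : (1 < size f)%N ->
  exists e u, f - (f.[c])%:P = ('X - c%:P) ^+ e * u /\ u.[c] != 0.
Proof.
move=> f1; have [e [u uc Ef]] := multiplicity_XsubC (f - (f.[c])%:P) c.
have fc0 : f - (f.[c])%:P != 0.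
  by rewrite subr_eq0; apply: contraTneq f1 => ->; rewrite -leqNgt size_polyC_leq1.
by exists e, u; rewrite Ef mulrC; split=> //; rewrite fc0 in uc.
Qed.

Lemma deriv_multiplicity (k : fieldType) (f u : {poly k}) (c b : k) (e : nat) :
  f - b%:P = ('X - c%:P) ^+ e.+1 * u ->
  f^`() = ('X - c%:P) ^+ e * (e.+1%:R *: u + ('X - c%:P) * u^`()).
Proof.
move=> /(congr1 (@deriv k)); rewrite derivB derivC subr0 => ->.
by rewrite derivM deriv_exp derivXsubC mul1r /= exprSr -mulrA mulrDr scaler_nat mulrnAr mulrnAl.
Qed.

Lemma critical_multiplicity (k : fieldType) (f u : {poly k}) (c : k) (e : nat) :
  root f^`() c -> f - (f.[c])%:P = ('X - c%:P) ^+ e * u -> u.[c] != 0 -> (1 < e)%N.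
Proof.
case: e => [|[|e]] // rc fE uc.
  by have := congr1 (horner_eval c) fE; rewrite /horner_eval expr0 mul1r !hornerE subrr => E; rewrite -E eqxx in uc.
have := deriv_multiplicity fE; rewrite expr0 mul1r scale1r => E.
by move: rc; rewrite E rootE !hornerE subrr mul0r addr0 (negPf uc).
Qed.

Lemma size_deriv_tame (k : fieldType) (f : {poly k}) : (1 < size f)%N ->
  ((size f).-1)%:R != 0 :> k -> size f^`() = (size f).-1.
Proof.
move=> f1 d0; have fpos := ltnW f1; have f0 : f != 0 by rewrite -size_poly_gt0.
apply/eqP; rewrite eqn_leq -ltnS prednK // lt_size_deriv //= leqNgt; apply/negP => lt.
have dpos : (0 < (size f).-1)%N by rewrite -subn1 subn_gt0.
have : f^`()`_((size f).-2) = 0 by rewrite nth_default // -ltnS prednK.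
rewrite coef_deriv prednK // -lead_coefE -mulr_natr => /eqP.
by rewrite mulf_eq0 lead_coef_eq0 (negPf f0) (negPf d0).
Qed.

(** The derivative is a constant times [(X - c)^(deg f - 1)], while its multiplicity at [c] is
    exactly [e - 1] because [e] is nonzero in [k]. So [e = deg f] and the cofactor [u] is
    constant. *)
Lemma unicritical_shape (k : fieldType) (f u : {poly k}) (cs : seq k) (c : k) (e : nat) :
  (1 < size f)%N -> ((size f).-1)%:R != 0 :> k ->
  f^`() %= \prod_(x <- cs) ('X - x%:P) -> root f^`() c ->
  (forall x, root f^`() x -> x = c) ->
  f - (f.[c])%:P = ('X - c%:P) ^+ e * u -> u.[c] != 0 -> e%:R != 0 :> k ->
  exists2 a, a != 0 & f = a *: ('X - c%:P) ^+ (size f).-1 + (f.[c])%:P.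
Proof.
move=> f1 d0 fcs rc uc1 fE uc e0; have e1 := critical_multiplicity rc fE uc.
have cs_c x : x \in cs -> x = c by move=> xcs; apply: uc1; rewrite (eqp_root fcs) root_prod_XsubC.
have fcs' : f^`() %= ('X - c%:P) ^+ size cs.
  apply: eqp_trans fcs _; rewrite (eq_big_seq (fun=> 'X - c%:P)) => [|x /cs_c -> //].
  by rewrite big_const_seq count_predT iter_mulr_1 eqpxx.
have scs : size cs = (size f).-2.
  by have := eqp_size fcs'; rewrite size_exp_XsubC size_deriv_tame // => ->.
have u0 : u != 0 by apply: contraNneq uc => ->; rewrite horner0.
have sfc : size (f - (f.[c])%:P) = size f.
  by rewrite size_polyDl // size_polyN (leq_ltn_trans (size_polyC_leq1 _)).
have size_eu : size f = (e + size u)%N.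
  by rewrite -sfc fE size_monicM ?monic_exp ?monicXsubC // size_exp_XsubC.
have lee : ((size f).-1 <= e)%N.
  case: e e0 e1 fE {size_eu} => // e e0 e1 fE.
  rewrite leqNgt; apply/negP => lte.
  have dpos : (0 < (size f).-1)%N by rewrite -subn1 subn_gt0.
  have lt : (e.+1 <= size cs)%N by rewrite scs -ltnS prednK.
  have : ('X - c%:P) ^+ e * ('X - c%:P) %| f^`().
    by rewrite (eqp_dvdr _ fcs') -exprSr dvdp_exp2l.
  rewrite (deriv_multiplicity fE) dvdp_mul2l ?expf_neq0 ?polyXsubC_eq0 //.
  rewrite dvdp_XsubCl rootE !hornerE subrr mul0r addr0 mulf_eq0 (negPf uc) orbF.
  by rewrite (negPf e0).
have su : size u = 1%N.
  apply/eqP; rewrite eqn_leq size_poly_gt0 u0 andbT -(leq_add2l e) -size_eu addn1.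
  by rewrite -(prednK (ltnW f1)) ltnS.
have ee : e = (size f).-1 by rewrite size_eu su addn1.
have /size_poly1P[a a0 ua] : size u == 1%N by rewrite su.
by exists a => //; rewrite -ee -mul_polyC -ua mulrC -fE subrK.
Qed.

(** Of two distinct primes at least one is odd; it takes the role of [r]. *)
Lemma prime_power_or (d : nat) : (1 < d)%N ->
  (exists p s, [/\ prime p, (0 < s)%N & d = (p ^ s)%N]) \/
  exists q r, [/\ prime q, prime r, (q %| d)%N, (r %| d)%N & odd r /\ q != r].
Proof.
move=> d1; have pr_p := pdiv_prime d1; set p := pdiv d in pr_p.
have pd : (p %| d)%N := pdiv_dvd d.
have [/p_natP[s ds]|/negP npd] := boolP (p.-nat d).
  by left; exists p, s; split=> //; case: s ds => // ds; rewrite ds in d1.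
right; have [q [pr_q qd qp]] : exists q, [/\ prime q, (q %| d)%N & q != p].
  apply: contrapT => no; apply: npd; apply/pnatP => [|q pr_q qd]; first exact: ltnW.
  by rewrite inE; apply: contrapT => /negP qp; apply: no; exists q.
have [oddp|evenp] := boolP (odd p); first by exists q, p.
have [p2|] := even_prime pr_p; last by rewrite (negPf evenp).
exists p, q; split=> //; split; last by rewrite eq_sym.
by have [q2|//] := even_prime pr_q; rewrite p2 q2 eqxx in qp.
Qed.

(** [a] and [c] are given in [Kbar], whereas the conjugacy is sought over an extension of [K]. Both
    come from [K]: [a] is the leading coefficient of [f], and the next coefficient is [- d a c] with
    [d] nonzero. After adjoining [z] with [z^(d-1) = 1/a], the map [z X + c] conjugates [f] to
    [X^d]. *)
Lemma powering_conjugate (K Kbar : fieldType) (iota : {rmorphism K -> Kbar}) (f : {poly K})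
    (a c : Kbar) (d : nat) : a != 0 -> (1 < d)%N -> d%:R != 0 :> Kbar ->
  map_poly iota f = a *: ('X - c%:P) ^+ d + c%:P -> conjugate_to_powering_map f.
Proof.
move=> a0 d1 d0 fE; have dpos := ltnW d1.
have sXc : size (('X - c%:P) ^+ d) = d.+1 by rewrite size_exp_XsubC.
have coefd : iota f`_d = a.
  rewrite -coef_map fE coefD coefZ coefC gtn_eqF // addr0.
  have /monicP := monic_exp d (monicXsubC c).
  by rewrite lead_coefE sXc => ->; rewrite mulr1.
have coefd1 : iota f`_d.-1 = - (a * c *+ d).
  have E : ('X - c%:P) ^+ d = \prod_(z <- nseq d c) ('X - z%:P).
    by rewrite big_nseq iter_mulr_1.
  (* [d > 1] keeps the added constant [c] out of the coefficient of degree [d - 1]. *)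
  have dn0 : (d.-1 == 0)%N = false by rewrite gtn_eqF // -subn1 subn_gt0.
  rewrite -coef_map fE coefD coefZ coefC dn0 addr0 E.
  have := @coefPn_prod_XsubC _ (nseq d c); rewrite size_nseq => -> //.
    by rewrite big_nseq iter_addr_0 mulrN mulrnAr.
  by rewrite gtn_eqF.
pose a1 := f`_d; pose c1 := - f`_d.-1 / (a1 * d%:R).
have ia : iota a1 = a by [].
have ic : iota c1 = c.
  rewrite fmorph_div rmorphN coefd1 opprK rmorphM ia rmorph_nat -mulr_natr [a * c * _]mulrAC.
  have -> : a * d%:R * c = c * (a * d%:R) by exact: mulrC.
  by rewrite mulfK // mulf_neq0.
have a10 : a1 != 0 by rewrite -(fmorph_eq0 iota) ia.
have fE1 : f = a1 *: ('X - c1%:P) ^+ d + c1%:P.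
  apply: (map_poly_inj iota); rewrite fE rmorphD /= map_polyZ rmorphXn rmorphB /= map_polyX.
  by rewrite !map_polyC /= ia ic.
have sg : (1 < size ('X^(d.-1) - (a1^-1)%:P)%R)%N.
  have dn0 : (0 < d.-1)%N by rewrite -subn1 subn_gt0.
  by rewrite size_XnsubC.
have [p irr pg] := irreducible_factor_ex sg.
have [L _ [z rz _]] := irredp_FAdjoin irr.
have z1 : z ^+ d.-1 = (in_alg L a1)^-1.
  have /dvdpP[q Eq] := pg; have := congr1 (fun g => (map_poly (in_alg L) g).[z]) Eq.
  rewrite rmorphM hornerM (rootP rz) mulr0 rmorphB /= map_polyXn map_polyC !hornerE.
  by move=> /eqP; rewrite subr_eq0 => /eqP ->; rewrite -(fmorphV (in_alg L)).
have ia0 : in_alg L a1 != 0 by rewrite fmorph_eq0.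
have z0 : z != 0.
  apply: contraTneq ia0 => z0; rewrite -invr_eq0 -z1 z0 expr0n gtn_eqF ?eqxx //.
  by rewrite -subn1 subn_gt0.
exists L, (in_alg L), z, (in_alg L c1), d; split=> //.
have azd : in_alg L a1 * z ^+ d = z by rewrite -(prednK dpos) exprSr z1 mulVKf.
rewrite {1}fE1 rmorphD /= map_polyZ rmorphXn rmorphB /= map_polyX !map_polyC /=.
rewrite comp_polyD comp_polyZ rmorphXn /= !comp_polyD !comp_polyC !comp_polyZ !comp_polyX.
rewrite -[- _ \Po _]/(comp_poly _ (- _)) raddfN /= comp_polyC addrK.
by rewrite exprZn scalerA [_ * _]azd.
Qed.

(** * The two cases for tame polynomials *)

Lemma post_critically_infinite_false (K Kbar Omega : fieldType) (iota : {rmorphism K -> Kbar})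
    (j : {rmorphism ratfun Kbar -> Omega}) (f : {poly K}) :
  separably_closed Kbar -> separable_closure j -> tamely_ramified iota f ->
  open (frattini (arboreal_group iota f j)) -> post_critically_infinite iota f -> False.
Proof.
move=> hK hO [phi [phiC phiX tame]] openF pci.
have f1 := tame_size phiC phiX; have d0 := tame_degree phiC phiX tame.
have [cs fcs] := critical_splits phiC phiX tame hK.
have csP c : critical_point iota f c <-> c \in cs.
  by rewrite /critical_point (eqp_root fcs) root_prod_XsubC.
have [c cin late] : exists2 c, c \in cs & forall c' m n, c' \in cs -> (m < n)%N ->
    iter n (horner (map_poly iota f)) c <> iter m (horner (map_poly iota f)) c'.
  apply: late_orbit_ex; apply: sub_infinite_set pci => y [c [n [/csP cin n0 ->]]].
  by exists c, n.
have [k Phik] := frattini_level hO fcs f1 openF.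
have [e [u [fE uc]]] := multiplicity_ex c f1.
have e0 := tame_mult phiC phiX tame fE uc.
have e1 := critical_multiplicity ((csP c).2 cin) fE uc.
apply: (critical_not_frattini hK hO fcs f1 d0 fE uc e0 e1 _ Phik) => c' m c'in /andP[_ lemk].
by rewrite !horner_fiter -iterSr; apply/eqP/late.
Qed.

Lemma unicritical_conclusion (K Kbar Omega : fieldType) (iota : {rmorphism K -> Kbar})
    (j : {rmorphism ratfun Kbar -> Omega}) (f : {poly K}) :
  separably_closed Kbar -> separable_closure j -> tamely_ramified iota f ->
  open (frattini (arboreal_group iota f j)) ->
  unicritical iota f -> ~ conjugate_to_powering_map f ->
  exists p s, [/\ prime p, (0 < s)%N, (size f).-1 = (p ^ s)%N
    & pro_p (arboreal_group iota f j) p].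
Proof.
move=> hK hO [phi [phiC phiX tame]] openF [c [rc uc1]] npow.
have f1 := tame_size phiC phiX; have d0 := tame_degree phiC phiX tame.
have [cs fcs] := critical_splits phiC phiX tame hK.
have [k Phik] := frattini_level hO fcs f1 openF.
have [e [u [fE uc]]] := multiplicity_ex c f1.
have e0 := tame_mult phiC phiX tame fE uc.
have [a a0 shape] := unicritical_shape f1 d0 fcs rc (fun x rx => esym (uc1 x rx)) fE uc e0.
(* The derivative has a root and is nonzero, so it is nonconstant, and its size is [deg f]. *)
have d1 : (1 < (size (map_poly iota f)).-1)%N.
  rewrite -(size_deriv_tame f1 d0); have := root_size_gt1 _ rc; apply.
  by rewrite -size_poly_gt0 size_deriv_tame // -subn1 subn_gt0.
have bc : (map_poly iota f).[c] != c.
  apply/eqP => E; rewrite E in shape.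
  exact: npow (powering_conjugate a0 d1 d0 shape).
have [[p [s [pr_p s0 ds]]]|[q [r [pr_q pr_r qd rd [odd_r qr]]]]] := prime_power_or d1.
  exists p, s; split=> //; first by rewrite -ds size_map_poly.
  exact: (unicritical_pro_p hK hO fcs f1 d0 a0 shape pr_p ds).
case: (unicritical_not_frattini hK hO fcs f1 d0 a0 shape Phik bc pr_q pr_r qd rd odd_r qr).
Qed.

Theorem corollary35 (K Kbar Omega : fieldType)
    (iota : {rmorphism K -> Kbar}) (hKbar : separable_closure iota)
    (j : {rmorphism ratfun Kbar -> Omega}) (hOmega : separable_closure j)
    (f : {poly K}) (hf : tamely_ramified iota f)
    (hfrat : open (frattini (arboreal_group iota f j)))
    (hcase : post_critically_infinite iota f \/
             (unicritical iota f /\ ~ conjugate_to_powering_map f)) :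
  (exists p : nat, prime p /\ pro_p (arboreal_group iota f j) p) /\
  prime_power (size f).-1.
Proof.
have [_ hK] := hKbar.
case: hcase => [pci|[uf npow]].
  by case: (post_critically_infinite_false hK hOmega hf hfrat pci).
have [p [s [pr_p s0 ds pG]]] := unicritical_conclusion hK hOmega hf hfrat uf npow.
by split; [exists p|exists p, s].
Qed.
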